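(* Fix the parameters, and hence $b_n^x$, and let $(m,\epsilon_1,\epsilon_2)$ be a label for $n$. Whenever $\alpha^{(n,m)}_{\epsilon_1,\epsilon_2}\in k$, the central element $Z_n$ acts on $W^{n,m}_{\epsilon_1,\epsilon_2}$ as multiplication by the scalar $$\alpha^{(n,m)}_{\epsilon_1,\epsilon_2}=[n]\,\frac{[2(-m+\epsilon_1w_1+\epsilon_2w_2)]}{[-m+\epsilon_1w_1+\epsilon_2w_2]}=[n]\left(q^{-m}Q_1^{\epsilon_1}Q_2^{\epsilon_2}+q^{m}Q_1^{-\epsilon_1}Q_2^{-\epsilon_2}\right).$$
   Context: \textbf{The algebra $b_n^x$.} Fix $n\ge1$, a field $k$ and $(\delta,\delta_L,\delta_R,\kappa_L,\kappa_R,\kappa_{LR})\in k^6$. Consider planar Temperley--Lieb diagrams in a rectangle with $n$ top and $n$ bottom nodes (strings are top arcs, bottom arcs, propagating lines, and possibly closed loops), up to isotopy, whose strings may carry left blobs $L$ (which can be deformed to touch the left wall) and right blobs $R$ (right wall), obtained by stacking copies of: $e_0$ (identity diagram with one $L$ on the first string), $e_i$ for $1\le i\le n-1$ (top arc $\{i,i+1\}$, bottom arc $\{i,i+1\}$, all other strings vertical), $e_n$ (identity diagram with one $R$ on the last string). Straightening relations: undecorated loop $\to\delta$; consecutive $LL$ on a string $\to\delta_L\,L$; consecutive $RR\to\delta_R\,R$; loop with one $L$ $\to\kappa_L$; loop with one $R$ $\to\kappa_R$; loop with one $L$ and one $R$ $\to\kappa_{LR}$; consecutive $LRL$ on a string $\to\kappa_{LR}L$;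 consecutive $RLR\to\kappa_{LR}R$; and the topological relation: a diagram without propagating lines having a top arc and a bottom arc each decorated with one $L$ and one $R$ is $\kappa_{LR}$ times the diagram obtained by replacing these two arcs by two vertical propagating lines joining their left endpoints and their right endpoints, the left one carrying one $L$ and the right one carrying one $R$. The symplectic blob algebra $b_n^x$ is the $k$-algebra with basis the diagrams to which no relation applies; $dd'$ is obtained by stacking $d$ over $d'$ and straightening until no relation applies (the result is well defined). \textbf{Cell modules.} A label for $n$ is $(m,\epsilon_1,\epsilon_2)$ with $0\le m\le n-1$, $m\equiv n-1 \pmod 2$, $\epsilon_i\in\{\pm1\}$ (written $\pm$), where $m=0$ is allowed only with $\epsilon_1=\epsilon_2=+1$, and $(1,-1,-1)$ is not allowed. The left $b_n^x$-module $W^{n,m}_{\epsilon_1,\epsilon_2}$ has as basis the (reduced) upper half-diagrams on $n$ nodes with exactly $m+1$ propagating lines, the leftmost carrying one $L$ iff $\epsilon_1=-1$, the rightmost carrying one $R$ iff $\epsilon_2=-1$, propagating lines being otherwise undecorated, and each arc exposed to the left (resp. right) wall carrying at most one $L$ (resp. $R$). Diagrams act by stacking on top and straightening; the result is $0$ if it has fewer propagating lines or its propagating lines carry a decoration not of this type. \textbf{Parameters.} $q,Q_1,Q_2\in k^\times$ with $q^2\ne1$, and $Q_i$ is written $q^{w_i}$, so that $[a+b_1w_1+b_2w_2]=\dfrac{q^aQ_1^{b_1}Q_2^{b_2}-q^{-a}Q_1^{-b_1}Q_2^{-b_2}}{q-q^{-1}}$ for integers $a,b_1,b_2$; assume $[w_1+1],[w_2+1]\neq0$.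 Set $\delta=[2]$, $\delta_L=[w_1]/[w_1+1]$, $\delta_R=[w_2]/[w_2+1]$, $\kappa_L=\kappa_R=1$, $\kappa_{LR}\in k$ arbitrary. \textbf{The element $Z_n$.} In $b_n^x$ put $g_i^{\pm1}=e_i-q^{\mp1}$ for $1\le i\le n-1$, $g_0^{\pm1}=Q_1^{\pm1}-(q^{\pm1}Q_1^{\pm1}-q^{\mp1}Q_1^{\mp1})e_0$, $g_n^{\pm1}=Q_2^{\pm1}-(q^{\pm1}Q_2^{\pm1}-q^{\mp1}Q_2^{\mp1})e_n$ (these are mutually inverse pairs). Let $J_0=g_1^{-1}g_2^{-1}\cdots g_{n-1}^{-1}g_ng_{n-1}\cdots g_2g_1g_0$, $J_i=g_iJ_{i-1}g_i$ for $1\le i\le n-1$, and $Z_n=\sum_{i=0}^{n-1}(J_i+J_i^{-1})$, which is known to be central in $b_n^x$. *)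

(* Defs.v *)
From mathcomp Require Import all_boot all_order all_algebra.
From mathcomp Require Import boolp.

Set Implicit Arguments.
Unset Strict Implicit.
Unset Printing Implicit Defensive.

Import GRing.Theory.
Local Open Scope ring_scope.

Definition blob := bool.
Definition bL : blob := false.
Definition bR : blob := true.

(* The reduced words are [::], L, R, LR and RL; the bound 2 on the size is only
   there to get a finite type. *)
Definition word := {bseq 2 of blob}.

Record blob_params (k : Type) := BlobParams {
  delta : k; deltaL : k; deltaR : k; kappaL : k; kappaR : k; kappaLR : k }.

Section Straightening.

Context {k : fieldType}.

Definition delta_of (P : blob_params k) (a : blob) : k :=
  if a == bL then deltaL P else deltaR P.

(* Reduced form of the word a :: u, where u is already reduced, together with
   the scalar coming from LL -> deltaL L, RR -> deltaR R, LRL -> kappaLR L and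
   RLR -> kappaLR R. *)
Definition cons_word (a : blob) (u : seq blob) : word :=
  match u with
  | [::] => [bseq a]
  | [:: b] => if a == b then [bseq b] else [bseq a; b]
  | b :: c :: _ => if a == b then [bseq b; c] else [bseq a]
  end.

Definition cons_coef (P : blob_params k) (a : blob) (u : seq blob) : k :=
  match u with
  | [::] => 1
  | b :: u' => if a == b then delta_of P a
               else if u' is _ :: _ then kappaLR P else 1
  end.

Fixpoint red_word (s : seq blob) : word :=
  if s is a :: s' then cons_word a (red_word s') else [bseq].

Fixpoint red_coef (P : blob_params k) (s : seq blob) : k :=
  if s is a :: s' then cons_coef P a (red_word s') * red_coef P s' else 1.

(* Value of a closed loop carrying a blobs L and b blobs R.  By planarity the
   blobs L are consecutive on the loop, and so are the blobs R, so that only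
   LL -> deltaL L and RR -> deltaR R apply before the loop is removed. *)
Definition loop_coef (P : blob_params k) (a b : nat) : k :=
  deltaL P ^+ a.-1 * deltaR P ^+ b.-1 *
  match a, b with
  | 0, 0 => delta P
  | _.+1, 0 => kappaL P
  | 0, _.+1 => kappaR P
  | _.+1, _.+1 => kappaLR P
  end.

End Straightening.

(* Nodes of a rectangle with n top nodes (inl) and l bottom nodes (inr), both
   numbered from 0, from left to right. *)
Definition node (n l : nat) := ('I_n + 'I_l)%type.

(* d x = (y, w) means that the string of d leaving x ends at y and carries the
   word w, read from x to y; the same string is thus also recorded at y, with
   the reversed word. *)
Definition ddiag (n l : nat) := {ffun node n l -> node n l * word}.

Definition partner n l (d : ddiag n l) (x : node n l) : node n l := (d x).1.
Definition deco n l (d : ddiag n l) (x : node n l) : word := (d x).2.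

Definition strands n (w : 'I_n -> word) : ddiag n n :=
  [ffun x => match x with inl j => (inr j, w j) | inr j => (inl j, w j) end].

Definition id_diag n : ddiag n n := strands (fun=> [bseq]).

(* For 1 <= i < n: exchanges the i-th and (i+1)-st nodes (i.-1 and i when
   counted from 0). *)
Definition swap_node n (i : nat) (j : 'I_n) : 'I_n :=
  if j == i.-1 :> nat then insubd j i
  else if j == i :> nat then insubd j i.-1 else j.

Definition cup_cap n (i : nat) : ddiag n n :=
  [ffun x => (match x with
              | inl j => if swap_node i j != j then inl (swap_node i j)
                         else inr j
              | inr j => if swap_node i j != j then inr (swap_node i j)
                         else inl j
              end, [bseq])].

Definition e_diag n (i : nat) : ddiag n n :=
  if i == 0%N then
    strands (fun j => if j == 0%N :> nat then [bseq bL] else [bseq])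
  else if i == n then
    strands (fun j => if j == n.-1 :> nat then [bseq bR] else [bseq])
  else cup_cap n i.

Section Stack.

Context {n l r : nat}.

(* From the j-th middle node, follow the string into d' (down = true) or into d
   (down = false) until it reaches an outer node; returns this node and the
   word read on the way.  A string meets each middle node at most once, so fuel
   l suffices, and the default x0 is never used. *)
Fixpoint walk (d : ddiag n l) (d' : ddiag l r) (x0 : node n r)
    (fuel : nat) (down : bool) (j : 'I_l) : node n r * seq blob :=
  if fuel isn't f.+1 then (x0, [::]) else
  if down then
    match partner d' (inl j) with
    | inr z => (inr z, deco d' (inl j) : seq blob)
    | inl j' => let: (y, w) := walk d d' x0 f false j' in
                (y, deco d' (inl j) ++ w)
    end
  else
    match partner d (inr j) with
    | inl z => (inl z, deco d (inr j) : seq blob)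
    | inr j' => let: (y, w) := walk d d' x0 f true j' in
                (y, deco d (inr j) ++ w)
    end.

Definition raw_string (d : ddiag n l) (d' : ddiag l r) (x : node n r) :
    node n r * seq blob :=
  match x with
  | inl i =>
    match partner d (inl i) with
    | inl z => (inl z, deco d (inl i) : seq blob)
    | inr j => let: (y, w) := walk d d' x l true j in
               (y, deco d (inl i) ++ w)
    end
  | inr i =>
    match partner d' (inr i) with
    | inr z => (inr z, deco d' (inr i) : seq blob)
    | inl j => let: (y, w) := walk d d' x l false j in
               (y, deco d' (inr i) ++ w)
    end
  end.

(* Stacking followed by all the straightening relations but the topological
   one: the resulting diagram, and the scalar in front of it. *)
Definition stack0 (d : ddiag n l) (d' : ddiag l r) : ddiag n r :=
  [ffun x => ((raw_string d d' x).1, red_word (raw_string d d' x).2)].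

(* The loops are the connected components of the graph of middle arcs in which
   every node lies both on a bottom arc of d and on a top arc of d'. *)
Definition middle_arc (d : ddiag n l) (d' : ddiag l r) : rel 'I_l := fun j j' =>
  (partner d (inr j) == inr j') || (partner d' (inl j) == inl j').

Definition middle_closed (d : ddiag n l) (d' : ddiag l r) (j : 'I_l) : bool :=
  [exists j1, partner d (inr j) == inr j1] &&
  [exists j2, partner d' (inl j) == inl j2].

(* j is the leftmost node of a loop *)
Definition loop_head (d : ddiag n l) (d' : ddiag l r) (j : 'I_l) : bool :=
  [forall j', connect (middle_arc d d') j j' ==>
     (j <= j')%N && middle_closed d d' j'].

(* Each blob of the loop is seen from both ends of its arc, hence the half. *)
Definition loop_count (d : ddiag n l) (d' : ddiag l r) (a : blob)
    (j : 'I_l) : nat :=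
  (\sum_(j' | connect (middle_arc d d') j j')
     (count_mem a (deco d (inr j')) + count_mem a (deco d' (inl j'))))./2%N.

(* In the first product each string is counted once, at its smaller end. *)
Definition stack0_coef {k : fieldType} (P : blob_params k)
    (d : ddiag n l) (d' : ddiag l r) : k :=
  (\prod_(x : node n r | (unsplit x < unsplit (raw_string d d' x).1)%N)
      red_coef P (raw_string d d' x).2) *
  \prod_(j | loop_head d d' j)
      loop_coef P (loop_count d d' bL j) (loop_count d d' bR j).

Definition no_propagating (d : ddiag n l) : bool :=
  [forall i : 'I_n, forall j : 'I_l, partner d (inl i) != inr j].

(* The arc with one L and one R at the top, resp. at the bottom (a planar
   diagram has at most one of each), given by its left and right ends. *)
Definition top_LR_arc (d : ddiag n l) : option ('I_n * 'I_n) :=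
  [pick p : 'I_n * 'I_n | [&& (p.1 < p.2)%N, partner d (inl p.1) == inl p.2
     & perm_eq (deco d (inl p.1)) [:: bL; bR]]].

Definition bottom_LR_arc (d : ddiag n l) : option ('I_l * 'I_l) :=
  [pick p : 'I_l * 'I_l | [&& (p.1 < p.2)%N, partner d (inr p.1) == inr p.2
     & perm_eq (deco d (inr p.1)) [:: bL; bR]]].

Definition topo (d : ddiag n l) : option (ddiag n l) :=
  if ~~ no_propagating d then None else
  match top_LR_arc d, bottom_LR_arc d with
  | Some (i1, i2), Some (j1, j2) =>
      Some [ffun x =>
        if x == inl i1 then (inr j1, [bseq bL])
        else if x == inr j1 then (inl i1, [bseq bL])
        else if x == inl i2 then (inr j2, [bseq bR])
        else if x == inr j2 then (inl i2, [bseq bR])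
        else d x]
  | _, _ => None
  end.

End Stack.

Definition stack n (d d' : ddiag n n) : ddiag n n :=
  odflt (stack0 d d') (topo (stack0 d d')).

Definition stack_coef {k : fieldType} (P : blob_params k) n
    (d d' : ddiag n n) : k :=
  stack0_coef P d d' * (if topo (stack0 d d') is Some _ then kappaLR P else 1).

(* The basis diagrams: the reduced diagrams obtained by stacking copies of
   e_0, ..., e_n.  Straightening such a stacking gives, up to a scalar, again
   such a stacking, so it is harmless to straighten at each step.  Planarity,
   and the fact that only exposed strings carry blobs, need not be imposed. *)
Inductive obtained n : ddiag n n -> Prop :=
| obtained_id : obtained (id_diag n)
| obtained_e i : (i <= n)%N -> obtained (e_diag n i)
| obtained_stack d d' : obtained d -> obtained d' -> obtained (stack d d').

Definition bdiag n := {d : ddiag n n | `[< obtained d >]}.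

Lemma obtained_stackP n (d d' : bdiag n) : `[< obtained (stack (val d) (val d')) >].
Proof.
by apply/asboolP/obtained_stack; apply/asboolP; [exact: (valP d)|exact: (valP d')].
Qed.

Lemma obtained_idP n : `[< obtained (id_diag n) >].
Proof. by apply/asboolP/obtained_id. Qed.

Lemma obtained_eP n (i : 'I_n.+1) : `[< obtained (e_diag n i) >].
Proof. by apply/asboolP/obtained_e; rewrite -ltnS. Qed.

Definition bstack n (d d' : bdiag n) : bdiag n :=
  exist _ (stack (val d) (val d')) (obtained_stackP d d').

Section Algebra.

Context {k : fieldType} (P : blob_params k) {n : nat}.

Definition sblob := {ffun bdiag n -> k^o}.

Definition bbasis (d : bdiag n) : sblob := [ffun d' => (d' == d)%:R].

Definition bone : sblob := bbasis (exist _ (id_diag n) (obtained_idP n)).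
Definition be (i : 'I_n.+1) : sblob := bbasis (exist _ (e_diag n i) (obtained_eP i)).

Definition bmul (a b : sblob) : sblob :=
  \sum_d \sum_d' (a d * b d' * stack_coef P (val d) (val d')) *: bbasis (bstack d d').

End Algebra.

Arguments sblob k n : clear implicits.

Definition is_label (n m : nat) (eps1 eps2 : int) : bool :=
  [&& (m <= n.-1)%N, m == n.-1 %[mod 2],
      eps1 \in [:: 1; -1], eps2 \in [:: 1; -1],
      (m == 0%N) ==> (eps1 == 1) && (eps2 == 1)
    & ~~ [&& m == 1%N, eps1 == -1 & eps2 == -1]].

(* A half-diagram on n nodes with l propagating lines is encoded as a diagram
   with n top nodes, l bottom nodes and no bottom arc, whose j-th bottom node is
   the lower end of the j-th propagating line. *)
Section HalfDiagrams.

Context {n l : nat}.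
Implicit Types (d : ddiag n l) (i j : 'I_n).

Definition wf_strings d : bool :=
  [forall x, [&& partner d x != x, partner d (partner d x) == x
    & (deco d (partner d x) : seq blob) == rev (deco d x)]].

Definition no_bottom_arc d : bool :=
  [forall b : 'I_l, exists i, partner d (inr b) == inl i].

(* Position on the boundary of the rectangle, read clockwise from the top left
   corner. *)
Definition boundary_pos (x : node n l) : nat :=
  match x with inl i => i | inr b => (n + (l - b.+1))%N end.

Definition planar d : bool :=
  [forall x, forall y,
    ~~ [&& boundary_pos x < boundary_pos y,
           boundary_pos y < boundary_pos (partner d x)
         & boundary_pos (partner d x) < boundary_pos (partner d y)]%N].

(* For a top arc {i, j} with i < j: no propagating line to its left (resp.
   right) and no arc around it. *)
Definition exposed_left d i j : bool :=
  [forall i' : 'I_n, (i' < i)%N ==>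
     if partner d (inl i') is inl j' then (j' < j)%N else false].

Definition exposed_right d i j : bool :=
  [forall j' : 'I_n, (j < j')%N ==>
     if partner d (inl j') is inl i' then (i < i')%N else false].

Definition arcs_ok d : bool :=
  [forall i : 'I_n, forall j : 'I_n,
    ((i < j)%N && (partner d (inl i) == inl j)) ==>
    [|| deco d (inl i) == [bseq],
        exposed_left d i j && (deco d (inl i) == [bseq bL])
      | exposed_right d i j && (deco d (inl i) == [bseq bR])]].

Definition lines_ok (eps1 eps2 : int) d : bool :=
  [forall b : 'I_l,
    (deco d (inr b) : seq blob) ==
      (if (b == 0%N :> nat) && (eps1 == -1) then [:: bL] else [::]) ++
      (if (b == l.-1 :> nat) && (eps2 == -1) then [:: bR] else [::])].

Definition is_half (eps1 eps2 : int) d : bool :=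
  [&& wf_strings d, no_bottom_arc d, planar d, arcs_ok d & lines_ok eps1 eps2 d].

End HalfDiagrams.

Definition hdiag (n m : nat) (eps1 eps2 : int) :=
  {d : ddiag n m.+1 | is_half eps1 eps2 d}.

Section CellModule.

Context {k : fieldType} (P : blob_params k) {n m : nat} {eps1 eps2 : int}.

Definition cellmod := {ffun hdiag n m eps1 eps2 -> k^o}.

Definition cbasis (h : hdiag n m eps1 eps2) : cellmod := [ffun h' => (h' == h)%:R].

(* The topological relation plays no role here: a stack without propagating
   lines acts as 0 anyway. *)
Definition act_basis (d : ddiag n n) (h : hdiag n m eps1 eps2) : cellmod :=
  if insub (stack0 d (val h)) is Some h'
  then stack0_coef P d (val h) *: cbasis h' else 0.

Definition act (a : sblob k n) (v : cellmod) : cellmod :=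
  \sum_d \sum_h (a d * v h) *: act_basis (val d) h.

End CellModule.

Arguments cellmod k n m eps1 eps2 : clear implicits.

Section Central.

Context {k : fieldType} (q Q1 Q2 : k).

(* The quantum number [a + b1 w1 + b2 w2], where Qi = q^wi. *)
Definition qnum (a b1 b2 : int) : k :=
  (q ^ a * Q1 ^ b1 * Q2 ^ b2 - q ^ (- a) * Q1 ^ (- b1) * Q2 ^ (- b2)) / (q - q^-1).

Definition qparams (kLR : k) : blob_params k := {|
  delta := qnum 2 0 0;
  deltaL := qnum 0 1 0 / qnum 1 1 0;
  deltaR := qnum 0 0 1 / qnum 1 0 1;
  kappaL := 1;
  kappaR := 1;
  kappaLR := kLR |}.

Context (kLR : k) (n : nat).

(* g_i^s for s = 1 or -1 *)
Definition g (i : 'I_n.+1) (s : int) : sblob k n :=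
  if i == 0%N :> nat then
    Q1 ^ s *: bone - (q ^ s * Q1 ^ s - q ^ (- s) * Q1 ^ (- s)) *: be i
  else if i == n :> nat then
    Q2 ^ s *: bone - (q ^ s * Q2 ^ s - q ^ (- s) * Q2 ^ (- s)) *: be i
  else be i - q ^ (- s) *: bone.

(* A list of pairs (i, s) stands for the product of the g_i^s in this order,
   which geval brackets to the right. *)
Definition gword := seq (nat * int).

Definition geval (w : gword) : sblob k n :=
  foldr (fun x a => bmul (qparams kLR) (g (inord x.1) x.2) a) bone w.

Definition ginv (w : gword) : gword := [seq (x.1, - x.2) | x <- rev w].

Definition J0word : gword :=
  [seq (i, -1) | i <- iota 1 n.-1] ++ (n, 1) ::
  [seq (i, 1) | i <- rev (iota 1 n.-1)] ++ [:: (0%N, 1)].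

Fixpoint Jword (i : nat) : gword :=
  if i is i'.+1 then (i, 1) :: rcons (Jword i') (i, 1) else J0word.

Definition J (i : nat) : sblob k n := geval (Jword i).
Definition Jinv (i : nat) : sblob k n := geval (ginv (Jword i)).

Definition Z : sblob k n := \sum_(i < n) (J i + Jinv i).

Definition alpha (m : nat) (eps1 eps2 : int) : k :=
  qnum n 0 0 * (q ^ (- m%:Z) * Q1 ^ eps1 * Q2 ^ eps2
                + q ^ m * Q1 ^ (- eps1) * Q2 ^ (- eps2)).

End Central.

(* Main.v *)
(* Stacking e_i on a half-diagram is a surgery on its strings at the nodes i-1
   and i (a decoration if i is 0 or n), so the e_i act on the cell module by
   explicit operators.  These satisfy the blob and Temperley-Lieb relations,
   hence the g_i satisfy the relations of the affine Hecke algebra of type C and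
   Z_n commutes with every e_i.

   Any half-diagram is obtained from one of the form ()()...() | | ... | with r
   undecorated cups on the left and m+1 lines, by applying the e_i and moving
   undecorated cups sideways (e_j followed by e_i, with |i-j| = 1, undoes it).
   By centrality it suffices to compute Z_n on such a vector h.  There the lines
   contribute J_(2r+a) h = q^(-2r-2a) x y h with x = Q_1^eps1 and y = Q_2^eps2,
   and the two ends of the k-th cup give (J_(2k) + J_(2k+1)) h = q^(-1-2k) c h,
   and q^(1+2k) c h for the inverses, with c = q x y + 1/(q x y) independent of
   k.  The sum of these geometric progressions is the announced scalar. *)
From HB Require Import structures.
Require Import Defs.
From mathcomp Require Import all_boot all_order all_algebra.
From mathcomp Require Import boolp zify ring.
Import GRing.Theory.
Local Open Scope ring_scope.

Set Implicit Arguments.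
Unset Strict Implicit.
Unset Printing Implicit Defensive.

(** * Straightening of words *)

(** In place of associativity the proof uses [act_be_mul]: acting by $e_id$ is acting by $d$, then
    by $e_i$, for $d$ built from the identity by left multiplications, as in the right bracketing of
    [geval]. The obstacle is the scalar. Straightening a string before its ends are joined, or only
    the resulting loop, gives the same value as soon as its word has blobs of one kind. Planarity
    provides this: an arc exposed to both walls leaves no room for a propagating line, and a stack
    that loses a line acts by $0$. Hence words are followed before straightening, and each stack is
    either [dead] or again a half-diagram. The topological relation is treated likewise: the two
    lines that it creates carry $L$ and $R$, which only the excluded label $(1,-1,-1)$ would accept.
    In the evaluation, $J_{2k}h$ itself need not be a multiple of $h$. The sum over the two ends of
    a cup is $q\,e_{2k+1}J_{2k}h$, which contains one term seeing both walls. Pulling a strand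
    through the next cup shows that this term is the same for all cups, and at the last cup the
    neighbouring line makes it computable. *)

Definition reducedw (u : seq blob) : bool :=
  u \in [:: [::]; [:: bL]; [:: bR]; [:: bL; bR]; [:: bR; bL]].

Lemma reducedwP (Q : seq blob -> Prop) :
  Q [::] -> Q [:: bL] -> Q [:: bR] -> Q [:: bL; bR] -> Q [:: bR; bL] ->
  forall u, reducedw u -> Q u.
Proof. by move=> ? ? ? ? ? u; rewrite /reducedw !inE => /or4P[|||/orP[]] /eqP->. Qed.

Lemma word_eq (u v : word) : (u = v :> seq blob) -> u = v.
Proof. exact: val_inj. Qed.

Lemma reduced_cons a u : reducedw u -> reducedw (cons_word a u).
Proof. by move=> hu; case: a; elim/reducedwP: u / hu. Qed.

Lemma reduced_red s : reducedw (red_word s).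
Proof. by elim: s => //= a s IH; apply: reduced_cons. Qed.

Lemma red_id u : reducedw u -> red_word u = u :> seq blob.
Proof. by move=> hu; elim/reducedwP: u / hu. Qed.

Lemma red_wordK s : red_word (red_word s) = red_word s.
Proof. exact/word_eq/red_id/reduced_red. Qed.

Lemma red_catr u v : red_word (u ++ red_word v) = red_word (u ++ v).
Proof. by elim: u => [|a u IH] /=; rewrite ?red_wordK ?IH. Qed.

(** Local confluence of the straightening relations, checked on the five reduced words. [red_word]
    straightens from the right, so [red_catr] is immediate, while [red_catl] rests on this check. *)
Lemma red_cons_cat a u w : reducedw u -> reducedw w ->
  red_word (cons_word a u ++ w) = red_word (a :: u ++ w).
Proof.
move=> hu hw; apply: word_eq.
by case: a; elim/reducedwP: u / hu; elim/reducedwP: w / hw.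
Qed.

Lemma red_catl u v : red_word (red_word u ++ v) = red_word (u ++ v).
Proof.
rewrite -[LHS]red_catr -[RHS]red_catr; move: (red_word v) (reduced_red v) => w hw {v}.
elim: u => [|a u IH] //=.
by rewrite red_cons_cat ?reduced_red //= IH.
Qed.

Lemma red_rev u : red_word (rev u) = rev (red_word u) :> seq blob.
Proof.
elim: u => [|a u IH] //.
rewrite rev_cons -cats1 -red_catl.
have -> : red_word (red_word (rev u) ++ [:: a]) = red_word (rev (red_word u) ++ [:: a]).
  by rewrite IH.
rewrite /=; move: (red_word u : seq blob) (reduced_red u) => w hw {IH}.
by case: a; elim/reducedwP: w / hw.
Qed.

Lemma red_nil u : red_word u = [::] :> seq blob -> u = [::].
Proof.
case: u => [|a u] //=; move: (red_word u : seq blob) (reduced_red u) => w hw.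
by case: a; elim/reducedwP: w / hw.
Qed.

Lemma mem_red a u : a \in (red_word u : seq blob) -> a \in u.
Proof.
elim: u => [|b u IH] //=.
move: (red_word u : seq blob) (reduced_red u) IH => w hw; rewrite inE.
by case: a b => -[]; elim/reducedwP: w / hw => //= IH; rewrite !inE //= => h;
   rewrite IH // !inE.
Qed.

(** For such words straightening a string commutes with closing it into a loop. With both kinds of
    blobs this can fail: $LRL$ straightens to $\kappa_{LR}L$, hence gives $\kappa_{LR}\kappa_L$ once
    closed, but [loop_coef] gives $\delta_L\kappa_{LR}$ to two $L$ and one $R$. *)
Definition mono (u : seq blob) : bool := ~~ ((bL \in u) && (bR \in u)).

Lemma mono_nseq u : mono u -> exists a j, u = nseq j a.
Proof.
rewrite /mono negb_and => /orP[] h; [exists bR | exists bL]; exists (size u);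
  apply/all_pred1P/allP => -[] //; by rewrite ?(negbTE h) // => /(negP h).
Qed.

Section Coefs.
Context {k : fieldType} (P : blob_params k).

Lemma red_coef_id u : reducedw u -> red_coef P u = 1.
Proof. by move=> hu; elim/reducedwP: u / hu => //=; rewrite !mulr1. Qed.

Lemma coef_catr u v : red_coef P (u ++ v) = red_coef P (u ++ red_word v) * red_coef P v.
Proof.
elim: u => [|a u IH] /=; first by rewrite (red_coef_id (reduced_red v)) mul1r.
by rewrite red_catr IH mulrA.
Qed.

(** The scalars are confluent too: the two ways of straightening an overlap multiply the same
    parameters in different orders. *)
Lemma coef_cons_cat a u w : reducedw u -> reducedw w ->
  red_coef P (a :: u ++ w) = cons_coef P a u * red_coef P (cons_word a u ++ w).
Proof.
move=> hu hw.
by case: a; elim/reducedwP: u / hu; elim/reducedwP: w / hw => /=;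
   rewrite /delta_of /= ?mulr1 ?mul1r //; ring.
Qed.

Lemma coef_catl u v : red_coef P (u ++ v) = red_coef P u * red_coef P (red_word u ++ v).
Proof.
rewrite coef_catr [in RHS]coef_catr mulrA; congr (_ * _).
move: (red_word v) (reduced_red v) => w hw {v}.
elim: u => [|a u IH] /=; first by rewrite mul1r.
rewrite IH -red_catl.
have /= E := coef_cons_cat a (reduced_red u) hw.
by rewrite mulrCA E; ring.
Qed.

Lemma coef_cat u v : red_coef P (u ++ v) =
  red_coef P u * red_coef P v * red_coef P (red_word u ++ red_word v).
Proof. by rewrite coef_catl coef_catr; ring. Qed.

Lemma coef_rev u : red_coef P (rev u) = red_coef P u.
Proof.
elim: u => [|a u IH] //.
rewrite rev_cons -cats1 coef_catl IH red_rev /= mulrC; congr (_ * _).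
rewrite /=; move: (red_word u : seq blob) (reduced_red u) => w hw {IH}.
by case: a; elim/reducedwP: w / hw => /=; rewrite /delta_of /= ?mulr1 ?mul1r.
Qed.

Lemma red_nseq a j : red_word (nseq j a) = nseq (j != 0%N) a :> seq blob.
Proof. by elim: j => [|j /= ->] //=; case: j => [|j] /=; rewrite ?eqxx. Qed.

Lemma coef_nseq a j : red_coef P (nseq j a) = delta_of P a ^+ j.-1.
Proof.
elim: j => [|j /= ->] //=; rewrite red_nseq; case: j => [|j] /=; rewrite ?expr0 ?mulr1 //.
by rewrite eqxx exprS.
Qed.

Definition loopw (u : seq blob) : k := loop_coef P (count_mem bL u) (count_mem bR u).

Lemma loop_nseq a j : (0 < j)%N -> loopw (nseq j a) =
  delta_of P a ^+ j.-1 * (if a == bL then kappaL P else kappaR P).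
Proof.
case: j => // j _.
rewrite /loopw !count_nseq /loop_coef /delta_of; case: a => /=;
  rewrite ?mul1n ?mul0n /= ?expr0 ?mul1r ?mulr1 //; congr (_ ^+ _ * _); lia.
Qed.

End Coefs.

Local Open Scope nat_scope.

(** * Strings of a stack of two diagrams *)

Section Runs.
Context {T : finType} (rho : T -> T) (rhoK : involutive rho).

(** A string of a stack, read on ports. A port is an end of a string of one of the two diagrams;
    [th] goes to the other end of that string, and [rho] exchanges the two sides of a middle node
    and fixes the outer nodes. The last argument lists the ports through which the middle nodes are
    left. *)
Inductive run (th : T -> T) (lab : T -> seq blob) (t : T) :
    T -> seq blob -> seq T -> Prop :=
| run_end : rho (th t) = th t -> run th lab t (th t) (lab t) [::]
| run_step y w s : rho (th t) != th t -> run th lab (rho (th t)) y w s ->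
    run th lab t y (lab t ++ w) (rho (th t) :: s).

Section One.
Context (th : T -> T) (lab : T -> seq blob).
Hypotheses (thK : involutive th) (th_free : forall t, th t != t).
Hypothesis labE : forall t, lab (th t) = rev (lab t).
Notation run := (run th lab).

Lemma run_det t y w s y' w' s' : run t y w s -> run t y' w' s' ->
  [/\ y = y', w = w' & s = s'].
Proof.
move=> h; elim: h y' w' s' => {t y w s} [t ht|t y w s ht _ IH] y' w' s' h'.
  by case: h' ht => [|? ? ?] // /eqP.
case: h' ht IH => [-> /eqP|{}y' {}w' {}s' _ h' _ IH] //.
by have [-> -> ->] := IH _ _ _ h'.
Qed.

Lemma run_out t y w s : run t y w s -> rho y = y.
Proof. by elim. Qed.

(** [nxt] is a permutation of a finite set, so iterating it comes back to the outer port [t]. As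
    [rho] is an involution, an outer port is reached only from an outer port, so the string has
    stopped by then. *)
Lemma run_exists t : rho t = t -> exists y w s, run t y w s.
Proof.
move=> ht; pose nxt t := rho (th t).
have inj : injective nxt by move=> a b /(inv_inj rhoK) /(inv_inj thK).
have [j jlt Ej] : exists2 j, 0 < j & iter j nxt t = t.
  by exists (order nxt t); [exact: order_gt0 | exact: iter_order].
have gen : forall j u, rho (iter j.+1 nxt u) = iter j.+1 nxt u -> exists y w s, run u y w s.
  elim=> [|{jlt Ej}j IH] u.
    rewrite /= /nxt rhoK => E; exists (th u), (lab u), [::].
    by apply: run_end; rewrite -E.
  rewrite iterSr => /IH [y [w [s h]]].
  have [E|E] := eqVneq (rho (th u)) (th u).
    by exists (th u), (lab u), [::]; apply: run_end.
  by exists y, (lab u ++ w), (nxt u :: s); apply: run_step.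
by case: j jlt Ej => // j _ Ej; apply: (gen j); rewrite Ej.
Qed.

(** Reversal needs an accumulator: the reversal of a run from [t] goes on with a run leaving from
    the other side of [t], and stops there if [t] is outer. [run_sym] is the second case. *)
Lemma run_rev t y w s x v s' : run t y w s ->
  (if rho t == t then [/\ x = t, v = [::] & s' = [::]] else run (rho t) x v s') ->
  run y x (rev w ++ v) (rev (map rho s) ++ (if rho t == t then [::] else rho t :: s')).
Proof.
move=> h; elim: h x v s' => {t y w s} [t ht|t y w s ht h IH] x v s' hx.
  case: eqP hx => [E [-> -> _]|/eqP E hx].
    by rewrite !cats0 -labE; have := @run_end th lab (th t); rewrite thK; apply.
  by rewrite -labE /=; have := @run_step th lab (th t) x v s'; rewrite !thK; apply.
have nE : (rho (rho (th t)) == rho (th t)) = false by rewrite rhoK eq_sym (negbTE ht).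
rewrite rev_cat -catA rev_cons cat_rcons /=.
have := IH x (rev (lab t) ++ v) (if rho t == t then [::] else rho t :: s').
rewrite nE rhoK; apply; rewrite -labE.
case: eqP hx => [E [-> -> _]|/eqP E hx].
  by rewrite cats0; have := @run_end th lab (th t); rewrite thK; apply.
by have := @run_step th lab (th t) x v s'; rewrite !thK; apply.
Qed.

Lemma run_sym x y w s : rho x = x -> run x y w s -> run y x (rev w) (rev (map rho s)).
Proof.
by move=> hx /(@run_rev _ _ _ _ x [::] [::]); rewrite hx eqxx !cats0; apply.
Qed.

Lemma run_suffix t y w s u : run t y w s -> u \in s ->
  exists w' s', run u y w' s' /\ size s' < size s.
Proof.
move=> h; elim: h => // {}t {}y {}w {}s _ h IH; rewrite inE => /predU1P[->|/IH].
  by exists w, s; split.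
by move=> [w' [s' [h' lt]]]; exists w', s'; split=> //; rewrite ltnS ltnW.
Qed.

Lemma run_pred t y w s u : run t y w s -> u \in s ->
  exists2 v, v \in t :: s & u = rho (th v).
Proof.
move=> h; elim: h => // {}t {}y {}w {}s _ h IH; rewrite inE => /predU1P[->|/IH].
  by exists t; rewrite ?mem_head.
by move=> [v hv ->]; exists v; rewrite // inE hv orbT.
Qed.

(* The two ports u and rho u are the same middle node, seen from both sides. *)
Lemma run_once t y w s : run t y w s ->
  [/\ uniq s, forall u, u \in s -> rho u != u &
      forall u, u \in s -> rho u \notin s] /\
  (rho t != t -> t \notin s /\ rho t \notin s).
Proof.
move=> h; elim: h => // {}t {}y {}w {}s ht h [[us ho hn] ht1].
have h1 := run_step ht h.
have nE : rho (rho (th t)) != rho (th t) by rewrite rhoK eq_sym.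
have [n1 n2] := ht1 nE; split.
  split=> [|u|u] /=; first by rewrite n1.
    by rewrite inE => /predU1P[->|/ho].
  rewrite !inE negb_or => /predU1P[->|us']; first by rewrite nE.
  rewrite hn // andbT; apply: contraNneq n2 => <-; by rewrite rhoK.
move=> rt; split.
  apply/negP => /(run_suffix h1)[w' [s' [/(run_det h1)[_ _ <-]]]]; by rewrite ltnn.
rewrite inE negb_or; apply/andP; split.
  by apply: contra (th_free t) => /eqP/(inv_inj rhoK) <-.
apply/negP => hin; have [v] := run_pred h hin.
move=> hv /(inv_inj rhoK) E.
have Ev : v = rho (rho (th t)) by rewrite rhoK E thK.
by move: hv; rewrite Ev inE (negbTE nE) (negbTE n2).
Qed.

Lemma run_nil t y w s : run t y w s -> s = [::] -> y = th t /\ w = lab t.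
Proof. by case. Qed.

Lemma run_endE t y w s : run t y w s -> rho (th t) = th t ->
  [/\ y = th t, w = lab t & s = [::]].
Proof. by move=> h E; apply: run_det h (run_end _ E). Qed.

Lemma run_stepE t y w s : run t y w s -> rho (th t) != th t -> exists u s',
  [/\ w = lab t ++ u, s = rho (th t) :: s' & run (rho (th t)) y u s'].
Proof.
case=> {y w s} [E|y w s _ h _]; last by exists w, s.
by rewrite {1}E eqxx.
Qed.

(** Such a run would be its own reversal, so some middle node would be met from both sides, against
    [run_once]. *)
Lemma run_neq x w s : rho x = x -> ~ run x x w s.
Proof.
move=> hx h; have [[_ ho hn] _] := run_once h.
have [_ _ E] := run_det h (run_sym hx h).
case: s => [|u s] in h ho hn E.
  by have [E' _] := run_nil h erefl; have := th_free x; rewrite -E' eqxx.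
have : u \in rev (map rho (u :: s)) by rewrite -E mem_head.
rewrite mem_rev => /mapP[v hv Ev]; have := hn v hv.
by rewrite -Ev mem_head.
Qed.

(** Every string of the run is seen from both of its ends, as in [loop_count]; hence the
    doubling. *)
Lemma run_count a t y w s : run t y w s ->
  \sum_(u <- s) (count_mem a (lab u) + count_mem a (lab (rho u)))
    + count_mem a (lab y) + count_mem a (lab t) = (count_mem a w).*2.
Proof.
have cth u : count_mem a (lab (th u)) = count_mem a (lab u).
  by rewrite labE count_rev.
elim=> {t y w s} [t _|t y w s _ _ IH].
  by rewrite big_nil cth add0n addnn.
rewrite big_cons rhoK cth count_cat; lia.
Qed.

Lemma run_closed t y w s u : run t y w s -> u \in s ->
  (th u = y \/ rho (th u) \in s) /\ (th (rho u) = t \/ th (rho u) \in s).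
Proof.
move=> h; elim: h u => // {}t {}y {}w {}s ht h IH u.
have hd : th (rho (th t)) = y \/ rho (th (rho (th t))) \in s.
  by case: h => [?|? ? ? ? ?]; [left|right; rewrite mem_head].
rewrite !inE => /predU1P[->|/IH[h1 h2]].
  by split; [case: hd => [|->]; rewrite ?orbT; auto | left; rewrite rhoK thK].
split; first by case: h1 => [|->]; rewrite ?orbT; auto.
by right; case: h2 => [->|->]; rewrite ?eqxx ?orbT.
Qed.

Lemma run_last t y w s : run t y w s -> s != [::] ->
  exists2 u, u \in s & th u = y.
Proof.
elim=> // {}t {}y {}w {}s _ h IH _.
have [E|/IH[u us <-]] := eqVneq s [::].
  by exists (rho (th t)); rewrite ?mem_head //; case: (run_nil h E).
by exists u; rewrite // inE us orbT.
Qed.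

End One.

(* Top surgery at the outer nodes p and p': they get joined by an undecorated
   string, and so do the other ends of the strings they were on. *)
Section Surgery.
Context (th : T -> T) (lab : T -> seq blob).
Hypotheses (thK : involutive th) (th_free : forall t, th t != t).
Hypothesis labE : forall t, lab (th t) = rev (lab t).
Context (th' : T -> T) (lab' : T -> seq blob).
Hypotheses (th'K : involutive th') (th'_free : forall t, th' t != t).
Hypothesis lab'E : forall t, lab' (th' t) = rev (lab' t).
Context (p p' : T) (hp : rho p = p) (hp' : rho p' = p') (pp' : p != p').
Hypothesis th'p : th' p = p'.
Hypothesis lab'p : lab' p = [::].
Hypothesis th'_same : forall t, t != p -> t != p' -> th t != p -> th t != p' ->
  th' t = th t /\ lab' t = lab t.
Hypothesis th'_join : th p != p' -> th' (th p) = th p' /\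
  lab' (th p) = red_word (lab (th p) ++ lab p').

Lemma run_surg t y w s : run th lab t y w s -> t != p -> t != p' ->
  y != p -> y != p' -> run th' lab' t y w s.
Proof.
elim=> {t y w s} [t ht|t y w s ht h IH] tp tp' yp yp'.
  by have [<- <-] := th'_same tp tp' yp yp'; apply: run_end; have [-> _] := th'_same tp tp' yp yp'.
have a1 : th t != p by apply: contraNneq ht => ->; rewrite hp.
have a2 : th t != p' by apply: contraNneq ht => ->; rewrite hp'.
have [E1 E2] := th'_same tp tp' a1 a2.
rewrite -E2 -E1; apply: run_step; rewrite ?E1 //; apply: IH => //.
  by apply: contraNneq a1 => E; rewrite -[th t]rhoK E hp.
by apply: contraNneq a2 => E; rewrite -[th t]rhoK E hp'.
Qed.

Definition tail t y u s := if rho (th t) == th t then [/\ y = th t, u = [::] & s = [::]]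
  else exists2 s', s = rho (th t) :: s' & run th' lab' (rho (th t)) y u s'.

Lemma run_tail t y w s : run th lab t y w s -> y != p -> y != p' ->
  exists2 u, w = lab t ++ u & tail t y u s.
Proof.
case=> {y w s} [ht|y w s ht h] yp yp'; rewrite /tail.
  by exists [::]; rewrite ?cats0 // ht eqxx.
exists w => //; rewrite (negbTE ht); exists s => //; apply: run_surg h _ _ yp yp'.
  by apply: contraNneq ht => E; rewrite -{2}(rhoK (th t)) E hp.
by apply: contraNneq ht => E; rewrite -{2}(rhoK (th t)) E hp'.
Qed.

(** The runs from [p] and [p'] lose their first strings, whose far ends are now joined, so the two
    remainders are glued, the first one read backwards. If [A] were [p'], there would be a single
    run, and the surgery would close it into a loop. *)
Lemma run_join A B u v s s' : run th lab p A u s -> run th lab p' B v s' -> A != p' ->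
  exists u2 v2 s'', [/\ u = lab p ++ u2, v = lab p' ++ v2 &
    run th' lab' A B (rev u2 ++ red_word (lab (th p) ++ lab p') ++ v2) s''].
Proof.
move=> hA hB Ap'.
have Ap : A != p by apply/eqP => E; apply: (run_neq thK th_free labE hp (w := u) (s := s)); rewrite -{2}E.
have Bp' : B != p' by apply/eqP => E; apply: (run_neq thK th_free labE hp' (w := v) (s := s')); rewrite -{2}E.
have Bp : B != p.
  apply: contra_neq Ap' => E; have := run_sym thK labE hp' hB; rewrite E => hB'.
  by have [] := run_det hA hB'.
have thpp' : th p != p'.
  by apply: contra_neq Ap' => E; have [] := run_endE hA; rewrite E.
have [E1 E2] := th'_join thpp'.
have [u2 -> tA] := run_tail hA Ap Ap'; have [v2 -> tB] := run_tail hB Bp Bp'.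
have [s'' r] : exists s'', run th' lab' (th p) B (red_word (lab (th p) ++ lab p') ++ v2) s''.
  rewrite -E2; move: tB; rewrite /tail; case: eqP => [E [-> -> _]|/eqP E [s1 _ r]].
    by exists [::]; rewrite cats0 -E1; apply: run_end; rewrite E1.
  by exists (rho (th p') :: s1); rewrite -E1; apply: run_step; rewrite E1.
exists u2, v2; move: tA; rewrite /tail; case: eqP => [E [-> -> _]|/eqP E [s1 _ r1]].
  by exists s''.
eexists; split; [by []|by []|].
have := @run_rev th' lab' th'K lab'E _ _ _ _ B (red_word (lab (th p) ++ lab p') ++ v2) s'' r1.
by rewrite rhoK eq_sym (negbTE E); apply.
Qed.

End Surgery.

Section Decoration.
Context (th : T -> T) (lab : T -> seq blob).
Hypotheses (thK : involutive th) (th_free : forall t, th t != t).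
Hypothesis labE : forall t, lab (th t) = rev (lab t).
Context (lab' : T -> seq blob) (z : T) (hz : rho z = z) (a : blob).
Hypothesis lab'E : forall t, lab' (th t) = rev (lab' t).
Hypothesis lab'_same : forall t, t != z -> th t != z -> lab' t = lab t.
Hypothesis lab'_z : lab' z = red_word (a :: lab z).

Lemma run_dec t y w s : run th lab t y w s -> t != z -> y != z -> run th lab' t y w s.
Proof.
elim=> {t y w s} [t ht|t y w s ht h IH] tz yz.
  by rewrite -lab'_same //; apply: run_end.
have a1 : th t != z by apply: contraNneq ht => ->; rewrite hz.
rewrite -lab'_same //; apply: run_step => //; apply: IH => //.
by apply: contraNneq a1 => E; rewrite -[th t]rhoK E hz.
Qed.

Lemma run_dec_z y w s : run th lab z y w s ->
  exists2 u, w = lab z ++ u & run th lab' z y (red_word (a :: lab z) ++ u) s.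
Proof.
move=> h; have yz : y != z.
  by apply/eqP => E; apply: (run_neq thK th_free labE hz (w := w) (s := s)); rewrite -{2}E.
rewrite -lab'_z; have [E|E] := eqVneq (rho (th z)) (th z).
  by have [-> -> ->] := run_endE h E; exists [::]; rewrite ?cats0 //; apply: run_end.
have [u [s' [-> -> h1]]] := run_stepE h E.
exists u => //; apply: run_step => //; apply: run_dec h1 _ yz.
by apply: contraNneq E => E'; rewrite -{2}(rhoK (th z)) E' hz.
Qed.
End Decoration.
End Runs.

Lemma wf_stringsP n l (d : ddiag n l) :
  reflect [/\ forall x, partner d x != x, involutive (partner d) &
     forall x, deco d (partner d x) = rev (deco d x) :> seq blob] (wf_strings d).
Proof.
apply: (iffP forallP) => [h|[h1 h2 h3] x]; last by rewrite h1 h2 eqxx h3 eqxx.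
by split=> x; case/and3P: (h x) => // h1 /eqP h2 /eqP.
Qed.

(** * Strings of a stack as runs on ports *)

Section Ports.
Context {n l r : nat}.
Definition port := (node n l + node l r)%type.

Definition glue (t : port) : port :=
  match t with
  | inl (inr j) => inr (inl j)
  | inr (inl j) => inl (inr j)
  | _ => t
  end.

Definition opn (x : node n r) : port :=
  match x with inl i => inl (inl i) | inr b => inr (inr b) end.

Definition mid (t : port) : option 'I_l :=
  match t with inl (inr j) | inr (inl j) => Some j | _ => None end.

Lemma glueK : involutive glue. Proof. by case=> [[]|[]]. Qed.

Lemma glue_opn x : glue (opn x) = opn x. Proof. by case: x. Qed.

Lemma opn_inj : injective opn. Proof. by move=> [i|i] [j|j] // [->]. Qed.

Lemma glue_fix t : glue t = t -> exists x, t = opn x.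
Proof. by case: t => [[i|j]|[j|b]] // _; [exists (inl i)|exists (inr b)]. Qed.

Lemma mid_glue t : mid (glue t) = mid t. Proof. by case: t => [[]|[]]. Qed.

Lemma mid_some t : glue t != t -> exists j, mid t = Some j.
Proof. by case: t => [[i|j]|[j|b]] //=; rewrite ?eqxx // => _; exists j. Qed.

Lemma mid_inj t t' j : mid t = Some j -> mid t' = Some j -> t' = t \/ t' = glue t.
Proof. by case: t => [[i|a]|[a|b]]; case: t' => [[i'|a']|[a'|b']] //= [->] [->]; auto. Qed.

Lemma uniq_mid s : uniq s -> (forall u, u \in s -> glue u != u) ->
  (forall u, u \in s -> glue u \notin s) -> uniq (pmap mid s).
Proof.
elim: s => //= u s IH /andP[us us'] ho hn.
have [j Ej] := mid_some (ho u (mem_head _ _)); rewrite Ej /= IH //; last 2 first.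
- by move=> v vs; apply: ho; rewrite inE vs orbT.
- by move=> v vs; have := hn v; rewrite !inE vs orbT negb_or => /(_ isT)/andP[].
rewrite andbT mem_pmap; apply/negP => /mapP[v vs Ev].
case: (mid_inj Ej (esym Ev)) => E; first by rewrite -E vs in us.
by have := hn u (mem_head _ _); rewrite inE -E vs orbT.
Qed.

Context (d : ddiag n l) (d' : ddiag l r).

Definition pth (t : port) : port :=
  match t with inl x => inl (partner d x) | inr x => inr (partner d' x) end.

Definition plab (t : port) : seq blob :=
  match t with inl x => deco d x | inr x => deco d' x end.

Definition port_at (down : bool) (j : 'I_l) : port :=
  if down then inr (inl j) else inl (inr j).

Notation prun := (run glue pth plab).

Lemma walk_run t y w s : prun t y w s -> forall b j x0 z fuel, t = port_at b j ->
  y = opn z -> size s < fuel -> walk d d' x0 fuel b j = (z, w).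
Proof.
elim=> {t y w s} [t|t y w s] ht.
  move=> b j x0 z [//|fuel] E; rewrite E in ht * => /= Ey _.
  case: b {E} ht Ey => /=; case E: (partner _ _) => [a|a] //= _; case: z => // a' [->];
    by [].
move=> h IH b j x0 z [//|fuel] E Ey; rewrite E /= in ht h IH * => hs.
case: b {E} ht h IH => /=; case E: (partner _ _) => [a|a] //= ht h IH; rewrite ?eqxx // in ht.
  by rewrite (IH false a x0 z fuel).
by rewrite (IH true a x0 z fuel).
Qed.

Hypotheses (wd : wf_strings d) (wd' : wf_strings d').

Lemma pthK : involutive pth.
Proof.
by case/wf_stringsP: wd => _ h _; case/wf_stringsP: wd' => _ h' _ [] x /=; rewrite ?h ?h'.
Qed.

Lemma pth_free t : pth t != t.
Proof.
case/wf_stringsP: wd => h _ _; case/wf_stringsP: wd' => h' _ _.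
by case: t => x /=; [have := h x|have := h' x]; apply: contraNneq => -[->].
Qed.

Lemma plabE t : plab (pth t) = rev (plab t).
Proof.
case/wf_stringsP: wd => _ _ h; case/wf_stringsP: wd' => _ _ h'.
by case: t => x /=; rewrite ?h ?h'.
Qed.

Lemma run_size t y w s : prun t y w s -> size s <= l.
Proof.
move=> h; have [[us ho hn] _] := run_once glueK pthK pth_free h.
have -> : size s = size (pmap mid s).
  rewrite size_pmap; apply/esym/eqP; rewrite -all_count.
  by apply/allP => u /ho /mid_some[j /= ->].
have uq := uniq_mid us ho hn.
by rewrite -(card_uniqP uq); apply: leq_trans (max_card _) _; rewrite card_ord.
Qed.

Lemma raw_run x y w s : prun (opn x) (opn y) w s -> raw_string d d' x = (y, w).
Proof.
move=> h; have hs := run_size h; rewrite /raw_string.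
have [E|E] := eqVneq (glue (pth (opn x))) (pth (opn x)).
  have [Ey -> _] := run_endE h E.
  case: x {h} E Ey => i /=; case: (partner _ _) => [a|a] //= _; by case: y => // a' [->].
have [u [s' [-> Es h1]]] := run_stepE h E.
rewrite Es /= in hs; move: (walk_run h1) => hw {Es}.
case: x {h} E h1 hw => i /=; case: (partner _ _) => [a|a] /=; rewrite ?eqxx // => _ _ hw.
  by rewrite (hw true a _ y).
by rewrite (hw false a _ y).
Qed.

Lemma raw_exists x : exists s,
  prun (opn x) (opn (raw_string d d' x).1) (raw_string d d' x).2 s.
Proof.
have [y [w [s h]]] := run_exists glueK plab pthK (glue_opn x).
have [z Ez] := glue_fix (run_out h).
by exists s; rewrite Ez in h; rewrite (raw_run h).
Qed.

Lemma wf_raw x : let: (y, w) := raw_string d d' x in y != x /\ raw_string d d' y = (x, rev w).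
Proof.
have [s] := raw_exists x; case: raw_string => y w /= h; split.
  apply/eqP => E; rewrite E in h.
  by apply: (run_neq glueK pthK pth_free plabE (glue_opn x) h).
exact: raw_run (run_sym glueK pthK plabE (glue_opn x) h).
Qed.

Lemma wf_stack0 : wf_strings (stack0 d d').
Proof.
apply/wf_stringsP; split=> x; rewrite /partner /deco ?ffunE /=.
- by have := wf_raw x; case: raw_string => y w [].
- by have := wf_raw x; case: raw_string => y w [_ ->].
by have := wf_raw x; case: raw_string => y w [_ ->] /=; rewrite red_rev.
Qed.

Lemma partner_stack0 x : partner (stack0 d d') x = (raw_string d d' x).1.
Proof. by rewrite /partner ffunE. Qed.

Lemma deco_stack0 x : deco (stack0 d d') x = red_word (raw_string d d' x).2.
Proof. by rewrite /deco ffunE. Qed.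

End Ports.

(** The diagram of $e_id$ when [p] and [p'] are the $i$-th and $(i+1)$-st top nodes. If they are
    already joined in [d], the two cases about partners do not occur and the arc just loses its
    word; the loop closed by $e_i$ is accounted for in [cup_coef]. *)
Definition surg n l (p p' : node n l) (d : ddiag n l) : ddiag n l :=
  [ffun x => if x == p then (p', [bseq]) else if x == p' then (p, [bseq])
    else if partner d x == p then (partner d p', red_word (deco d x ++ deco d p'))
    else if partner d x == p' then (partner d p, red_word (deco d x ++ deco d p))
    else d x].

Definition dec n l (z : node n l) (a : blob) (d : ddiag n l) : ddiag n l :=
  [ffun x => if x == z then (partner d z, red_word (a :: deco d z))
    else if x == partner d z then (z, red_word (rcons (deco d x) a)) else d x].

Definition reducedd n l (d : ddiag n l) := forall x, reducedw (deco d x).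

Section SurgFacts.
Context {n l : nat} (d : ddiag n l) (wd : wf_strings d).
Context (p p' : node n l) (pp' : p != p').
Let hf := let: And3 h _ _ := wf_stringsP _ wd in h.
Let hK := let: And3 _ h _ := wf_stringsP _ wd in h.
Let hr := let: And3 _ _ h := wf_stringsP _ wd in h.

Lemma surg_p : surg p p' d p = (p', [bseq]).
Proof. by rewrite ffunE eqxx. Qed.
Lemma surg_p' : surg p p' d p' = (p, [bseq]).
Proof. by rewrite ffunE eqxx eq_sym (negbTE pp'). Qed.
Lemma surg_same x : x != p -> x != p' -> partner d x != p -> partner d x != p' ->
  surg p p' d x = d x.
Proof. by move=> /negbTE h1 /negbTE h2 /negbTE h3 /negbTE h4; rewrite ffunE h1 h2 h3 h4. Qed.
Lemma surg_join : partner d p != p' -> surg p p' d (partner d p) =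
  (partner d p', red_word (deco d (partner d p) ++ deco d p')).
Proof. by move=> h; rewrite ffunE (negbTE (hf p)) (negbTE h) hK eqxx. Qed.
Lemma surg_join' : partner d p != p' -> surg p p' d (partner d p') =
  (partner d p, red_word (deco d (partner d p') ++ deco d p)).
Proof.
move=> h; have h' : partner d p' != p by apply: contraNneq h => <-; rewrite hK.
by rewrite ffunE (negbTE (hf p')) (negbTE h') hK eq_sym (negbTE pp') eqxx.
Qed.

Lemma surg_ind (Q : node n l -> node n l * word -> Prop) :
  Q p (p', [bseq]) -> Q p' (p, [bseq]) ->
  (partner d p != p' -> Q (partner d p)
     (partner d p', red_word (deco d (partner d p) ++ deco d p'))) ->
  (partner d p != p' -> Q (partner d p')
     (partner d p, red_word (deco d (partner d p') ++ deco d p))) ->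
  (forall x, x != p -> x != p' -> partner d x != p -> partner d x != p' -> Q x (d x)) ->
  forall x, Q x (surg p p' d x).
Proof.
move=> h1 h2 h3 h4 h5 x.
have [->|xp] := eqVneq x p; first by rewrite surg_p.
have [->|xp'] := eqVneq x p'; first by rewrite surg_p'.
have [E|np] := eqVneq (partner d x) p.
  have hx : partner d p != p' by rewrite -E hK.
  by have := h3 hx; rewrite -surg_join // -E hK.
have [E|np'] := eqVneq (partner d x) p'.
  have hx : partner d p != p' by apply: contraNneq xp => E'; rewrite -(hK x) E -E' hK.
  by have := h4 hx; rewrite -surg_join' // -E hK.
by rewrite surg_same //; apply: h5.
Qed.

Lemma wf_surg : wf_strings (surg p p' d).
Proof.
pose Q x (yw : node n l * word) := [/\ yw.1 != x, (surg p p' d yw.1).1 = x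
     & (surg p p' d yw.1).2 = rev yw.2 :> seq blob].
have key : forall x, Q x (surg p p' d x).
  apply: surg_ind; rewrite /Q /=.
  - by rewrite surg_p' eq_sym.
  - by rewrite surg_p.
  - move=> h; rewrite surg_join' //=; split=> //.
      by apply: contraNneq pp' => /(inv_inj hK) ->.
    by rewrite -red_rev rev_cat !hr revK.
  - move=> h; rewrite surg_join //=; split=> //.
      by apply: contraNneq pp' => /(inv_inj hK) ->.
    by rewrite -red_rev rev_cat !hr revK.
  move=> {}x h1 h2 h3 h4; rewrite surg_same ?hK //; split=> //.
  - exact: hf.
  - exact: hK.
  exact: hr.
by apply/wf_stringsP; split=> x; have [] := key x.
Qed.

Lemma reducedd_surg : reducedd d -> reducedd (surg p p' d).
Proof.
move=> h x; rewrite /deco; apply: (@surg_ind (fun x yw => reducedw yw.2)) => //=.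
- by move=> _; apply: reduced_red.
- by move=> _; apply: reduced_red.
by move=> y _ _ _ _; apply: h.
Qed.

Section Dec.
Context (z : node n l) (a : blob).
Lemma dec_z : dec z a d z = (partner d z, red_word (a :: deco d z)).
Proof. by rewrite ffunE eqxx. Qed.
Lemma dec_z' : dec z a d (partner d z) = (z, red_word (rcons (deco d (partner d z)) a)).
Proof. by rewrite ffunE (negbTE (hf z)) eqxx. Qed.
Lemma dec_same x : x != z -> partner d x != z -> dec z a d x = d x.
Proof.
move=> h1 h2; rewrite ffunE (negbTE h1); case: eqP => // E.
by rewrite E hK eqxx in h2.
Qed.
Lemma dec_ind (Q : node n l -> node n l * word -> Prop) :
  Q z (partner d z, red_word (a :: deco d z)) ->
  Q (partner d z) (z, red_word (rcons (deco d (partner d z)) a)) ->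
  (forall x, x != z -> partner d x != z -> Q x (d x)) ->
  forall x, Q x (dec z a d x).
Proof.
move=> h1 h2 h3 x; have [->|xz] := eqVneq x z; first by rewrite dec_z.
have [E|xz'] := eqVneq (partner d x) z; last by rewrite dec_same //; apply: h3.
by rewrite -(hK x) E dec_z'.
Qed.

Lemma partner_dec x : partner (dec z a d) x = partner d x.
Proof. by rewrite /partner; apply: (@dec_ind (fun x yw => yw.1 = (d x).1)) => //=; rewrite [RHS]hK. Qed.

Lemma wf_dec : wf_strings (dec z a d).
Proof.
apply/wf_stringsP; split=> x; rewrite ?partner_dec ?hK //.
rewrite /deco [in RHS]/dec; apply: (@dec_ind (fun x yw => (dec z a d (partner d x)).2 = rev yw.2 :> seq blob)).
- by rewrite dec_z' /snd -red_rev rev_cons hr.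
- by rewrite hK dec_z /snd -[RHS]red_rev rev_rcons hr revK.
by move=> {}x h1 h2; rewrite dec_same ?hK //; apply: hr.
Qed.

Lemma reducedd_dec : reducedd d -> reducedd (dec z a d).
Proof.
move=> h x; rewrite /deco; apply: (@dec_ind (fun x yw => reducedw yw.2)) => //=.
- exact: reduced_red (_ :: _).
- exact: reduced_red.
by move=> y _ _; apply: h.
Qed.
End Dec.
End SurgFacts.

(** * Surgery at the top commutes with stacking below *)

Section RawSurg.
Context {n l r : nat} (d : ddiag n l) (d' : ddiag l r).
Hypotheses (wd : wf_strings d) (wd' : wf_strings d').
Context (i i' : 'I_n) (ii' : i != i').
Notation p := (inl i : node n l).
Notation p' := (inl i' : node n l).
Notation q := (inl i : node n r).
Notation q' := (inl i' : node n r).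
Let pp' : p != p'. Proof. by apply: contraNneq ii' => -[->]. Qed.
Let qq' : q != q'. Proof. by apply: contraNneq ii' => -[->]. Qed.
Notation raw := (raw_string d d').
Notation raw' := (raw_string (surg p p' d) d').
Notation D := (stack0 d d').

Let wD : wf_strings D := wf_stack0 wd wd'.
Let wS : wf_strings (surg p p' d) := wf_surg wd pp'.

Let pth_same : forall t : port, t != opn q -> t != opn q' -> pth d d' t != opn q ->
  pth d d' t != opn q' ->
  pth (surg p p' d) d' t = pth d d' t /\ plab (surg p p' d) d' t = plab d d' t.
Proof.
move=> [x|x] // h1 h2 h3 h4.
have E : surg p p' d x = d x.
  by apply: surg_same => //; rewrite -(inj_eq (@inl_inj _ (node l r))).
by rewrite /pth /plab /partner /deco E.
Qed.

Let pth_join : pth d d' (opn q) != opn q' ->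
  pth (surg p p' d) d' (pth d d' (opn q)) = pth d d' (opn q') /\
  plab (surg p p' d) d' (pth d d' (opn q)) =
   red_word (plab d d' (pth d d' (opn q)) ++ plab d d' (opn q')).
Proof.
move=> h; have h' : partner d p != p' by apply: contraNneq h => /= ->.
by rewrite /pth /plab /= /partner /deco surg_join.
Qed.

Let opnE x y : (opn x == opn y :> port) = (x == y :> node n r) := inj_eq (@opn_inj n l r) x y.

Lemma raw_surg_p : raw' q = (q', [::]).
Proof.
by rewrite /raw_string /= -/p /partner surg_p /= /deco surg_p.
Qed.

Lemma raw_surg_same x : x != q -> x != q' -> (raw x).1 != q -> (raw x).1 != q' -> raw' x = raw x.
Proof.
move=> h1 h2 h3 h4; have [s] := raw_exists wd wd' x; case: (raw x) h3 h4 => y w /= h3 h4 h.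
apply: (raw_run wS wd' (s := s)).
by apply: (run_surg (@glueK n l r) (glue_opn q) (glue_opn q') pth_same h); rewrite opnE.
Qed.

Lemma raw_surg_join : (raw q).1 != q' -> exists u v,
  [/\ (raw q).2 = deco d p ++ u, (raw q').2 = deco d p' ++ v &
    raw' (raw q).1 = ((raw q').1,
      rev u ++ red_word (deco d (partner d p) ++ deco d p') ++ v)].
Proof.
move=> h; have [s hs] := raw_exists wd wd' q; have [s' hs'] := raw_exists wd wd' q'.
have [|u [v [s'' [E1 E2 h']]]] := run_join (@glueK n l r) (pthK wd wd') (pth_free wd wd')
  (plabE wd wd') (pthK wS wd') (plabE wS wd') (glue_opn q) (glue_opn q')
  pth_same pth_join hs hs'; first by rewrite opnE.
by exists u, v; split=> //; apply: raw_run h'.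
Qed.

Lemma deco_raw_rev : deco D (raw q).1 = red_word (rev (raw q).2).
Proof.
have := wf_raw wd wd' q; rewrite deco_stack0.
by case E : (raw q) => [A w] [_ ->].
Qed.

Lemma raw_join_red : (raw q).1 != q' ->
  red_word (raw' (raw q).1).2 = red_word (deco D (partner D q) ++ deco D q').
Proof.
have [_ _ hr] := wf_stringsP _ wd.
move=> h; have [u [v [E1 E2 ->]]] := raw_surg_join h.
rewrite partner_stack0 deco_raw_rev deco_stack0 red_catl red_catr E1 E2 hr [LHS]/=.
by rewrite -red_catr red_catl red_catr rev_cat !catA.
Qed.

(** This is $(e_id)d'=e_i(dd')$ at the level of diagrams; the scalars are compared in
    [stack0_coef_surg]. *)
Lemma stack0_surg : stack0 (surg p p' d) d' = surg q q' D.
Proof.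
have [hf hK hr] := wf_stringsP _ wD.
pose Q x (yw : node n r * word) := stack0 (surg p p' d) d' x = yw.
have st x : stack0 (surg p p' d) d' x = ((raw' x).1, red_word (raw' x).2) by rewrite ffunE.
apply/ffunP; apply: (surg_ind wD qq' (Q := Q)); rewrite /Q.
- by rewrite st raw_surg_p.
- have := wf_raw wS wd' q; rewrite raw_surg_p => -[_ E].
  by rewrite st E.
- rewrite !partner_stack0 => h; rewrite st raw_join_red // partner_stack0.
  by have [u [v [_ _ ->]]] := raw_surg_join h.
- rewrite !partner_stack0 => h; have := raw_join_red h.
  have [u [v [_ _ E3]]] := raw_surg_join h.
  have := wf_raw wS wd' (raw q).1; rewrite E3 => -[_ E4] /= E.
  rewrite st E4; congr (_, _); apply: word_eq; rewrite red_rev {}E -red_rev rev_cat.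
  by rewrite -!hr hK ?partner_stack0.
move=> x h1 h2; rewrite !partner_stack0 => h3 h4; rewrite st raw_surg_same //.
by rewrite ffunE.
Qed.

Section Coef.
Context {k : fieldType} (P : blob_params k).
Local Open Scope ring_scope.

(** Both sides are the scalar of the full word of the two strings read through [q] and [q'],
    straightened in two orders: at the new junction first, or along each old string first. *)
Lemma raw_join_coef : (raw q).1 != q' ->
  red_coef P (deco d (partner d p) ++ deco d p') * red_coef P (raw' (raw q).1).2 =
  red_coef P (raw q).2 * red_coef P (raw q').2 *
    red_coef P (deco D (partner D q) ++ deco D q').
Proof.
have [_ _ hr] := wf_stringsP _ wd.
move=> h; have [u [v [E1 E2 ->]]] := raw_surg_join h.
rewrite partner_stack0 deco_raw_rev deco_stack0 -(coef_rev P (raw q).2) -coef_cat.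
rewrite E1 E2 rev_cat -hr -!catA /=; set m1 := deco _ _; set m2 := deco _ _.
rewrite (catA (m1 : seq blob)) (coef_catr P (rev u)) [in RHS](coef_catr P (rev u)).
by rewrite [in RHS](coef_catl P (m1 ++ m2)) red_catl; ring.
Qed.
End Coef.
End RawSurg.

(** * Scalars of a stack after a surgery *)

Section Pairs.
Context {T : finType} (sg : T -> T) (rk : T -> nat).
Hypotheses (sgK : involutive sg) (sg_free : forall x, sg x != x) (rk_inj : injective rk).
Context {k : fieldType} (F : T -> k) (FE : forall x, F (sg x) = F x).
Local Open Scope ring_scope.

(** The product takes each string at its smaller end. Whichever end [z] is, its factor can be split
    off, because [F] has the same value at both ends. *)
Lemma prod_pairs (Q : pred T) z : Q z -> Q (sg z) ->
  \prod_(x | (rk x < rk (sg x))%N && Q x) F x =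
  F z * \prod_(x | (rk x < rk (sg x))%N && (Q x && (x != z) && (x != sg z))) F x.
Proof.
have gen y : Q y -> (rk y < rk (sg y))%N ->
  \prod_(x | (rk x < rk (sg x))%N && Q x) F x =
  F y * \prod_(x | (rk x < rk (sg x))%N && (Q x && (x != y) && (x != sg y))) F x.
  move=> Qy hy; rewrite (bigD1 y) ?hy //=; congr (_ * _); apply: eq_bigl => x.
  rewrite -!andbA; case: ltnP => //= hx; case: (Q x) => //=.
  case: eqP => //= _; apply/esym/eqP => E; move: hx hy; rewrite E sgK; lia.
move=> Qz Qz'; case: (ltngtP (rk z) (rk (sg z))) => [h|h|/rk_inj E].
- exact: gen.
- rewrite (gen (sg z)) ?sgK // FE; congr (_ * _); apply: eq_bigl => x.
  by rewrite -!andbA [(x != sg z) && _]andbC.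
by have := sg_free z; rewrite -E eqxx.
Qed.
End Pairs.

Definition loops {k : fieldType} (P : blob_params k) n l r (d : ddiag n l) (d' : ddiag l r) : k :=
  (\prod_(j | loop_head d d' j)
      loop_coef P (loop_count d d' bL j) (loop_count d d' bR j))%R.

Lemma middle_arc_sym n l r (d : ddiag n l) (d' : ddiag l r) :
  wf_strings d -> wf_strings d' -> symmetric (middle_arc d d').
Proof.
move=> /wf_stringsP[_ h _] /wf_stringsP[_ h' _] j j'; rewrite /middle_arc.
by rewrite ![_ == inr j]eq_sym ![_ == inl j]eq_sym !(inv_eq h) !(inv_eq h').
Qed.

Section Loops.
Context {n l r : nat} (d d1 : ddiag n l) (d' : ddiag l r).
Context {k : fieldType} (P : blob_params k).

Lemma loops_same :
  middle_arc d1 d' =2 middle_arc d d' -> middle_closed d1 d' =1 middle_closed d d' ->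
  (forall j a, middle_closed d d' j ->
     count_mem a (deco d1 (inr j)) = count_mem a (deco d (inr j))) ->
  loops P d1 d' = loops P d d'.
Proof.
move=> h1 h2 h3; have hc := eq_connect h1.
have hh j : loop_head d1 d' j = loop_head d d' j.
  by apply: eq_forallb => j'; rewrite hc h2.
rewrite /loops (eq_bigl _ _ hh); apply: eq_bigr => j /forallP hj.
have hl a : loop_count d1 d' a j = loop_count d d' a j.
  rewrite /loop_count (eq_bigl (connect (middle_arc d d') j)) //; congr (_./2).
  apply: eq_bigr => j' cj; have := hj j'; rewrite cj /= => /andP[_ cl].
  by rewrite h3.
by rewrite !hl.
Qed.

Context (a b : 'I_l) (ab : a != b).
Hypotheses (wd : wf_strings d) (wd1 : wf_strings d1) (wd' : wf_strings d').
Hypothesis arcE : forall j j', middle_arc d1 d' j j' =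
  middle_arc d d' j j' || ((j == a) && (j' == b) || (j == b) && (j' == a)).
Hypotheses (opa : ~~ middle_closed d d' a) (opb : ~~ middle_closed d d' b).
Hypothesis closedE : forall j, j != a -> j != b -> middle_closed d1 d' j = middle_closed d d' j.
Hypothesis decoE : forall j, j != a -> j != b -> deco d1 (inr j) = deco d (inr j).
Notation R := (middle_arc d d').
Notation R1 := (middle_arc d1 d').
Notation C := (connect R1 a).

Let symR : connect_sym R := sym_connect_sym (middle_arc_sym wd wd').
Let symR1 : connect_sym R1 := sym_connect_sym (middle_arc_sym wd1 wd').

Lemma connect_closed_ind (T : finType) (e : rel T) (S : pred T) x y :
  (forall u v, S u -> e u v -> S v) -> S x -> connect e x y -> S y.
Proof.
move=> h hx /connectP[s]; elim: s x hx => [|z s IH] x hx /=; first by move=> _ ->.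
by case/andP=> exz ps ey; apply: (IH z) => //; apply: h exz.
Qed.

Lemma connR1 x y : connect R x y -> connect R1 x y.
Proof. by apply: connect_sub => u v e; apply: connect1; rewrite arcE e. Qed.

Lemma Cb : C b. Proof. by apply: connect1; rewrite arcE !eqxx orbT. Qed.

Lemma connR_out j x : ~~ C j -> connect R1 j x = connect R j x.
Proof.
move=> nC; apply/idP/idP; last exact: connR1.
apply: (@connect_closed_ind _ R1 (connect R j)) => // u v ju.
rewrite arcE => /or3P[e|/andP[/eqP E _]|/andP[/eqP E _]].
- exact: connect_trans ju (connect1 e).
- by case/negP: nC; rewrite symR1; apply: connR1; rewrite -E.
case/negP: nC; apply: connect_trans Cb _; rewrite symR1; apply: connR1.
by rewrite -E.
Qed.

Lemma C_old j : C j -> connect R j a || connect R j b.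
Proof.
apply: (@connect_closed_ind _ R1 (fun j => connect R j a || connect R j b)); last by rewrite connect0.
move=> u v hu; rewrite arcE => /or3P[e|/andP[_ /eqP->]|/andP[_ /eqP->]]; last 2 first.
- by rewrite connect0 orbT.
- by rewrite connect0.
have vu : connect R v u by rewrite symR connect1.
by case/orP: hu => h; rewrite (connect_trans vu h) ?orbT.
Qed.

Lemma C_head j : C j -> loop_head d d' j = false.
Proof.
move=> /C_old h; apply/negP => /forallP hj.
by case/orP: h => h; [have := hj a|have := hj b]; rewrite h /= ?(negbTE opa) ?(negbTE opb) andbF.
Qed.

Lemma nC_ab j x : ~~ C j -> connect R j x -> (x != a) && (x != b).
Proof.
move=> nC h; apply/andP; split; apply: contraNneq nC => E.
  by rewrite symR1 connR1 // -E.
by apply: connect_trans Cb _; rewrite symR1 connR1 // -E.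
Qed.

(** The arc added between [a] and [b] only affects their component [C]. There was no loop in it
    before, since [a] and [b] were open ends, and the other components are untouched. *)
Lemma loops_split : loops P d1 d' = (loops P d d' *
  \prod_(j | loop_head d1 d' j && C j)
      loop_coef P (loop_count d1 d' bL j) (loop_count d1 d' bR j))%R.
Proof.
rewrite /loops (bigID C) /= mulrC; congr (_ * _)%R.
rewrite [RHS](bigID C) /= [X in _ = (X * _)%R]big_pred0 ?mul1r; last first.
  by move=> j; case Cj: (C j); rewrite ?andbF // C_head.
have hc j : ~~ C j -> loop_head d1 d' j = loop_head d d' j.
  move=> nC; apply: eq_forallb => x; rewrite connR_out //.
  case h: (connect R j x) => //=; have /andP[xa xb] := nC_ab nC h.
  by rewrite closedE.
rewrite (eq_bigl (fun j => loop_head d d' j && ~~ C j)); last first.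
  by move=> j; case Cj: (C j) => /=; rewrite ?andbF // !andbT hc ?Cj.
apply: eq_bigr => j /andP[_ nC].
have hl c : loop_count d1 d' c j = loop_count d d' c j.
  rewrite /loop_count (eq_bigl (connect R j)); last by move=> x; rewrite connR_out.
  congr (_./2); apply: eq_bigr => x h; have /andP[xa xb] := nC_ab nC h.
  by rewrite decoE.
by rewrite !hl.
Qed.

Lemma loops_open j0 : C j0 -> ~~ middle_closed d1 d' j0 -> loops P d1 d' = loops P d d'.
Proof.
move=> h0 op; rewrite loops_split big_pred0 ?mulr1 // => j.
apply/negP => /andP[/forallP h Cj]; have := h j0.
by rewrite (connect_trans _ h0) ?(negbTE op) ?andbF // symR1.
Qed.

(** A loop is counted at its leftmost node, so a closed component contributes exactly one factor. It
    may be computed from [a], as the counts depend on the component only. *)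
Lemma loops_new : (forall j, C j -> middle_closed d1 d' j) ->
  loops P d1 d' = (loops P d d' *
    loop_coef P (loop_count d1 d' bL a) (loop_count d1 d' bR a))%R.
Proof.
move=> hcl; rewrite loops_split; congr (_ * _)%R.
have Ca : C a by rewrite connect0.
case: (arg_minnP (fun j : 'I_l => j : nat) Ca) => j0 Cj0 hmin.
have E0 : connect R1 j0 =1 C by move=> x; apply/esym; apply: same_connect.
rewrite (big_pred1 j0) => [|j].
  have hl c : loop_count d1 d' c j0 = loop_count d1 d' c a.
    by rewrite /loop_count (eq_bigl C).
  by rewrite !hl.
apply/andP/eqP => [[/forallP hj Cj]|->{j}].
  apply/val_inj/eqP; rewrite eqn_leq hmin // andbT.
  by have := hj j0; rewrite (connect_trans _ Cj0) 1?symR1 //= => /andP[].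
split=> //; apply/forallP => j; apply/implyP; rewrite E0 => Cj.
by rewrite hmin // hcl.
Qed.
End Loops.

#[local] Arguments raw_string : simpl never.

Section Trace.
Context {n l r : nat} (d : ddiag n l) (d' : ddiag l r).
Notation prun := (run glue (pth d d') (plab d d')).

Lemma mid_step t j j1 : mid t = Some j -> mid (pth d d' t) = Some j1 ->
  middle_arc d d' j j1.
Proof.
case: t => [[i|a]|[a|b]] //= [->]; rewrite /middle_arc.
  by case: (partner d (inr j)) => // a' [->]; rewrite eqxx.
by case: (partner d' (inl j)) => // a' [->]; rewrite eqxx orbT.
Qed.

Lemma trace_conn t y w s j u j' : prun t y w s -> mid t = Some j ->
  u \in s -> mid u = Some j' -> connect (middle_arc d d') j j'.
Proof.
move=> h; elim: h j => // {}t {}y {}w {}s ht h IH j Ej us Eu.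
have [j1 Ej1] : exists j1, mid (pth d d' t) = Some j1.
  by rewrite -mid_glue; apply: mid_some; rewrite glueK eq_sym.
have e := connect1 (mid_step Ej Ej1); rewrite -mid_glue in Ej1.
move: us; rewrite inE => /predU1P[E|us]; first by move: Eu; rewrite E Ej1 => -[<-].
exact: connect_trans e (IH _ Ej1 us Eu).
Qed.
End Trace.

Section Master.
Context {n l r : nat} (d : ddiag n l) (d' : ddiag l r).
Hypotheses (wd : wf_strings d) (wd' : wf_strings d') (rd : reducedd d).
Context (i i' : 'I_n) (ii' : i != i').
Context {k : fieldType} (P : blob_params k).
Notation p := (inl i : node n l).
Notation p' := (inl i' : node n l).
Notation q := (inl i : node n r).
Notation q' := (inl i' : node n r).
Let pp' : p != p'. Proof. by apply: contraNneq ii' => -[->]. Qed.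
Let qq' : q != q'. Proof. by apply: contraNneq ii' => -[->]. Qed.
Notation d1 := (surg p p' d).
Notation raw := (raw_string d d').
Notation raw' := (raw_string d1 d').
Notation D := (stack0 d d').
Notation prun := (run glue (pth d d') (plab d d')).

Let wD : wf_strings D := wf_stack0 wd wd'.
Let wS : wf_strings d1 := wf_surg wd pp'.
Let hf := let: And3 h _ _ := wf_stringsP _ wd in h.
Let hK := let: And3 _ h _ := wf_stringsP _ wd in h.
Let hr := let: And3 _ _ h := wf_stringsP _ wd in h.

Lemma arc_bottom : partner D q = q' -> partner d p != p' ->
  exists a b, [/\ partner d p = inr a, partner d p' = inr b & a != b].
Proof.
rewrite partner_stack0 => E ne.
have E' : (raw q').1 = q.
  by have := wf_raw wd wd' q; case: (raw q) E => A w /= -> [_ ->].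
case Ea : (partner d p) => [z|a].
  move: E; rewrite /raw_string /= Ea /= => -[E].
  by rewrite Ea E eqxx in ne.
case Eb : (partner d p') => [z|b].
  move: E'; rewrite /raw_string /= Eb /= => -[E'].
  by have := hK p'; rewrite Eb E' Ea.
exists a, b; split=> //; apply: contraNneq pp' => E2.
by rewrite -(inj_eq (inv_inj hK)) Ea Eb E2.
Qed.

Local Open Scope ring_scope.

Definition strands_coef (e : ddiag n l) : k :=
  \prod_(x : node n r | (unsplit x < unsplit (raw_string e d' x).1)%N)
      red_coef P (raw_string e d' x).2.

Lemma strands_coefT (e : ddiag n l) : strands_coef e =
  \prod_(x : node n r | (unsplit x < unsplit (raw_string e d' x).1)%N && xpredT x)
      red_coef P (raw_string e d' x).2.
Proof. by apply: eq_bigl => x; rewrite andbT. Qed.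

Lemma strands_pairs (e : ddiag n l) (Q : pred (node n r)) z : wf_strings e ->
  Q z -> Q (raw_string e d' z).1 ->
  \prod_(x | (unsplit x < unsplit (raw_string e d' x).1)%N && Q x)
      red_coef P (raw_string e d' x).2 =
  red_coef P (raw_string e d' z).2 *
  \prod_(x | (unsplit x < unsplit (raw_string e d' x).1)%N &&
             (Q x && (x != z) && (x != (raw_string e d' z).1)))
      red_coef P (raw_string e d' x).2.
Proof.
move=> we; have [gf gK _] := wf_stringsP _ (wf_stack0 we wd').
have E x : (raw_string e d' x).1 = partner (stack0 e d') x by rewrite partner_stack0.
apply: (@prod_pairs _ (fun x => (raw_string e d' x).1) (fun x => unsplit x : nat)).
- by move=> x; rewrite !E gK.
- by move=> x; rewrite E.
- by move=> x y /val_inj; apply: (can_inj (@unsplitK _ _)).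
by move=> x; have := wf_raw we wd' x; case: raw_string => y w [_ ->] /=; rewrite coef_rev.
Qed.

Lemma raw_untouched x : x != q -> x != q' -> x != (raw q).1 -> x != (raw q').1 ->
  raw' x = raw x.
Proof.
move=> h1 h2 h3 h4; apply: raw_surg_same => //.
  apply: contraNneq h3 => E; have := wf_raw wd wd' x.
  by case: (raw x) E => y w /= -> [_ ->].
apply: contraNneq h4 => E; have := wf_raw wd wd' x.
by case: (raw x) E => y w /= -> [_ ->].
Qed.

Lemma strands_loop : partner D q = q' ->
  strands_coef d = red_coef P (raw q).2 * strands_coef d1.
Proof.
move=> E; have Ep : raw' q = (q', [::]) by apply: raw_surg_p.
rewrite partner_stack0 in E.
have E' : (raw q').1 = q.
  by have := wf_raw wd wd' q; case: (raw q) E => A w /= -> [_ ->].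
rewrite !strands_coefT.
rewrite (@strands_pairs d xpredT q) // E; congr (_ * _).
rewrite (@strands_pairs d1 xpredT q) // Ep mul1r /=.
have S x : x != q -> x != q' -> raw' x = raw x.
  by move=> h1 h2; apply: raw_untouched; rewrite ?E ?E'.
apply: eq_big => [x|x /and3P[_ h1 h2]]; last by rewrite S.
have [->|h1] := eqVneq x q; first by rewrite !andbF.
have [->|h2] := eqVneq x q'; first by rewrite !andbF.
by rewrite S.
Qed.

Lemma strands_join : partner D q != q' ->
  red_coef P (deco d (partner d p) ++ deco d p') * strands_coef d1 =
  strands_coef d * red_coef P (deco D (partner D q) ++ deco D q').
Proof.
move=> ne; have E0 := raw_join_coef wd wd' ii' P; rewrite partner_stack0 in ne.
have {}E0 := E0 ne.
have [gf gK _] := wf_stringsP _ wD.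
have E x : (raw x).1 = partner D x by rewrite partner_stack0.
have Ep : raw' q = (q', [::]) by apply: raw_surg_p.
have [u [v [_ _ EA]]] := raw_surg_join wd wd' ii' ne.
have Aq : (raw q).1 != q by rewrite E.
have Bq' : (raw q').1 != q' by rewrite E.
have Bq : (raw q').1 != q by apply: contraNneq ne; rewrite !E => <-; rewrite gK.
have AB : (raw q).1 != (raw q').1.
  by apply: contraNneq qq'; rewrite !E => /(inv_inj gK)->.
rewrite !strands_coefT.
rewrite (@strands_pairs d xpredT q) // (@strands_pairs d _ q') //; last 2 first.
- by rewrite eq_sym qq' eq_sym ne.
- by rewrite Bq eq_sym AB.
rewrite (@strands_pairs d1 xpredT q) // (@strands_pairs d1 _ (raw q).1) // ?Ep /= ?Aq ?ne //; last first.
  by rewrite EA /= Bq Bq'.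
rewrite mul1r mulrA E0 -!mulrA; congr (_ * _); congr (_ * _); rewrite mulrC; congr (_ * _).
rewrite EA /=; apply: eq_big => [x|x].
  have [->|h1] := eqVneq x q; first by rewrite !andbF.
  have [->|h2] := eqVneq x q'; first by rewrite !andbF.
  have [->|h3] := eqVneq x (raw q).1; first by rewrite !andbF.
  have [->|h4] := eqVneq x (raw q').1; first by rewrite !andbF.
  by rewrite raw_untouched.
by move=> /andP[_ /andP[/andP[/andP[h1 h2] h3] h4]]; rewrite raw_untouched.
Qed.

Lemma mid_arcs j : partner d (inr j) != p -> partner d (inr j) != p' -> d1 (inr j) = d (inr j).
Proof. by move=> h1 h2; apply: surg_same. Qed.

Lemma loops_top : (forall a b, partner d p = inr a -> partner d p' <> inr b) ->
  loops P d1 d' = loops P d d'.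
Proof.
move=> h; have cl j : ~~ [exists j1, partner d (inr j) == inr j1] -> forall j1, partner d1 (inr j) <> inr j1.
  move=> hj j1; rewrite /partner.
  pose Q (x : node n l) (yw : node n l * word) := x = inr j -> yw.1 <> inr j1.
  apply: (surg_ind wd pp' (Q := Q)) => // [pn E|pn E|x _ _ _ _ -> E].
  - exact: (h _ _ E).
  - by move=> E'; apply: (h _ _ E' E).
  by case/negP: hj; apply/existsP; exists j1; apply/eqP.
have key j j1 : (partner d1 (inr j) == inr j1) = (partner d (inr j) == inr j1).
  case hj: [exists j1, partner d (inr j) == inr j1]; last first.
    apply/eqP/eqP => E; first by case: (cl j (negbT hj) j1).
    by case/negP: (negbT hj); apply/existsP; exists j1; rewrite E.
  have /existsP[j2 /eqP Ej] := hj.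
  by rewrite /partner mid_arcs // -/(partner d _) Ej.
apply: loops_same => [j j'|j|j a /andP[/existsP[j2 /eqP Ej] _]].
- by rewrite /middle_arc key.
- rewrite /middle_closed; congr (_ && _); apply: eq_existsb => j1; exact: key.
by rewrite /deco mid_arcs ?Ej.
Qed.

Section Bottom.
Context (a b : 'I_l) (Ea : partner d p = inr a) (Eb : partner d p' = inr b) (ab : a != b).

Let Ea' : partner d (inr a) = p. Proof. by rewrite -Ea hK. Qed.
Let Eb' : partner d (inr b) = p'. Proof. by rewrite -Eb hK. Qed.
Let ne : partner d p != p'. Proof. by rewrite Ea. Qed.

Lemma surg_a : d1 (inr a) = (inr b, red_word (deco d (inr a) ++ deco d p')).
Proof. by have := surg_join wd ne; rewrite Ea Eb. Qed.
Lemma surg_b : d1 (inr b) = (inr a, red_word (deco d (inr b) ++ deco d p)).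
Proof. by have := surg_join' wd pp' ne; rewrite Ea Eb. Qed.
Lemma surg_ab j : j != a -> j != b -> d1 (inr j) = d (inr j).
Proof.
move=> ja jb; apply: mid_arcs.
  by apply: contraNneq ja => /(canRL hK) E; move: E; rewrite Ea => -[->].
by apply: contraNneq jb => /(canRL hK) E; move: E; rewrite Eb => -[->].
Qed.

Lemma arc_ab j j' : middle_arc d1 d' j j' =
  middle_arc d d' j j' || ((j == a) && (j' == b) || (j == b) && (j' == a)).
Proof.
rewrite /middle_arc /partner.
have [->|ja] := eqVneq j a.
  rewrite surg_a -/(partner d (inr a)) Ea' /= (negbTE ab) orbF orbC.
  by congr (_ || _); rewrite eq_sym.
have [->|jb] := eqVneq j b.
  rewrite surg_b -/(partner d (inr b)) Eb' /= orbC.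
  by congr (_ || _); rewrite eq_sym.
by rewrite surg_ab // orbF.
Qed.

Lemma open_a : ~~ middle_closed d d' a.
Proof. by rewrite negb_and; apply/orP; left; apply/existsP => -[j]; rewrite Ea'. Qed.
Lemma open_b : ~~ middle_closed d d' b.
Proof. by rewrite negb_and; apply/orP; left; apply/existsP => -[j]; rewrite Eb'. Qed.
Lemma closed_ab j : j != a -> j != b -> middle_closed d1 d' j = middle_closed d d' j.
Proof. by move=> ja jb; rewrite /middle_closed /partner surg_ab. Qed.
Lemma deco_ab j : j != a -> j != b -> deco d1 (inr j) = deco d (inr j).
Proof. by move=> ja jb; rewrite /deco surg_ab. Qed.

Lemma first_step A w s : prun (opn q) A w s ->
  exists w1 s1, s = inr (inl a) :: s1 /\ prun (inr (inl a)) A w1 s1.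
Proof.
move=> h; have [|w1 [s1 [_ Es h1]]] := run_stepE h; first by rewrite /= Ea.
by exists w1, s1; move: Es h1; rewrite /= Ea.
Qed.

Lemma trace_C A w s u j : prun (opn q) A w s -> u \in s -> mid u = Some j ->
  connect (middle_arc d1 d') a j.
Proof.
move=> h us Eu; apply: (connR1 arc_ab); have [w1 [s1 [Es h1]]] := first_step h.
move: us; rewrite Es inE => /predU1P[E|us]; first by move: Eu; rewrite E => -[<-].
exact: (trace_conn h1 _ us Eu).
Qed.

(** The string leaving [q] ends at an outer node other than [q'], so its last middle node is still
    open after the surgery, and this node lies in the component of the new arc. *)
Lemma loops_bottom_open : partner D q != q' -> loops P d1 d' = loops P d d'.
Proof.
rewrite partner_stack0 => neA; have [s h] := raw_exists wd wd' q.
have [w1 [s1 [Es h1]]] := first_step h.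
have [|u us Eu] := run_last h; first by rewrite Es.
have [[_ ho _] _] := run_once (@glueK n l r) (pthK wd wd') (pth_free wd wd') h.
have [j Ej] := mid_some (ho u us).
have Cj := trace_C h us Ej.
apply: (loops_open P wd wS wd' arc_ab open_a open_b closed_ab deco_ab Cj).
case: u us Eu Ej => [[//|j1]|[j1|//]] us /= Eu [Ej]; rewrite -Ej negb_and; apply/orP.
  left; apply/existsP => -[j2].
  case Eq : (raw q).1 Eu neA => [z|z] //= -[Eu] neA.
  have np : partner d (inr j1) != p.
    apply/eqP => E; have := raw_exists wd wd' q; rewrite Eq => -[s2 h2].
    apply: (run_neq (@glueK n l r) (pthK wd wd') (pth_free wd wd') (plabE wd wd') (glue_opn q)).
    by move: h2; rewrite -[opn (inl z)]/(inl (inl z)) -Eu E; apply.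
  have np' : partner d (inr j1) != p' by apply: contraNneq neA; rewrite Eu => -[->].
  by rewrite /partner mid_arcs // -/(partner d _) Eu.
right; apply/existsP => -[j2]; move: Eu; case: (raw q).1 {neA h} => z //= [->] //.
Qed.

Section Closed.
Context (w : seq blob) (s : seq (@port n l r)) (h : prun (opn q) (opn q') w s).

Let ho u : u \in s -> glue u != u.
Proof. by have [[_ ho _] _] := run_once (@glueK n l r) (pthK wd wd') (pth_free wd wd') h; apply: ho. Qed.

Let mem_mid u j : u \in s -> mid u = Some j -> j \in pmap mid s.
Proof. by move=> us E; rewrite mem_pmap; apply/mapP; exists u. Qed.

Lemma trace_arcs j : j \in pmap mid s ->
  (exists2 j1, j1 \in pmap mid s & partner d' (inl j) = inl j1) /\
  [\/ partner d (inr j) = p, partner d (inr j) = p' |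
      exists2 j1, j1 \in pmap mid s & partner d (inr j) = inr j1].
Proof.
rewrite mem_pmap => /mapP[u us Eu].
have key t : mid t = Some j -> [\/ pth d d' t = opn q, pth d d' t = opn q',
    pth d d' t \in s | glue (pth d d' t) \in s].
  have [h1 h2] := run_closed (@glueK n l r) (pthK wd wd') h us.
  case/(mid_inj (esym Eu)) => ->.
    by case: h1 => ->; [constructor 2|constructor 4].
  by case: h2 => ->; [constructor 1|constructor 3].
have key2 t : mid t = Some j -> [\/ pth d d' t = opn q, pth d d' t = opn q' |
    exists2 j1, j1 \in pmap mid s & mid (pth d d' t) = Some j1].
  case/key => [->|->|hs|hs]; [by constructor 1|by constructor 2|constructor 3|constructor 3].
    by have [j1 E1] := mid_some (ho hs); exists j1; rewrite // (mem_mid hs).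
  have [j1 E1] := mid_some (ho hs); exists j1; first by rewrite (mem_mid hs).
  by rewrite -mid_glue.
split.
  have [] := key2 (inr (inl j)) erefl => // -[j1 js] /=.
  by case: (partner d' (inl j)) => // j2 [->]; exists j1.
have [] := key2 (inl (inr j)) erefl => [[->]|[->]|[j1 js] /=]; [by constructor 1|by constructor 2|].
by case: (partner d (inr j)) => // j2 [->]; constructor 3; exists j1.
Qed.

Lemma a_trace : a \in pmap mid s.
Proof.
have [w1 [s1 [Es _]]] := first_step h.
by rewrite mem_pmap; apply/mapP; exists (inr (inl a)); rewrite ?Es ?mem_head.
Qed.

Lemma b_trace : b \in pmap mid s.
Proof.
have h' := run_sym (@glueK n l r) (pthK wd wd') (plabE wd wd') (glue_opn q) h.
have [|u1 [s1 [_ Es _]]] := run_stepE h'; first by rewrite /= Eb.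
have : inr (inl b) \in rev (map glue s) by rewrite Es /= Eb mem_head.
rewrite mem_rev => /mapP[u us Eu]; rewrite (mem_mid us) //.
by rewrite -mid_glue -Eu.
Qed.

Lemma C_trace : connect (middle_arc d1 d') a =1 [pred j | j \in pmap mid s].
Proof.
move=> j; apply/idP/idP => /=; last first.
  by rewrite mem_pmap => /mapP[u us Eu]; apply: (trace_C h us).
move=> C; apply: (connect_closed_ind _ _ C); last exact: a_trace.
move=> u v us; rewrite arc_ab => /orP[|]; last first.
  by case/orP => /andP[_ /eqP->]; [exact: b_trace|exact: a_trace].
have [[j1 hj1 E1] h2] := trace_arcs us.
rewrite /middle_arc E1 => /orP[/eqP E|/eqP[<-] //].
by case: h2 => [|| [j2 hj2]]; rewrite E // => -[->].
Qed.

Lemma closed_trace j : connect (middle_arc d1 d') a j -> middle_closed d1 d' j.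
Proof.
rewrite C_trace /= => js; have [[j1 _ E1] h2] := trace_arcs js.
rewrite /middle_closed; apply/andP; split; apply/existsP; last by exists j1; rewrite E1.
have [->|ja] := eqVneq j a; first by exists b; rewrite /partner surg_a.
have [->|jb] := eqVneq j b; first by exists a; rewrite /partner surg_b.
case: h2 => [E|E|[j2 _ E]]; last by exists j2; rewrite /partner surg_ab // -/(partner d _) E.
  by move/(canRL hK): E; rewrite Ea => -[/eqP]; rewrite (negbTE ja).
by move/(canRL hK): E; rewrite Eb => -[/eqP]; rewrite (negbTE jb).
Qed.

Lemma sum_trace (F : 'I_l -> nat) :
  (\sum_(j | connect (middle_arc d1 d') a j) F j = \sum_(u <- s) oapp F 0 (mid u))%N.
Proof.
have gen (t : seq (@port n l r)) : (\sum_(j <- pmap mid t) F j = \sum_(u <- t) oapp F 0 (mid u))%N.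
  elim: t => [|u t IH] /=; first by rewrite !big_nil.
  by rewrite big_cons -IH; case: (mid u) => [j|] //=; rewrite big_cons.
have [[us ho' hn] _] := run_once (@glueK n l r) (pthK wd wd') (pth_free wd wd') h.
by rewrite (eq_bigl _ _ C_trace) -gen big_uniq // uniq_mid.
Qed.

(** The new loop has the arcs of the string from [q] to [q'], except that its two extreme strings in
    [d] are replaced by a single one, whose word has been straightened. The inequality makes the
    later subtraction of blobs legitimate. *)
Lemma count_trace c :
  (loop_count d1 d' c a + count_mem c (deco d p) + count_mem c (deco d p') =
     count_mem c w + count_mem c (red_word (deco d (partner d p) ++ deco d p')))%N /\
  (count_mem c (deco d p) + count_mem c (deco d p') <= count_mem c w)%N.
Proof.
have cr u : count_mem c (deco d (partner d u)) = count_mem c (deco d u) by rewrite hr count_rev.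
have E0 := run_count (@glueK n l r) (plabE wd wd') c h.
pose F (e : ddiag n l) (j : 'I_l) := (count_mem c (deco e (inr j)) + count_mem c (deco d' (inl j)))%N.
have E1 : (\sum_(u <- s) (count_mem c (plab d d' u) + count_mem c (plab d d' (glue u))) =
   \sum_(j | connect (middle_arc d1 d') a j) F d j)%N.
  rewrite sum_trace !big_seq; apply: eq_bigr => u /ho.
  by case: u => [[x|x]|[x|x]]; rewrite /= ?eqxx // => _; rewrite addnC.
rewrite {}E1 /= in E0.
have Ca : connect (middle_arc d1 d') a a by [].
have Cb : connect (middle_arc d1 d') a b && (b != a) by rewrite C_trace /= b_trace eq_sym ab.
rewrite /loop_count (bigD1 a) //= (bigD1 b) //=.
rewrite (bigD1 a) //= (bigD1 b) //= in E0.
set X := (\sum_(j | _) _)%N; set Y := (\sum_(j | _) _)%N in E0.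
have EXY : X = Y.
  by apply: eq_bigr => j /andP[/andP[_ ja] jb]; rewrite /F deco_ab.
have Da : count_mem c (deco d (inr a)) = count_mem c (deco d p) by rewrite -Ea cr.
have Db : count_mem c (deco d (inr b)) = count_mem c (deco d p') by rewrite -Eb cr.
rewrite /F Da Db in E0.
rewrite Ea /deco surg_a surg_b /=.
have W : count_mem c (red_word ((d (inr b)).2 ++ (d p).2)) =
         count_mem c (red_word ((d (inr a)).2 ++ (d p').2)).
  rewrite -[in LHS]count_rev -red_rev rev_cat; congr (count_mem c (red_word (_ ++ _))).
    by have := hr p; rewrite Ea /deco => ->.
  by have := hr p'; rewrite Eb /deco => ->; rewrite revK.
rewrite W; move: E0; rewrite -EXY {EXY} /deco; clearbody X.
move: (count_mem c (red_word _)) (count_mem c (d (inl i)).2) (count_mem c (d (inl i')).2) (count_mem c w)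
  (count_mem c (d' (inl a)).2) (count_mem c (d' (inl b)).2) X.
by clear; move=> c1 c2 c3 c4 c5 c6 X; rewrite -!muln2 => E; split; lia.
Qed.

End Closed.

(** With one kind of blob all scalars are powers of the same $\delta$, up to the value of a loop
    with at most one blob. Straightening at the junction of the two strings of [d] only anticipates
    some of these factors. *)
Lemma loops_bottom_closed : partner D q = q' -> mono (raw q).2 ->
  red_coef P (deco d (partner d p) ++ deco d p') * loops P d1 d' =
  loops P d d' * (red_coef P (raw q).2 * loopw P (deco D q)).
Proof.
rewrite partner_stack0 deco_stack0 => E; have [s] := raw_exists wd wd' q; rewrite E => h.
case/mono_nseq => c [j Ew]; rewrite Ew in h *.
rewrite (loops_new P wd wS wd' arc_ab open_a open_b closed_ab deco_ab (closed_trace h)).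
have [d1E d2E] : (exists j1, (deco d p : seq blob) = nseq j1 c) /\
    (exists j2, (deco d p' : seq blob) = nseq j2 c).
  have sub (u v : seq blob) : nseq j c = u ++ v -> exists j1, u = nseq j1 c.
    move=> Eu; exists (size u); apply/all_pred1P; have := all_pred1_nseq c j.
    by rewrite Eu all_cat => /andP[].
  have [w1 [s1 [E1 _ _]]] : exists u s', [/\ nseq j c = plab d d' (opn q) ++ u,
      s = glue (pth d d' (opn q)) :: s' & prun (glue (pth d d' (opn q))) (opn q') u s'].
    by apply: run_stepE h _; rewrite /= Ea.
  split; first exact: sub E1.
  have h' := run_sym (@glueK n l r) (pthK wd wd') (plabE wd wd') (glue_opn q) h.
  have [|w2 [s2 [E2 _ _]]] := run_stepE h'; first by rewrite /= Eb.
  by apply: (sub _ w2); rewrite -E2 rev_nseq.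
case: d1E d2E => j1 Ej1 [j2 Ej2].
have Ej1' : deco d (partner d p) = nseq j1 c :> seq blob by rewrite hr Ej1 rev_nseq.
have H x := count_trace h x.
have jj : (j1 + j2 <= j)%N.
  by have [_] := H c; rewrite Ej1 Ej2 !count_nseq /= eqxx !mul1n.
have Lc x : loop_count d1 d' x a =
    count_mem x (nseq (j - (j1 + j2) + (j1 + j2 != 0%N)) c).
  have [+ _] := H x; rewrite Ej1 Ej2 Ej1' -nseqD red_nseq !count_nseq /=.
  by clear -jj; case: (c == x); rewrite ?mul1n ?mul0n; lia.
rewrite !Lc -/(loopw P _) Ej1' Ej2 -nseqD /loopw red_nseq -!/(loopw P _) !coef_nseq mulrCA.
congr (_ * _).
have [j0|j0] := posnP (j1 + j2); rewrite ?j0 /= ?expr0 ?mul1r ?subn0 ?addn0.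
  have [->|jp] := posnP j; first by rewrite /= expr0 mul1r.
  by rewrite !loop_nseq // expr0 mul1r.
have jp : (0 < j)%N by apply: leq_trans jj.
have -> : (j != 0%N) = true by rewrite -lt0n.
rewrite !loop_nseq //; last by rewrite addn1.
rewrite expr0 mul1r !mulrA -exprD.
by congr (_ ^+ _ * _); clear -jj j0 jp; lia.
Qed.

End Bottom.

Definition cup_coef l1 (e : ddiag n l1) : k :=
  if partner e (inl i) == inl i' then loopw P (deco e (inl i))
  else red_coef P (deco e (partner e (inl i)) ++ deco e (inl i')).

Lemma stack0_coefE (e : ddiag n l) : stack0_coef P e d' = strands_coef e * loops P e d'.
Proof. by []. Qed.

(** The cocycle identity behind associativity. Either $e_i$ closes a loop inside [d], or it closes
    one that passes through [d'], or it joins two distinct strings; the hypothesis on the word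
    serves the second case. *)
Lemma stack0_coef_surg : (partner D q = q' -> mono (raw q).2) ->
  cup_coef d * stack0_coef P d1 d' = stack0_coef P d d' * cup_coef D.
Proof.
move=> hm; rewrite !stack0_coefE /cup_coef.
have [Ep|nep] := eqVneq (partner d p) p'.
  have Er : raw q = (q', deco d p : seq blob) by rewrite /raw_string /= Ep.
  have E : partner D q = q' by rewrite partner_stack0 Er.
  rewrite E eqxx (strands_loop E) Er red_coef_id ?mul1r; last exact: rd.
  rewrite loops_top; last by move=> a b; rewrite Ep.
  have -> : deco D q = deco d p :> seq blob.
    by rewrite deco_stack0 Er; apply: red_id; apply: rd.
  by rewrite mulrC.
have [E|ne] := eqVneq (partner D q) q'.
  have [a [b [Ea Eb ab]]] := arc_bottom E nep.
  have H := loops_bottom_closed Ea Eb ab E (hm E).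
  by rewrite (strands_loop E) [LHS]mulrCA H; ring.
rewrite mulrA strands_join // mulrAC; congr (_ * _ * _).
case Ea : (partner d p) => [z|a]; first by apply: loops_top => a b; rewrite Ea.
case Eb : (partner d p') => [z|b]; first by apply: loops_top => a' b _; rewrite Eb.
apply: (loops_bottom_open Ea Eb) => //; apply: contraNneq pp' => E.
by rewrite -(inj_eq (inv_inj hK)) Ea Eb E.
Qed.
End Master.

Section MasterDec.
Context {n l r : nat} (d : ddiag n l) (d' : ddiag l r).
Hypotheses (wd : wf_strings d) (wd' : wf_strings d') (rd : reducedd d).
Context (i : 'I_n) (a : blob).
Context {k : fieldType} (P : blob_params k).
Notation z := (inl i : node n l).
Notation zq := (inl i : node n r).
Notation d1 := (dec z a d).
Notation raw := (raw_string d d').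
Notation raw' := (raw_string d1 d').
Notation D := (stack0 d d').

Let wD : wf_strings D := wf_stack0 wd wd'.
Let wS : wf_strings d1 := wf_dec wd z a.

Let pthE : pth d1 d' =1 pth d d'.
Proof. by case=> x //=; rewrite partner_dec. Qed.

Let opnE x y : (opn x == opn y :> port) = (x == y :> node n r) := inj_eq (@opn_inj n l r) x y.

Let plab_same : forall t : port, t != opn zq -> pth d d' t != opn zq -> plab d1 d' t = plab d d' t.
Proof.
by move=> [x|x] // h1 h2; rewrite /plab /deco dec_same.
Qed.

Let plab_z : plab d1 d' (opn zq) = red_word (a :: plab d d' (opn zq)).
Proof. by rewrite /plab /= /deco dec_z. Qed.

Lemma run_pthE t y w s : run glue (pth d d') (plab d1 d') t y w s ->
  run glue (pth d1 d') (plab d1 d') t y w s.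
Proof.
elim=> {t y w s} [t ht|t y w s ht _ IH].
  by rewrite -pthE; apply: run_end; rewrite pthE.
by rewrite -pthE; apply: run_step; rewrite pthE.
Qed.

Lemma raw_dec_same x : x != zq -> (raw x).1 != zq -> raw' x = raw x.
Proof.
move=> h1 h2; have [s] := raw_exists wd wd' x; case: (raw x) h2 => y w /= h2 h.
apply: (raw_run wS wd' (s := s)); apply: run_pthE.
by apply: (run_dec (@glueK n l r) (glue_opn zq) plab_same h); rewrite opnE.
Qed.

Lemma raw_dec_z : exists2 u, (raw zq).2 = deco d z ++ u &
  raw' zq = ((raw zq).1, red_word (a :: deco d z) ++ u).
Proof.
have [s hs] := raw_exists wd wd' zq.
have [u Eu h] := run_dec_z (@glueK n l r) (pthK wd wd') (pth_free wd wd')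
  (plabE wd wd') (glue_opn zq) plab_same plab_z hs.
by exists u => //; apply: (raw_run wS wd' (s := s)); apply: run_pthE.
Qed.

Lemma stack0_dec : stack0 (dec z a d) d' = dec zq a D.
Proof.
have [hf hK hr] := wf_stringsP _ wD.
pose Q x (yw : node n r * word) := stack0 d1 d' x = yw.
have st x : stack0 d1 d' x = ((raw' x).1, red_word (raw' x).2) by rewrite ffunE.
have [u E1 E2] := raw_dec_z.
have Ez : red_word (red_word (a :: deco d z) ++ u) = red_word (a :: deco D zq).
  by rewrite red_catl deco_stack0 E1 -[in RHS]cat1s red_catr.
apply/ffunP; apply: (dec_ind wD (Q := Q)); rewrite /Q.
- by rewrite st E2 partner_stack0 Ez.
- have := wf_raw wS wd' zq; rewrite E2 partner_stack0 => -[_ E3].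
  rewrite st E3; congr (_, _); apply: word_eq; rewrite red_rev Ez -red_rev rev_cons.
  by rewrite -hr partner_stack0.
move=> x h1; rewrite partner_stack0 => h2; rewrite st raw_dec_same //.
by rewrite ffunE.
Qed.

Local Open Scope ring_scope.

Lemma stack0_coef_dec : cons_coef P a (deco d z) * stack0_coef P d1 d' =
  stack0_coef P d d' * cons_coef P a (deco D zq).
Proof.
rewrite !stack0_coefE.
have -> : loops P d1 d' = loops P d d'.
  apply: loops_same => [j j'|j|j c /andP[/existsP[j2 /eqP Ej] _]].
  - by rewrite /middle_arc partner_dec.
  - rewrite /middle_closed; congr (_ && _); apply: eq_existsb => j1; by rewrite partner_dec.
  by rewrite /deco dec_same // Ej.
have [u E1 E2] := raw_dec_z.
rewrite !strands_coefT (@strands_pairs _ _ _ d' wd' _ P d xpredT zq) //.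
rewrite (@strands_pairs _ _ _ d' wd' _ P d1 xpredT zq) // E2 /=.
rewrite [X in _ * (_ * X * _) = _](_ : _ =
   \prod_(x | (unsplit x < unsplit (raw x).1)%N && ((x != zq) && (x != (raw zq).1)))
        red_coef P (raw x).2); last first.
  have un x : x != zq -> x != (raw zq).1 -> raw' x = raw x.
    move=> h1 h2; apply: raw_dec_same => //.
    apply: contraNneq h2 => E; have := wf_raw wd wd' x.
    by case: (raw x) E => y w /= -> [_ ->].
  apply: eq_big => [x|x /and3P[_ h1 h2]]; last by rewrite un.
  have [->|h1] := eqVneq x zq; first by rewrite !andbF.
  have [->|h2] := eqVneq x (raw zq).1; first by rewrite !andbF.
  by rewrite un.
have key : cons_coef P a (deco d z) * red_coef P (red_word (a :: deco d z) ++ u) =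
    red_coef P (raw zq).2 * cons_coef P a (deco D zq).
  have F1 : red_coef P (a :: (deco d z ++ u)) =
    cons_coef P a (red_word (deco d z ++ u)) * red_coef P (deco d z ++ u) by [].
  have F2 : red_coef P (a :: deco d z) = cons_coef P a (deco d z).
    have -> : red_coef P (a :: deco d z) =
      cons_coef P a (red_word (deco d z)) * red_coef P (deco d z) by [].
    by rewrite (red_coef_id P (rd z)) mulr1 red_id.
  by rewrite deco_stack0 E1 -F2 -(coef_catl P (a :: deco d z) u) cat_cons F1 mulrC.
rewrite !mulrA key; ring.
Qed.

End MasterDec.

Section Identity.
Context {n l : nat} (d : ddiag n l) (wd : wf_strings d) (rd : reducedd d).

Lemma wf_id : wf_strings (id_diag n).
Proof. by apply/wf_stringsP; split=> -[j|j]; rewrite /partner /deco !ffunE. Qed.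

Lemma reducedd_id : reducedd (id_diag n).
Proof. by move=> -[j|j]; rewrite /deco ffunE. Qed.

Lemma raw_id x : raw_string (id_diag n) d x = (partner d x, deco d x : seq blob).
Proof.
have wi := wf_id.
have id1 j : partner (id_diag n) (inl j) = inr j by rewrite /partner ffunE.
have id2 j : partner (id_diag n) (inr j) = inl j by rewrite /partner ffunE.
have id3 y : deco (id_diag n) y = [::] :> seq blob by rewrite /deco ffunE; case: y.
have bot j : exists s, run glue (pth (id_diag n) d) (plab (id_diag n) d) (inl (inr j))
    (inl (inl j)) [::] s.
  by exists [::]; have := @run_end _ glue (pth (id_diag n) d) (plab (id_diag n) d) (inl (inr j));
     rewrite /= id2 id3; apply.
have top t w0 : plab (id_diag n) d t = w0 -> (exists y, pth (id_diag n) d t = inr y) ->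
  exists s, forall y, pth (id_diag n) d t = inr y -> run glue (pth (id_diag n) d) (plab (id_diag n) d) t
    (opn (match y with inl j => inl j | inr j => inr j end)) w0 s.
  move=> <- [[j|j] E].
    have [s h] := bot j.
    exists (inl (inr j) :: s) => y; rewrite E => -[<-].
    rewrite -[plab _ _ t]cats0.
    by have := @run_step _ glue (pth (id_diag n) d) (plab (id_diag n) d) t _ [::] s; rewrite E; apply.
  exists [::] => y; rewrite E => -[<-].
  by have := @run_end _ glue (pth (id_diag n) d) (plab (id_diag n) d) t; rewrite E; apply.
have xE (y : node n l) : (match y with inl j => inl j | inr j => inr j end) = y by case: y.
case: x => j; last first.
  have [|s h] := top (inr (inr j)) _ erefl; first by exists (partner d (inr j)).
  by apply: (raw_run wi wd (s := s)); have := h _ erefl; rewrite xE.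
have [|s h] := top (inr (inl j)) _ erefl; first by exists (partner d (inl j)).
apply: (raw_run wi wd (s := inr (inl j) :: s)); have := h _ erefl; rewrite xE => {}h.
have := @run_step _ glue (pth (id_diag n) d) (plab (id_diag n) d) (opn (inl j)).
by rewrite /= id1 id3 /=; apply.
Qed.

Lemma stack0_id : stack0 (id_diag n) d = d.
Proof.
apply/ffunP => x; rewrite ffunE raw_id /=.
have -> : red_word (deco d x) = deco d x by apply: word_eq; apply: red_id; apply: rd.
by rewrite /partner /deco -surjective_pairing.
Qed.

Lemma stack0_coef_id {k : fieldType} (P : blob_params k) : stack0_coef P (id_diag n) d = 1%R.
Proof.
rewrite /stack0_coef big1 ?mul1r => [|x _]; last first.
  by rewrite raw_id red_coef_id //; apply: rd.
rewrite big_pred0 // => j; apply/negP => /forallP /(_ j); rewrite connect0 /=.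
by case/andP=> _ /andP[/existsP[j1]]; rewrite /partner ffunE.
Qed.
End Identity.

(** * Planarity *)

(* Chords on a circle cut open at one point.  Writing the conditions as sums
   modulo 2 makes them additive under surgery. *)
Section Chords.
Context {T : eqType} (pos : T -> nat) (pos_inj : injective pos).
Notation lt x y := (pos x < pos y).

(** [lt a c (+) lt b c] tells whether [c] lies between [a] and [b], so the sum of the four terms
    tells whether exactly one end of the chord [c d] lies there. *)
Definition crossing a b c d := lt a c (+) lt b c (+) lt a d (+) lt b d.

Definition noncrossing (sg : T -> T) := forall x y, y != x -> y != sg x ->
  crossing x (sg x) y (sg y) = false.

(* No chord separates x from the cut. *)
Definition outermost (sg : T -> T) x := forall y, y != x -> y != sg x -> lt y x = lt (sg y) x.

Lemma lt_flip x y : x != y -> lt x y = ~~ lt y x.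
Proof.
by move=> h; rewrite -leqNgt [RHS]leq_eqVlt (inj_eq pos_inj) (negbTE h).
Qed.

Lemma crossC a b c d : crossing b a c d = crossing a b c d.
Proof. by rewrite /crossing; do 4 case: (lt _ _). Qed.

Lemma crossC' a b c d : crossing a b d c = crossing a b c d.
Proof. by rewrite /crossing; do 4 case: (lt _ _). Qed.

Lemma cross_sym a b c d : c != a -> c != b -> d != a -> d != b ->
  crossing c d a b = crossing a b c d.
Proof.
rewrite /crossing => h1 h2 h3 h4.
rewrite (lt_flip h1) (lt_flip h2) (lt_flip h3) (lt_flip h4).
by do 4 case: (lt _ _).
Qed.

Section Surgery.
Context (sg sg' : T -> T) (sgK : involutive sg) (sg_free : forall x, sg x != x).
Context (p p' : T) (pp' : p != p').
Hypothesis adj : forall y, y != p -> y != p' -> lt y p = lt y p'.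
Hypotheses (sg'p : sg' p = p') (sg'p' : sg' p' = p).
Hypothesis sg'j : sg p != p' -> sg' (sg p) = sg p' /\ sg' (sg p') = sg p.
Hypothesis sg's : forall x, x != p -> x != p' -> sg x != p -> sg x != p' -> sg' x = sg x.

Lemma chord_cases x : x = p \/ x = p' \/ (sg p != p' /\ x = sg p) \/
  (sg p != p' /\ x = sg p') \/ [/\ x != p, x != p', sg x != p & sg x != p'].
Proof.
have [|h1] := eqVneq x p; first by left.
have [|h2] := eqVneq x p'; first by right; left.
have [E|h3] := eqVneq (sg x) p.
  by do 2 right; left; split; rewrite -E sgK.
have [E|h4] := eqVneq (sg x) p'; last by do 4 right.
do 3 right; left; split; last by rewrite -E sgK.
by apply: contraNneq h1 => E'; rewrite -(sgK x) E -E' sgK.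
Qed.

Lemma adj' y : y != p -> y != p' -> lt p y = lt p' y.
Proof. by move=> h h'; rewrite !(@lt_flip _ y) 1?eq_sym // adj. Qed.

Lemma out_pp z : z != p -> z != p' -> sg' z != p /\ sg' z != p'.
Proof.
move=> zp zp'; case: (chord_cases z) => [E|[E|[[h ->]|[[h ->]|[h1 h2 h3 h4]]]]].
- by rewrite E eqxx in zp.
- by rewrite E eqxx in zp'.
- have [-> _] := sg'j h; split; rewrite ?sg_free //; apply: contraNneq h => <-; by rewrite sgK.
- by have [_ ->] := sg'j h; split; rewrite ?sg_free.
by rewrite sg's.
Qed.

(** Modulo 2, the crossings of a chord with the new chord from [sg p] to [sg p'] are the sum of its
    crossings with the two old chords: the terms at [p] and [p'] cancel because these two are
    adjacent. *)
Lemma noncrossing_surg : noncrossing sg -> noncrossing sg'.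
Proof.
move=> nc x y yx ysx.
have [E|xp] := eqVneq x p.
  rewrite E sg'p in yx ysx *; have [h1 h2] := out_pp yx ysx.
  by rewrite /crossing !adj' //; do 2 case: (lt p' _).
have [E|xp'] := eqVneq x p'.
  rewrite E sg'p' in yx ysx *; have [h1 h2] := out_pp ysx yx.
  by rewrite /crossing !adj' //; do 2 case: (lt p' _).
have [sxp sxp'] := out_pp xp xp'.
have [->|yp] := eqVneq y p.
  by rewrite sg'p /crossing !adj //; do 2 case: (lt _ p').
have [->|yp'] := eqVneq y p'.
  by rewrite sg'p' /crossing !adj //; do 2 case: (lt _ p').
have [syp syp'] := out_pp yp yp'.
have key z : [/\ z != p, z != p', sg z != p & sg z != p'] ->
    crossing (sg p) (sg p') z (sg z) = false.
  move=> [h1 h2 h3 h4].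
  have za : z != sg p by rewrite -(inj_eq (inv_inj sgK)) sgK.
  have zb : z != sg p' by rewrite -(inj_eq (inv_inj sgK)) sgK.
  have := nc p z h1 za; have := nc p' z h2 zb; rewrite /crossing !adj' //.
  by do 6 case: (lt _ _).
have cases u : u != p -> u != p' -> (u = sg p /\ sg' u = sg p') \/ (u = sg p' /\ sg' u = sg p) \/
   [/\ u != p, u != p', sg u != p & sg u != p'].
  move=> up up'; case: (chord_cases u) => [E|[E|[[h ->]|[[h ->]|]]]]; last by auto.
  - by rewrite E eqxx in up.
  - by rewrite E eqxx in up'.
  - by have [-> _] := sg'j h; left.
  by have [_ ->] := sg'j h; right; left.
have dist z : [/\ z != p, z != p', sg z != p & sg z != p'] ->
    [/\ z != sg p, z != sg p', sg z != sg p & sg z != sg p'].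
  move=> [h1 h2 h3 h4]; rewrite !(inj_eq (inv_inj sgK)); split=> //.
    by rewrite -(inj_eq (inv_inj sgK)) sgK.
  by rewrite -(inj_eq (inv_inj sgK)) sgK.
case: (cases x xp xp') => [[Ex Esx]|[[Ex Esx]|hx]];
  case: (cases y yp yp') => [[Ey Esy]|[[Ey Esy]|hy]].
- by rewrite Ex Ey eqxx in yx.
- by rewrite Esx Ey eqxx in ysx.
- by rewrite Esx Ex; case: (hy) => h1 h2 h3 h4; rewrite sg's //; apply: key.
- by rewrite Esx Ey eqxx in ysx.
- by rewrite Ex Ey eqxx in yx.
- by rewrite Esx Ex crossC; case: (hy) => h1 h2 h3 h4; rewrite sg's //; apply: key.
- have [h5 h6 h7 h8] := dist x hx; case: (hx) => h1 h2 h3 h4.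
  by rewrite Esy Ey sg's // -cross_sym ?key // eq_sym.
- have [h5 h6 h7 h8] := dist x hx; case: (hx) => h1 h2 h3 h4.
  by rewrite Esy Ey crossC' sg's // -cross_sym ?key // eq_sym.
case: (hx) (hy) => h1 h2 h3 h4 [h5 h6 h7 h8]; rewrite !sg's //.
by apply: nc => //; rewrite -sg's.
Qed.

Lemma outermost_same x : outermost sg x ->
  [/\ x != p, x != p', sg x != p & sg x != p'] -> outermost sg' x.
Proof.
move=> hx hh y yx; case: (hh) => h1 h2 h3 h4; rewrite sg's // => ysx.
(* As [x] is outermost, [sg p] is on the side of [p] and [sg p'] on the side of [p'], and these
   sides are equal by adjacency. *)
have hA : lt (sg p) x = lt (sg p') x.
  by rewrite -!hx 1?eq_sym // ?adj' // eq_sym.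
case: (chord_cases y) => [->|[->|[[h ->]|[[h ->]|[g1 g2 g3 g4]]]]].
- by rewrite sg'p adj'.
- by rewrite sg'p' adj'.
- by have [-> _] := sg'j h.
- by have [_ ->] := sg'j h.
by rewrite sg's // hx.
Qed.

(** A chord that does not cross the chord of [x] separates both of its ends from the cut, or
    neither. *)
Lemma outermost_other x : involutive sg -> noncrossing sg -> outermost sg x -> outermost sg (sg x).
Proof.
move=> gK nc hx y ysx; rewrite gK => yx; have ysx' : sg y != x by rewrite -(inj_eq (inv_inj gK)) gK.
have xsy : x != sg y by rewrite eq_sym.
have := nc y x; rewrite eq_sym yx xsy /crossing => /(_ isT isT).
by rewrite hx //; do 3 case: (lt _ _).
Qed.

Lemma outermost_join_l : sg p != p' -> noncrossing sg -> outermost sg p -> outermost sg' (sg p).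
Proof.
move=> h nc hp y; have [-> _] := sg'j h => yA yB.
have Ap : sg p != p by [].
case: (chord_cases y) => [->|[->|[[_ E]|[[_ E]|[g1 g2 g3 g4]]]]].
- by rewrite sg'p adj'.
- by rewrite sg'p' adj'.
- by rewrite E eqxx in yA.
- by rewrite E eqxx in yB.
by rewrite sg's //; apply: outermost_other; rewrite ?sgK.
Qed.

Lemma outermost_join_r : sg p != p' -> noncrossing sg -> outermost sg p' -> outermost sg' (sg p').
Proof.
move=> h nc hp y; have [_ ->] := sg'j h => yB yA.
have Bp : sg p' != p by apply: contraNneq h => <-; rewrite sgK.
have Bp' : sg p' != p' by [].
case: (chord_cases y) => [->|[->|[[_ E]|[[_ E]|[g1 g2 g3 g4]]]]].
- by rewrite sg'p adj'.
- by rewrite sg'p' adj'.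
- by rewrite E eqxx in yA.
- by rewrite E eqxx in yB.
by rewrite sg's //; apply: outermost_other; rewrite ?sgK.
Qed.

End Surgery.
End Chords.

Section Positions.
Context {n l : nat}.
Implicit Types (d : ddiag n l) (x y : node n l).

(* Positions read from the top right corner. *)
Definition right_pos x : nat := match x with inl i => l + i | inr b => l - b.+1 end.

Lemma boundary_pos_inj : injective (@boundary_pos n l).
Proof.
move=> [i|b] [i'|b'] /= E; first by congr inl; apply: val_inj.
- by have := ltn_ord i; lia.
- by have := ltn_ord i'; lia.
by congr inr; apply: val_inj => /=; have := ltn_ord b; have := ltn_ord b'; lia.
Qed.

Lemma right_pos_inj : injective right_pos.
Proof.
move=> [i|b] [i'|b'] /= E; first by congr inl; apply: val_inj => /=; lia.
- by have := ltn_ord b'; lia.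
- by have := ltn_ord b; lia.
by congr inr; apply: val_inj => /=; have := ltn_ord b; have := ltn_ord b'; lia.
Qed.

Definition istop x := if x is inl _ then true else false.

Lemma right_ltE x y : (right_pos x < right_pos y) =
  (boundary_pos x < boundary_pos y) (+) istop x (+) istop y.
Proof.
case: x => i; case: y => j /=; have := ltn_ord i; have := ltn_ord j; rewrite ?addbT ?addbF ?addbN ?negbK; lia.
Qed.

Definition outL d x := outermost (@boundary_pos n l) (partner d) x.
Definition outR d x := outermost right_pos (partner d) x.
Definition ncL d := noncrossing (@boundary_pos n l) (partner d).
Definition ncR d := noncrossing right_pos (partner d).

(** Moving the cut to the other corner flips the order between top and bottom nodes. Each of the
    four ends occurs in two terms of [crossing], so the flips cancel. *)
Lemma ncLR d : ncL d -> ncR d.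
Proof.
move=> h x y yx yx'; have := h x y yx yx'; rewrite /crossing !right_ltE.
by do 4 case: (_ < _); case: (istop x); case: (istop y); case: (istop _); case: (istop _).
Qed.

Lemma planarP d : wf_strings d -> reflect (ncL d) (planar d).
Proof.
move=> /wf_stringsP[hf hK _]; apply: (iffP forallP) => [h x y yx ysx|h x].
  have P u v := forallP (h u) v.
  have ysx' : partner d y != x by rewrite -(inj_eq (inv_inj hK)) hK.
  have sysx : partner d y != partner d x by rewrite (inj_eq (inv_inj hK)).
  have I (u v : node n l) : u != v -> boundary_pos u <> boundary_pos v.
    by move=> uv /boundary_pos_inj /eqP; rewrite (negbTE uv).
  have := I _ _ yx; have := I _ _ ysx; have := I _ _ ysx'; have := I _ _ sysx.
  have := I _ _ (hf x); have := I _ _ (hf y).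
  have := P x y; have := P y x; have := P (partner d x) y; have := P y (partner d x).
  have := P x (partner d y); have := P (partner d y) x.
  have := P (partner d x) (partner d y); have := P (partner d y) (partner d x).
  rewrite /crossing !hK.
  move: (boundary_pos x) (boundary_pos y) (boundary_pos (partner d x)) (boundary_pos (partner d y)).
  clear; move=> a b c e; lia.
apply/forallP => y; apply/negP => /and3P[h1 h2 h3].
have := h x y; rewrite /crossing.
have I (u v : node n l) : boundary_pos u < boundary_pos v -> v != u.
  by move=> uv; apply: contraTneq uv => ->; rewrite ltnn.
rewrite I // eq_sym I // => /(_ isT isT).
rewrite h1 h3 (ltn_trans h1 (ltn_trans h2 h3)).
by rewrite ltnNge (ltnW h2).
Qed.

(** For a node to the left of [i], [exposed_left] only bounds its partner by [j]. Planarity improves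
    the bound to [i], which is the outermost condition. *)
Lemma exposed_leftP d (i j : 'I_n) : wf_strings d -> ncL d -> i < j -> partner d (inl i) = inl j ->
  exposed_left d i j <-> outL d (inl i).
Proof.
move=> /wf_stringsP[hf hK _] nc ij E; split=> [/forallP h|h]; last first.
  apply/forallP => i'; apply/implyP => lti; have := h (inl i'); rewrite E.
  case Ei: (partner d (inl i')) => [j'|b] /= h'.
    apply: (ltn_trans _ ij); rewrite -h' //.
      by apply: contraTneq lti => -[->]; rewrite ltnn.
    by apply: contraTneq lti => -[->]; rewrite -leqNgt ltnW.
  have := ltn_ord i; suff : n + (l - b.+1) < i by lia.
  rewrite -h' //; first by apply: contraTneq lti => -[->]; rewrite ltnn.
  by apply: contraTneq lti => -[->]; rewrite -leqNgt ltnW.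
have key y : y != inl i -> y != inl j -> boundary_pos y < i -> boundary_pos (partner d y) < i.
  case: y => [i'|b] yi yj /= lti; last by have := ltn_ord i; lia.
  have := h i'; rewrite lti /=; case Ei: (partner d (inl i')) => [j'|b] //= j'j.
  have := nc (inl i) (inl i') yi; rewrite E Ei => /(_ yj); rewrite /crossing /=.
  have j'i : j' != i :> nat.
    by apply: contraNneq yj => /val_inj E'; rewrite -E -(inj_eq (inv_inj hK)) hK Ei E'.
  lia.
move=> y yi; rewrite E => yj; apply/idP/idP; first exact: key.
move=> hlt; rewrite -(hK y); apply: key => //.
  by apply: contraNneq yj => E'; rewrite -(hK y) E' E.
by apply: contraNneq yi => E'; rewrite -(hK y) E' -E hK.
Qed.

Lemma exposed_rightP d (i j : 'I_n) : wf_strings d -> ncL d -> i < j -> partner d (inl i) = inl j ->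
  exposed_right d i j <-> outR d (inl j).
Proof.
move=> /wf_stringsP[hf hK _] nc ij E.
have E2 : partner d (inl j) = inl i by rewrite -E hK.
split=> [/forallP h|h]; last first.
  apply/forallP => i'; apply/implyP => lti; have := h (inl i'); rewrite E2.
  case Ei: (partner d (inl i')) => [j'|b] /= h'.
    have : (l + j' < l + j) = false.
      rewrite -h'; first by lia.
        by apply: contraTneq lti => -[->]; rewrite ltnn.
      by apply: contraTneq lti => -[->]; rewrite -leqNgt ltnW.
    have : j' != j :> nat; last by lia.
    have /eqP h2 : inl i' != inl i :> node n l by apply: contraTneq lti => -[->]; rewrite -leqNgt ltnW.
    by apply/eqP => /val_inj E'; case: h2; rewrite -(hK (inl i')) Ei E' E2.
  have : (l - b.+1 < l + j) = false; last by have := ltn_ord b; lia.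
  rewrite -h'; first by lia.
    by apply: contraTneq lti => -[->]; rewrite ltnn.
  by apply: contraTneq lti => -[->]; rewrite -leqNgt ltnW.
have key y : y != inl i -> y != inl j -> (right_pos y < l + j) = false ->
    (right_pos (partner d y) < l + j) = false.
  case: y => [i'|b] yi yj /= lti; last by have := ltn_ord b; lia.
  have ji' : j < i'.
    have : i' != j :> nat by apply: contraNneq yj => /val_inj->.
    lia.
  have := h i'; rewrite ji' /=; case Ei: (partner d (inl i')) => [j'|b] //= ij'.
  have := nc (inl i) (inl i') yi; rewrite E Ei => /(_ yj); rewrite /crossing /=.
  have j'j : j' != j :> nat.
    by apply: contraNneq yi => /val_inj E'; rewrite -E2 -(inj_eq (inv_inj hK)) hK Ei E'.
  lia.
have key2 z : z != inl i -> z != inl j -> right_pos (partner d z) < l + j -> right_pos z < l + j.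
  by move=> zi zj hz; apply/negPn/negP => /negbTE h'; rewrite key in hz.
move=> y yj; rewrite E2 => yi /=; apply/idP/idP; last exact: key2.
move=> hlt; apply: key2; rewrite ?hK //.
  by apply: contraNneq yj => E'; rewrite -(hK y) E' E.
by apply: contraNneq yi => E'; rewrite -(hK y) E' E2.
Qed.

(** Bottom nodes come in decreasing order on the boundary, so the first line separates all the other
    ones from the left corner. *)
Lemma outL_line d (b : 'I_l) i : partner d (inr b) = inl i -> outL d (inr b) ->
  (forall b', exists i', partner d (inr b') = inl i') -> b = 0 :> nat.
Proof.
move=> E h hb; case: (posnP b) => // bp; have lb := ltn_ord b.
pose b0 : 'I_l := Ordinal (ltn_trans bp lb).
have [i0 E0] := hb b0.
have := h (inr b0); rewrite E E0 /= => /(_ _ _).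
have h1 : (inr b0 : node n l) != inr b by apply/eqP => -[/(congr1 val)] /=; lia.
by move/(_ h1 isT); have := ltn_ord i0; lia.
Qed.

Lemma outR_line d (b : 'I_l) i : partner d (inr b) = inl i -> outR d (inr b) ->
  (forall b', exists i', partner d (inr b') = inl i') -> b = l.-1 :> nat.
Proof.
move=> E h hb; have lb := ltn_ord b; have [//|bp] := eqVneq (b : nat) l.-1.
have lp : l.-1 < l by lia.
pose b0 : 'I_l := Ordinal lp.
have [i0 E0] := hb b0.
have := h (inr b0); rewrite E E0 /= => /(_ _ _).
have h1 : (inr b0 : node n l) != inr b by apply/eqP => -[/(congr1 val)] /=; lia.
by move/(_ h1 isT); have := ltn_ord i0; lia.
Qed.

Lemma outL_first d (b : 'I_l) : wf_strings d -> b = 0 :> nat -> outL d (inr b).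
Proof.
move=> /wf_stringsP[_ hK _] b0 y yb yb'; have := ltn_ord b => lb.
have key (z : node n l) : z != inr b -> boundary_pos z < n + (l - b.+1).
  case: z => [z|z] h /=; first by have := ltn_ord z; lia.
  have : z != b :> nat by apply: contraNneq h => /val_inj->.
  by have := ltn_ord z; lia.
rewrite /= !key //.
by apply: contraNneq yb' => <-; rewrite hK.
Qed.

Lemma outR_last d (b : 'I_l) : wf_strings d -> b = l.-1 :> nat -> outR d (inr b).
Proof.
move=> /wf_stringsP[_ hK _] b0 y yb yb'; have := ltn_ord b => lb.
have key (z : node n l) : z != inr b -> (right_pos z < l - b.+1) = false.
  case: z => [z|z] h /=; first by lia.
  have : z != b :> nat by apply: contraNneq h => /val_inj->.
  by have := ltn_ord z; lia.
rewrite /= !key //.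
by apply: contraNneq yb' => <-; rewrite hK.
Qed.

Lemma outL_top0 d (i : 'I_n) : i = 0 :> nat -> outL d (inl i).
Proof. by move=> i0 y _ _; rewrite /= i0 !ltn0. Qed.

Lemma outR_top d (i : 'I_n) : wf_strings d -> i = n.-1 :> nat -> outR d (inl i).
Proof.
move=> /wf_stringsP[_ hK _] i0 y yb yb'; have := ltn_ord i => lb.
have key (z : node n l) : z != inl i -> right_pos z < l + i.
  case: z => [z|z] h /=; last by have := ltn_ord z; lia.
  have : z != i :> nat by apply: contraNneq h => /val_inj->.
  by have := ltn_ord z; lia.
rewrite /= !key //.
by apply: contraNneq yb' => <-; rewrite hK.
Qed.

(** The top end of the line would be to the right of [i] seen from the left corner, and to its left
    seen from the right corner. This is how the presence of a propagating line forbids words mixing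
    $L$ and $R$ on arcs. *)
Lemma out_exclusive d (i j : 'I_n) (b : 'I_l) i0 : wf_strings d ->
  partner d (inl i) = inl j -> partner d (inr b) = inl i0 ->
  outL d (inl i) -> outR d (inl i) -> False.
Proof.
move=> /wf_stringsP[_ hK _] E Eb hL hR.
have n1 : inl i0 != inl i :> node n l by apply/eqP => -[E']; have := hK (inr b); rewrite Eb E' E.
have n2 : inl i0 != inl j :> node n l by rewrite -E -(inj_eq (inv_inj hK)) hK -Eb hK.
have := hL (inr b) isT; rewrite E Eb /= => /(_ isT).
have := hR (inr b) isT; rewrite E Eb /= => /(_ isT).
have := ltn_ord i; have := ltn_ord b; have : i0 != i :> nat.
  by apply: contraNneq n1 => /val_inj->.
lia.
Qed.

End Positions.

Lemma adj_neq n (i i' : 'I_n) : i' = i.+1 :> nat -> i != i'.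
Proof. by move=> adj; apply/eqP => E; move: adj; rewrite E; lia. Qed.

Section Colored.
Context {n l : nat}.
Implicit Types (d : ddiag n l).

(** The words are a parameter because the condition is used for reduced decorations and also for the
    words of a stack before straightening, on which the scalars depend. *)
Definition colored d (w : node n l -> seq blob) := forall x,
  (bL \in w x -> outL d x) /\ (bR \in w x -> outR d x).

Lemma outL_partner d x : wf_strings d -> ncL d -> outL d x -> outL d (partner d x).
Proof. by move=> /wf_stringsP[_ hK _]; apply: outermost_other. Qed.

Lemma outR_partner d x : wf_strings d -> ncL d -> outR d x -> outR d (partner d x).
Proof. by move=> /wf_stringsP[_ hK _] /ncLR; apply: outermost_other. Qed.

Section Surg.
Context (d : ddiag n l) (wd : wf_strings d) (nc : ncL d) (i i' : 'I_n) (adj : i' = i.+1 :> nat).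
Notation p := (inl i : node n l).
Notation p' := (inl i' : node n l).

Let pp' : p != p'. Proof. by apply: contraNneq (adj_neq adj) => -[->]. Qed.
Let hf := let: And3 h _ _ := wf_stringsP _ wd in h.
Let hK := let: And3 _ h _ := wf_stringsP _ wd in h.

Lemma adjL (y : node n l) : y != p -> y != p' -> (boundary_pos y < boundary_pos p) = (boundary_pos y < boundary_pos p').
Proof.
case: y => [j|b] /= h h'; last by have := ltn_ord i; have := ltn_ord i'; lia.
have h1 : j != i :> nat by apply: contraNneq h => /val_inj->.
rewrite adj; lia.
Qed.

Lemma adjR (y : node n l) : y != p -> y != p' -> (right_pos y < right_pos p) = (right_pos y < right_pos p').
Proof.
case: y => [j|b] /= h h'; last by have := ltn_ord b; lia.
have h1 : j != i :> nat by apply: contraNneq h => /val_inj->.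
rewrite adj; lia.
Qed.

Let s_p : partner (surg p p' d) p = p'. Proof. by rewrite /partner surg_p. Qed.
Let s_p' : partner (surg p p' d) p' = p. Proof. by rewrite /partner surg_p'. Qed.
Let s_j : partner d p != p' -> partner (surg p p' d) (partner d p) = partner d p' /\
   partner (surg p p' d) (partner d p') = partner d p.
Proof. by move=> h; rewrite /partner surg_join // surg_join'. Qed.
Let s_s x : x != p -> x != p' -> partner d x != p -> partner d x != p' ->
  partner (surg p p' d) x = partner d x.
Proof. by move=> h1 h2 h3 h4; rewrite /partner surg_same. Qed.

Lemma ncL_surg : ncL (surg p p' d).
Proof. exact: (noncrossing_surg (@boundary_pos_inj n l) hK hf adjL s_p s_p' s_j s_s nc). Qed.

(** The string created by joining is exposed to a wall as soon as one of the two old strings was, so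
    its letters may come from either of them. *)
Lemma colored_surg w w1 : colored d w -> w1 p = [::] -> w1 p' = [::] ->
  (forall x a, x != p -> x != p' -> partner d x != p -> partner d x != p' -> a \in w1 x -> a \in w x) ->
  (partner d p != p' -> forall a, (a \in w1 (partner d p) -> (a \in w p) || (a \in w p')) /\
     (a \in w1 (partner d p') -> (a \in w p) || (a \in w p'))) ->
  colored (surg p p' d) w1.
Proof.
move=> cw w1p w1p' w1s w1j.
have nc1 := ncL_surg; have wd1 : wf_strings (surg p p' d) by apply: wf_surg.
have JL : partner d p != p' -> (outL d p \/ outL d p') ->
   outL (surg p p' d) (partner d p) /\ outL (surg p p' d) (partner d p').
  move=> h hh; have [E1 E2] := s_j h.
  suff [h1|h1] : outL (surg p p' d) (partner d p) \/ outL (surg p p' d) (partner d p').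
  - by split=> //; rewrite -E1; apply: outL_partner.
  - by split=> //; rewrite -E2; apply: outL_partner.
  case: hh => h1; [left|right].
    exact: (outermost_join_l (@boundary_pos_inj n l) hK hf adjL s_p s_p' s_j s_s h nc h1).
  exact: (outermost_join_r (@boundary_pos_inj n l) hK hf adjL s_p s_p' s_j s_s h nc h1).
have JR : partner d p != p' -> (outR d p \/ outR d p') ->
   outR (surg p p' d) (partner d p) /\ outR (surg p p' d) (partner d p').
  move=> h hh; have [E1 E2] := s_j h.
  suff [h1|h1] : outR (surg p p' d) (partner d p) \/ outR (surg p p' d) (partner d p').
  - by split=> //; rewrite -E1; apply: outR_partner.
  - by split=> //; rewrite -E2; apply: outR_partner.
  case: hh => h1; [left|right].
    exact: (outermost_join_l (@right_pos_inj n l) hK hf adjR s_p s_p' s_j s_s h (ncLR nc) h1).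
  exact: (outermost_join_r (@right_pos_inj n l) hK hf adjR s_p s_p' s_j s_s h (ncLR nc) h1).
have C a : partner d p != p' -> (a \in w p) || (a \in w p') -> (if a == bL then outL d p \/ outL d p' else outR d p \/ outR d p').
  move=> _; have [c1 c2] := cw p; have [c3 c4] := cw p'.
  by case: a => /= /orP[]; auto.
move=> x; have [E|xp] := eqVneq x p; first by rewrite E w1p.
have [E|xp'] := eqVneq x p'; first by rewrite E w1p'.
case: (chord_cases hK p p' x) => [E|[E|[[h ->]|[[h ->]|[h1 h2 h3 h4]]]]].
- by rewrite E eqxx in xp.
- by rewrite E eqxx in xp'.
- split=> ha.
    by have [h1 _] := w1j h bL; case/(JL h): (C bL h (h1 ha)).
  by have [h1 _] := w1j h bR; case/(JR h): (C bR h (h1 ha)).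
- split=> ha.
    by have [_ h1] := w1j h bL; case/(JL h): (C bL h (h1 ha)).
  by have [_ h1] := w1j h bR; case/(JR h): (C bR h (h1 ha)).
have [c1 c2] := cw x; split=> ha.
  exact: (outermost_same (@boundary_pos_inj n l) hK adjL s_p s_p' s_j s_s (c1 (w1s _ _ h1 h2 h3 h4 ha))).
exact: (outermost_same (@right_pos_inj n l) hK adjR s_p s_p' s_j s_s (c2 (w1s _ _ h1 h2 h3 h4 ha))).
Qed.

Lemma colored_surg_deco : colored d (deco d) -> colored (surg p p' d) (deco (surg p p' d)).
Proof.
have hr : forall x, deco d (partner d x) = rev (deco d x) :> seq blob by case: (wf_stringsP _ wd).
move=> cd; apply: (@colored_surg (fun x => deco d x) (fun x => deco (surg p p' d) x) cd).
- by rewrite /deco surg_p.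
- by rewrite /deco surg_p'.
- by move=> x a h1 h2 h3 h4; rewrite /deco surg_same.
move=> h a; rewrite /deco surg_join // surg_join' //=; split=> /mem_red; rewrite mem_cat.
  by rewrite -/(deco d (partner d _)) hr mem_rev.
by rewrite -/(deco d (partner d _)) hr mem_rev orbC.
Qed.
End Surg.

Section Dec.
Context (d : ddiag n l) (wd : wf_strings d) (z : node n l) (a : blob).
Let hK := let: And3 _ h _ := wf_stringsP _ wd in h.

Lemma partner_decE : partner (dec z a d) = partner d.
Proof. by apply: funext => x; rewrite partner_dec. Qed.

Lemma ncL_dec : ncL d -> ncL (dec z a d).
Proof. by rewrite /ncL partner_decE. Qed.

Lemma colored_dec w w1 : ncL d -> (if a == bL then outL d z else outR d z) -> colored d w ->
  (forall x c, c \in w1 x -> (c \in w x) || ((c == a) && ((x == z) || (x == partner d z)))) ->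
  colored (dec z a d) w1.
Proof.
move=> nc hz cw h x; rewrite /outL /outR partner_decE -/(outL d x) -/(outR d x).
have [c1 c2] := cw x; split=> /h /orP[|/andP[/eqP E]]; auto; rewrite -E /= in hz => /orP[] /eqP->//.
  exact: outL_partner.
exact: outR_partner.
Qed.

Lemma colored_dec_deco : ncL d -> (if a == bL then outL d z else outR d z) -> colored d (deco d) ->
  colored (dec z a d) (deco (dec z a d)).
Proof.
move=> nc hz cw; apply: (@colored_dec (fun x => deco d x) (fun x => deco (dec z a d) x) nc hz cw) => x c.
pose Q x (yw : node n l * word) := c \in (yw.2 : seq blob) ->
  (c \in (deco d x : seq blob)) || (c == a) && ((x == z) || (x == partner d z)).
suff : Q x (dec z a d x) by [].
apply: dec_ind; rewrite /Q //.
- by move/mem_red; rewrite inE eqxx /= andbT orbC.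
- by move/mem_red; rewrite mem_rcons inE eqxx orbT andbT orbC.
by move=> y _ _ ->.
Qed.
End Dec.
End Colored.

(** * The generators as operators on diagrams *)

Definition ord_of n (hn : 0 < n) (j : nat) : 'I_n := insubd (Ordinal hn) j.

Lemma val_ord_of n (hn : 0 < n) j : j < n -> ord_of hn j = j :> nat.
Proof. by move=> h; rewrite /ord_of val_insubd h. Qed.

Lemma ord_of_val n (hn : 0 < n) (i : 'I_n) : ord_of hn i = i.
Proof. by apply: val_inj; rewrite /= val_ord_of. Qed.

(* e_i stacked on top of d is topcf times topop. *)
Definition topop n (hn : 0 < n) (i : nat) l (d : ddiag n l) : ddiag n l :=
  if i == 0 then dec (inl (ord_of hn 0)) bL d
  else if i == n then dec (inl (ord_of hn n.-1)) bR d
  else surg (inl (ord_of hn i.-1)) (inl (ord_of hn i)) d.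

Definition topcf {k : fieldType} (P : blob_params k) n (hn : 0 < n) (i : nat) l (d : ddiag n l) : k :=
  if i == 0 then cons_coef P bL (deco d (inl (ord_of hn 0)))
  else if i == n then cons_coef P bR (deco d (inl (ord_of hn n.-1)))
  else cup_coef (ord_of hn i.-1) (ord_of hn i) P d.

Section TopOp.
Context {n : nat} (hn : 0 < n) (i : nat) (hi : i <= n).

Lemma ord_adj : i != 0 -> i != n -> ord_of hn i = (ord_of hn i.-1).+1 :> nat.
Proof. by move=> i0 ine; rewrite !val_ord_of; lia. Qed.

Lemma top_neq l : i != 0 -> i != n ->
  inl (ord_of hn i.-1) != inl (ord_of hn i) :> node n l.
Proof. by move=> i0 ine; apply/eqP => -[E]; have := ord_adj i0 ine; rewrite E; lia. Qed.

Lemma wf_topop l (d : ddiag n l) : wf_strings d -> wf_strings (topop hn i d).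
Proof.
move=> wd; rewrite /topop; case: eqP => [_|/eqP i0]; first exact: wf_dec.
case: eqP => [_|/eqP ine]; first exact: wf_dec.
by apply: wf_surg => //; apply: top_neq.
Qed.

Lemma reducedd_topop l (d : ddiag n l) : wf_strings d -> reducedd d -> reducedd (topop hn i d).
Proof.
move=> wd rd; rewrite /topop; case: eqP => [_|/eqP i0]; first exact: reducedd_dec.
case: eqP => [_|/eqP ine]; first exact: reducedd_dec.
by apply: reducedd_surg => //; apply: top_neq.
Qed.

Lemma ncL_topop l (d : ddiag n l) : wf_strings d -> ncL d -> ncL (topop hn i d).
Proof.
move=> wd rd; rewrite /topop; case: eqP => [_|/eqP i0]; first exact: ncL_dec.
case: eqP => [_|/eqP ine]; first exact: ncL_dec.
by apply: ncL_surg => //; apply: ord_adj.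
Qed.

Let hz0 l (d : ddiag n l) : outL d (inl (ord_of hn 0)).
Proof. by apply: outL_top0; rewrite val_ord_of. Qed.
Let hz1 l (d : ddiag n l) : wf_strings d -> outR d (inl (ord_of hn n.-1)).
Proof. by move=> wd; apply: outR_top; rewrite // val_ord_of //; lia. Qed.

Lemma colored_topop_deco l (d : ddiag n l) : wf_strings d -> ncL d -> colored d (fun x => deco d x) ->
  colored (topop hn i d) (fun x => deco (topop hn i d) x).
Proof.
move=> wd nc cd; rewrite /topop; case: eqP => [_|/eqP i0]; first by apply: colored_dec_deco => //=; apply: hz0.
case: eqP => [_|/eqP ine]; first by apply: colored_dec_deco => //=; apply: hz1.
by apply: colored_surg_deco => //; apply: ord_adj.
Qed.

Section Stacked.
Context {l r : nat} (d : ddiag n l) (d' : ddiag l r).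
Hypotheses (wd : wf_strings d) (wd' : wf_strings d').
Notation D := (stack0 d d').
Let wD : wf_strings D := wf_stack0 wd wd'.

Lemma stack0_topop : stack0 (topop hn i d) d' = topop hn i D.
Proof.
rewrite /topop; case: eqP => [_|/eqP i0]; first by rewrite stack0_dec.
case: eqP => [_|/eqP ine]; first by rewrite stack0_dec.
by rewrite stack0_surg // adj_neq // ord_adj.
Qed.

Lemma colored_topop_raw : ncL D -> colored D (fun x => (raw_string d d' x).2) ->
  colored (topop hn i D) (fun x => (raw_string (topop hn i d) d' x).2).
Proof.
have dec_case z a : (if a == bL then outL D (inl z) else outR D (inl z)) -> ncL D ->
    colored D (fun x => (raw_string d d' x).2) ->
    colored (dec (inl z) a D) (fun x => (raw_string (dec (inl z) a d) d' x).2).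
  move=> hz nc cD; apply: (colored_dec wD nc hz cD) => x c.
  have [u E1 E2] := raw_dec_z wd wd' z a.
  have zz : c \in (raw_string (dec (inl z) a d) d' (inl z)).2 ->
      (c \in (raw_string d d' (inl z)).2) || (c == a).
    rewrite E2 E1 /= !mem_cat => /orP[/(@mem_red _ (_ :: _))|->]; last by rewrite orbT.
    by rewrite inE => /orP[->|->]; rewrite ?orbT.
  have wS : wf_strings (dec (inl z : node n l) a d) by apply: wf_dec.
  have [->|xz] := eqVneq x (inl z); first by rewrite /= andbT; apply: zz.
  have [E|xz'] := eqVneq (raw_string d d' x).1 (inl z); last by rewrite raw_dec_same // => ->.
  have Ex : x = partner D (inl z).
    by rewrite partner_stack0 -E; have := wf_raw wd wd' x; case: (raw_string d d' x) => y w /= [_ ->].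
  rewrite Ex eqxx orbT andbT partner_stack0.
  have := wf_raw wS wd' (inl z); have := wf_raw wd wd' (inl z).
  move: zz; rewrite E2; case: (raw_string d d' (inl z)) => A w /= zz [_ E3] [_ ->].
  by rewrite E3 /= !mem_rev.
move=> nc cD; rewrite /topop; case: eqP => [_|/eqP i0]; first by apply: dec_case => //=; apply: hz0.
case: eqP => [_|/eqP ine]; first by apply: dec_case => //=; apply: hz1.
have adj := ord_adj i0 ine; have ne := adj_neq adj.
set p := ord_of hn i.-1 in adj ne *; set p' := ord_of hn i in adj ne *.
have pp' : inl p != inl p' :> node n l by apply: contraNneq ne => -[->].
have wS : wf_strings (surg (inl p : node n l) (inl p') d) by apply: wf_surg.
have [hf hK hr] := wf_stringsP _ wd.
apply: (colored_surg wD nc adj cD).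
- by rewrite raw_surg_p.
- have := wf_raw wS wd' (inl p); rewrite raw_surg_p // => -[_ ->] //.
- move=> x c h1 h2; rewrite !partner_stack0 => h3 h4; rewrite raw_surg_same //.
rewrite !partner_stack0 => h c.
have [u [v [E1 E2 E3]]] := raw_surg_join wd wd' ne h.
have key : (c \in rev u ++ red_word (deco d (partner d (inl p)) ++ deco d (inl p')) ++ v) ->
   (c \in (raw_string d d' (inl p)).2) || (c \in (raw_string d d' (inl p')).2).
  rewrite E1 E2 !mem_cat mem_rev => /or3P[->|/mem_red|->]; rewrite ?orbT //.
  by rewrite mem_cat hr mem_rev => /orP[]->; rewrite ?orbT.
rewrite E3; split; first exact: key.
by have := wf_raw wS wd' (raw_string d d' (inl p)).1; rewrite E3 => -[_ ->] /=; rewrite mem_rev.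
Qed.

Lemma stack0_coef_topop {k : fieldType} (P : blob_params k) : reducedd d ->
  (forall j j', i != 0 -> i != n -> partner D (inl j) = inl j' -> mono (raw_string d d' (inl j)).2) ->
  (topcf P hn i d * stack0_coef P (topop hn i d) d' = stack0_coef P d d' * topcf P hn i D)%R.
Proof.
move=> rd hm; rewrite /topcf /topop; case: eqP => [_|/eqP i0]; first by rewrite stack0_coef_dec.
case: eqP => [_|/eqP ine]; first by rewrite stack0_coef_dec.
rewrite stack0_coef_surg // ?adj_neq ?ord_adj // => E; exact: (hm _ _ _ _ E).
Qed.

End Stacked.

(** With [stack0_topop] and [stack0_id], this turns stacking $e_i$ on a diagram into an operator on
    that diagram. *)
Lemma e_diagE : e_diag n i = topop hn i (id_diag n).
Proof.
apply/ffunP => x; rewrite /e_diag /topop.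
case: eqP => [_|/eqP i0].
  rewrite [in RHS]ffunE; have -> : partner (id_diag n) (inl (ord_of hn 0)) = inr (ord_of hn 0).
    by rewrite /partner ffunE.
  case: x => j; rewrite /strands ffunE.
    case: eqP => [j0|/eqP j0].
      have -> : j = ord_of hn 0 by apply: val_inj; rewrite /= j0 val_ord_of.
      by rewrite eqxx /deco !ffunE.
    rewrite ifN; first by rewrite /id_diag /strands ffunE.
    by apply: contraNneq j0 => -[->]; rewrite val_ord_of.
  rewrite /=; case: eqP => [j0|/eqP j0].
    have -> : j = ord_of hn 0 by apply: val_inj; rewrite /= j0 val_ord_of.
    by rewrite eqxx /deco !ffunE.
  rewrite ifN; first by rewrite /id_diag /strands ffunE.
  by apply: contraNneq j0 => -[->]; rewrite val_ord_of.
case: eqP => [_|/eqP ine].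
  rewrite [in RHS]ffunE; have -> : partner (id_diag n) (inl (ord_of hn n.-1)) = inr (ord_of hn n.-1).
    by rewrite /partner ffunE.
  have hn1 : n.-1 < n by lia.
  case: x => j; rewrite /strands ffunE.
    case: eqP => [j0|/eqP j0].
      have -> : j = ord_of hn n.-1 by apply: val_inj; rewrite /= j0 val_ord_of.
      by rewrite eqxx /deco !ffunE.
    rewrite ifN; first by rewrite /id_diag /strands ffunE.
    by apply: contraNneq j0 => -[->]; rewrite val_ord_of.
  rewrite /=; case: eqP => [j0|/eqP j0].
    have -> : j = ord_of hn n.-1 by apply: val_inj; rewrite /= j0 val_ord_of.
    by rewrite eqxx /deco !ffunE.
  rewrite ifN; first by rewrite /id_diag /strands ffunE.
  by apply: contraNneq j0 => -[->]; rewrite val_ord_of.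
have hi1 : i.-1 < n by lia.
have hi2 : i < n by lia.
set p := ord_of hn i.-1; set p' := ord_of hn i.
have Ep : p = i.-1 :> nat by rewrite val_ord_of.
have Ep' : p' = i :> nat by rewrite val_ord_of.
have pp' : p != p' by apply/eqP => E; move: Ep Ep'; rewrite E; lia.
have sw j : swap_node i j = if j == p then p' else if j == p' then p else j.
  rewrite /swap_node -(inj_eq val_inj) -(inj_eq val_inj j) /= Ep Ep'.
  by case: eqP => [_|_]; [|case: eqP => // _]; apply: val_inj; rewrite val_insubd ?hi1 ?hi2 ?Ep ?Ep'.
have id1 j : partner (id_diag n) (inl j) = inr j by rewrite /partner ffunE.
have id2 j : partner (id_diag n) (inr j) = inl j by rewrite /partner ffunE.
have idd y : deco (id_diag n) y = [bseq] :> word by rewrite /deco ffunE; case: y.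
have idE y : id_diag n y = (partner (id_diag n) y, deco (id_diag n) y).
  by rewrite /partner /deco -surjective_pairing.
have nil : red_word ([bseq] ++ [bseq] : seq blob) = [bseq] :> word by [].
rewrite /cup_cap /surg [LHS]ffunE [RHS]ffunE !id1 !idd nil.
case: x => j; rewrite ?id1 ?id2 !(inj_eq (@inl_inj _ _)) sw idE ?id1 ?id2 idd.
  case: (eqVneq j p) => [->|jp]; first by rewrite eq_sym pp'.
  by case: (eqVneq j p') => [->|jp'] /=; rewrite ?pp' ?eqxx.
rewrite /=; case: (eqVneq j p) => [->|jp]; first by rewrite eq_sym pp'.
by case: (eqVneq j p') => [->|jp'] /=; rewrite ?pp' ?eqxx.
Qed.

End TopOp.

(** * Half-diagrams *)

Section Half.
Context {n m : nat} (eps1 eps2 : int).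
Implicit Types (d : ddiag n m.+1).

Definition line_word (b : 'I_m.+1) : seq blob :=
  (if (b == 0 :> nat) && (eps1 == -1)%R then [:: bL] else [::]) ++
  (if (b == m :> nat) && (eps2 == -1)%R then [:: bR] else [::]).

(* dead stacks are those acting by 0. *)
Definition dead d := (exists b b', partner d (inr b) = inr b') \/
  (exists b, line_word b = [::] /\ deco d (inr b) <> [::] :> seq blob).

Lemma line_wordP b : line_word b = [::] \/ (b = 0 :> nat /\ eps1 = -1)%R \/ (b = m :> nat /\ eps2 = -1)%R.
Proof.
rewrite /line_word; case: (boolP ((b == 0 :> nat) && (eps1 == -1)%R)) => [/andP[/eqP-> /eqP->]|_].
  by right; left.
case: (boolP ((b == m :> nat) && (eps2 == -1)%R)) => [/andP[/eqP-> /eqP->]|_]; last by left.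
by right; right.
Qed.

Section FromHalf.
Context (d : ddiag n m.+1) (hd : is_half eps1 eps2 d).

Lemma half_wf : wf_strings d. Proof. by case/and5P: hd. Qed.
Let hf := let: And3 h _ _ := wf_stringsP _ half_wf in h.
Let hK := let: And3 _ h _ := wf_stringsP _ half_wf in h.
Let hr := let: And3 _ _ h := wf_stringsP _ half_wf in h.

Lemma half_nc : ncL d. Proof. by case/and5P: hd => w _ /planarP-/(_ w). Qed.

Lemma half_bottom b : exists i, partner d (inr b) = inl i.
Proof. by case/and5P: hd => _ /forallP/(_ b)/existsP[i /eqP ?] _ _ _; exists i. Qed.

Lemma half_line b : deco d (inr b) = line_word b :> seq blob.
Proof. by case/and5P: hd => _ _ _ _ /forallP/(_ b)/eqP. Qed.

Lemma half_not_dead : ~ dead d.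
Proof.
case=> [[b [b' E]]|[b [E1]]]; last by rewrite half_line.
by have [i] := half_bottom b; rewrite E.
Qed.

Lemma half_arc (i j : 'I_n) : i < j -> partner d (inl i) = inl j ->
  [\/ deco d (inl i) = [::] :> seq blob,
      outL d (inl i) /\ deco d (inl i) = [:: bL] :> seq blob |
      outR d (inl i) /\ deco d (inl i) = [:: bR] :> seq blob].
Proof.
move=> ij E; case/and5P: hd => _ _ _ /forallP/(_ i)/forallP/(_ j) + _; rewrite ij E eqxx /=.
case/or3P => [/eqP->|/andP[h /eqP->]|/andP[h /eqP->]].
- by constructor 1.
- constructor 2; split=> //.
  by apply/(exposed_leftP half_wf half_nc ij E).
constructor 3; split=> //.
have /(outR_partner half_wf half_nc) := proj1 (exposed_rightP half_wf half_nc ij E) h.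
by rewrite -E hK.
Qed.

Lemma half_colored : colored d (fun x => deco d x).
Proof.
have [wd nc] := (half_wf, half_nc).
have flip x : ((bL \in (deco d x : seq blob) -> outL d x) /\ (bR \in (deco d x : seq blob) -> outR d x)) ->
   ((bL \in (deco d (partner d x) : seq blob) -> outL d (partner d x)) /\
    (bR \in (deco d (partner d x) : seq blob) -> outR d (partner d x))).
  rewrite hr !mem_rev => -[h1 h2]; split=> h; first by apply: outL_partner; auto.
  by apply: outR_partner; auto.
have bot b : (bL \in (deco d (inr b) : seq blob) -> outL d (inr b)) /\
    (bR \in (deco d (inr b) : seq blob) -> outR d (inr b)).
  rewrite half_line /line_word !mem_cat; split=> /orP[].
  - by case: ifP => // /andP[/eqP b0 _] _; apply: outL_first.
  - by case: ifP => // _; rewrite inE.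
  - by case: ifP => // _; rewrite inE.
  by case: ifP => // /andP[/eqP b0 _] _; apply: outR_last.
have top (i j : 'I_n) : i < j -> partner d (inl i) = inl j ->
    (bL \in (deco d (inl i) : seq blob) -> outL d (inl i)) /\ (bR \in (deco d (inl i) : seq blob) -> outR d (inl i)).
  by move=> ij E; case: (half_arc ij E) => [->|[h ->]|[h ->]].
case=> [i|b]; last exact: bot.
case E: (partner d (inl i)) => [j|b]; last first.
  by rewrite -[inl i]hK E; apply: flip.
case: (ltngtP i j) => [ij|ji|/val_inj Eij]; first exact: (top _ _ ij E).
  by rewrite -[inl i]hK E; apply: flip; apply: (top _ _ ji); rewrite -E hK.
by have := hf (inl i); rewrite E Eij eqxx.
Qed.

Lemma half_reduced : reducedd d.
Proof.
have wrd b : reducedw (line_word b).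
  by rewrite /line_word; case: (_ && _); case: (_ && _).
have rr u : reducedw u -> reducedw (rev u) by move=> hu; elim/reducedwP: u / hu.
case=> [i|b]; last by rewrite half_line.
case E: (partner d (inl i)) => [j|b]; last by rewrite -[inl i]hK E hr; apply: rr; rewrite half_line.
case: (ltngtP i j) => [ij|ji|/val_inj Eij].
- by case: (half_arc ij E) => [->|[h ->]|[h ->]].
- have E' : partner d (inl j) = inl i by rewrite -E hK.
  by rewrite -[inl i]hK E hr; apply: rr; case: (half_arc ji E') => [->|[h ->]|[h ->]].
by have := hf (inl i); rewrite E Eij eqxx.
Qed.

Lemma mono_arc (w : node n m.+1 -> seq blob) i j : colored d w -> partner d (inl i) = inl j ->
  mono (w (inl i)).
Proof.
move=> cw E; apply/negP => /andP[hL hR]; have [c1 c2] := cw (inl i).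
have [i0 E0] := half_bottom ord0.
exact: (out_exclusive half_wf E E0 (c1 hL) (c2 hR)).
Qed.
End FromHalf.

Hypothesis hlab : is_label n m eps1 eps2.

Lemma label_m0 : m = 0 -> eps1 = 1%R /\ eps2 = 1%R.
Proof. by case/andP: hlab => _ /and5P[_ _ _ /implyP h _] /eqP/h/andP[/eqP-> /eqP->]. Qed.

Lemma label_m1 : m = 1 -> eps1 = (-1)%R -> eps2 = (-1)%R -> False.
Proof. by case/andP: hlab => _ /and5P[_ _ _ _ /negP h] m1 e1 e2; apply: h; rewrite m1 e1 e2. Qed.

Lemma line_word0 : m = 0 -> forall b, line_word b = [::].
Proof. by move=> m0 b; rewrite /line_word; have [-> ->] := label_m0 m0; rewrite /= !andbF. Qed.

(** If there is no bottom arc, [colored] confines $L$ to the first line and $R$ to the last one, and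
    the last hypothesis says that no required blob is missing. What can still go wrong is an extra
    blob, which is the other case of [dead]. *)
Lemma half_or_dead d : wf_strings d -> ncL d -> reducedd d -> colored d (fun x => deco d x) ->
  (forall b, line_word b <> [::] -> deco d (inr b) <> [::] :> seq blob) ->
  dead d \/ is_half eps1 eps2 d.
Proof.
move=> wd nc rd cd hl; have [hf hK hr] := wf_stringsP _ wd.
have [h|hdead] := boolP `[< dead d >]; first by left; apply/asboolP.
move/asboolP: hdead => nd; right.
have bot b : exists i, partner d (inr b) = inl i.
  by case E: (partner d (inr b)) => [i|b']; [exists i|case: nd; left; exists b, b'].
apply/and5P; split=> //; last 1 first.
- apply/forallP => b; apply/eqP; change (deco d (inr b) = line_word b :> seq blob).
  have [i0 E0] := bot b; have [cL cR] := cd (inr b).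
  have bl : (bL \in (deco d (inr b) : seq blob)) -> b = 0 :> nat.
    by move=> /cL h; apply: (outL_line E0 h bot).
  have br : (bR \in (deco d (inr b) : seq blob)) -> b = m :> nat.
    by move=> /cR h; apply: (outR_line E0 h bot).
  have [E|ne] := eqVneq (line_word b) [::].
    rewrite E; case E2: (deco d (inr b) : seq blob) => // [a u].
    by case: nd; right; exists b; rewrite E2.
  (* For [m = 0] the label forces an undecorated line. Hence the first and the last lines differ
     here, and no line carries both blobs. *)
  have m0 : m <> 0 by move=> m0; rewrite line_word0 // eqxx in ne.
  have := hl b (elimN eqP ne); have := rd (inr b); case: (line_wordP b) => [E|]; first by rewrite E eqxx in ne.
  move: (deco d (inr b) : seq blob) bl br => u bl br hh hu une.
  case: hh => -[Eb E]; rewrite /line_word Eb E /= ?eqxx /=.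
    rewrite (_ : (0 == m) = false) /=; last by apply/eqP => E'; apply: m0.
    have nR : bR \notin u by apply/negP => /br; rewrite Eb => E'; apply: m0.
    by elim/reducedwP: u / hu une nR {bl br}.
  rewrite ?eqxx (_ : (m == 0) = false) /=; last by apply/eqP.
  have nL : bL \notin u by apply/negP => /bl; rewrite Eb.
  by elim/reducedwP: u / hu une nL {bl br}.
- by apply/forallP => b; have [i E] := bot b; apply/existsP; exists i; rewrite E.
- exact/(planarP wd).
apply/forallP => i; apply/forallP => j; apply/implyP => /andP[ij /eqP E].
have [i0 E0] := bot ord0; have [cL cR] := cd (inl i).
have excl : bL \in (deco d (inl i) : seq blob) -> bR \in (deco d (inl i) : seq blob) -> False.
  by move=> h1 h2; apply: (out_exclusive wd E E0 (cL h1) (cR h2)).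
have XL : outL d (inl i) -> exposed_left d i j by move=> h; apply/(exposed_leftP wd nc ij E).
have XR : outR d (inl i) -> exposed_right d i j.
  by move=> h; apply/(exposed_rightP wd nc ij E); rewrite -E; apply: outR_partner.
have := rd (inl i); rewrite -!(inj_eq val_inj) /=.
move: (deco d (inl i) : seq blob) cL cR excl => u cL cR excl hu.
elim/reducedwP: u / hu cL cR excl => //= cL cR excl.
- by rewrite (XL (cL (mem_head _ _))).
- by rewrite (XR (cR (mem_head _ _))) orbT.
- by case: excl; rewrite !inE.
by case: excl; rewrite !inE.
Qed.

Section TopHalf.
Context (hn : 0 < n) (i : nat) (hi : i <= n).

(** No relation between words produces the empty word, so a decorated line stays decorated. *)
Lemma deco_topop_nil l (d : ddiag n l) b : wf_strings d ->
  deco (topop hn i d) (inr b) = [::] :> seq blob -> deco d (inr b) = [::] :> seq blob.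
Proof.
move=> wd; have dec_case z a : deco (dec (inl z : node n l) a d) (inr b) = [::] :> seq blob ->
    deco d (inr b) = [::] :> seq blob.
  pose Q x (yw : node n l * word) := yw.2 = [::] :> seq blob -> deco d x = [::] :> seq blob.
  suff : Q (inr b) (dec (inl z) a d (inr b)) by [].
  apply: dec_ind; rewrite /Q //.
  - by move/red_nil.
  - by move/red_nil; case: (deco d _ : seq blob).
rewrite /topop; case: eqP => [_|/eqP i0]; first exact: dec_case.
case: eqP => [_|/eqP ine]; first exact: dec_case.
have ne := top_neq hn hi l i0 ine.
set p := inl _ in ne *; set p' := inl _ in ne *.
pose Q (x : node n l) (yw : node n l * word) := x <> p -> x <> p' -> yw.2 = [::] :> seq blob -> deco d x = [::] :> seq blob.
suff h : Q (inr b) (surg p p' d (inr b)) by apply: h.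
apply: (surg_ind wd ne); rewrite /Q //.
- by move=> _ _ _ /red_nil; case: (deco d _ : seq blob).
by move=> _ _ _ /red_nil; case: (deco d _ : seq blob).
Qed.

Lemma dead_topop d : wf_strings d -> dead d -> dead (topop hn i d).
Proof.
move=> wd [[b [b' E]]|[b [E1 E2]]]; last first.
  by right; exists b; split=> // /(deco_topop_nil wd).
left; exists b, b'; rewrite /topop; case: eqP => [_|/eqP i0]; first by rewrite partner_dec.
case: eqP => [_|/eqP ine]; first by rewrite partner_dec.
have ne := top_neq hn hi m.+1 i0 ine.
by rewrite /partner surg_same // -/(partner d _) E.
Qed.

Lemma half_topop d : is_half eps1 eps2 d ->
  dead (topop hn i d) \/ is_half eps1 eps2 (topop hn i d).
Proof.
move=> hd; have wd := half_wf hd; have nc := half_nc hd; apply: half_or_dead.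
- exact: wf_topop.
- exact: ncL_topop.
- by apply: reducedd_topop => //; apply: half_reduced hd.
- by apply: colored_topop_deco => //; apply: half_colored hd.
by move=> b hb /(deco_topop_nil wd); rewrite (half_line hd).
Qed.

End TopHalf.

(* Stacking d on any basis half-diagram gives 0 or a basis half-diagram, in
   which case planarity constrains the words before straightening. *)
Definition tame (d : ddiag n n) := forall h : ddiag n m.+1, is_half eps1 eps2 h ->
  dead (stack0 d h) \/
  is_half eps1 eps2 (stack0 d h) /\ colored (stack0 d h) (fun x => (raw_string d h x).2).

Lemma tame_id : tame (id_diag n).
Proof.
move=> h hh; have wh := half_wf hh; have rh := half_reduced hh.
right; rewrite stack0_id //; split=> // x; rewrite raw_id //; exact: half_colored hh x.
Qed.

Lemma tame_topop (hn : 0 < n) i (d : ddiag n n) : i <= n -> wf_strings d -> tame d -> tame (topop hn i d).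
Proof.
move=> hi wd td h hh; have wh := half_wf hh; rewrite stack0_topop //.
case: (td h hh) => [hd|[hd cd]]; first by left; apply: dead_topop; rewrite // wf_stack0.
case: (half_topop hn hi hd) => [h1|h1]; [by left|right; split=> //].
by apply: colored_topop_raw => //; apply: half_nc hd.
Qed.

(** The strings leaving the top of [d] all return to the top, so a lower end of the stack can only
    be joined to another lower end. *)
Lemma no_propagating_dead (d : ddiag n n) (h : ddiag n m.+1) : wf_strings d -> no_propagating d ->
  is_half eps1 eps2 h -> dead (stack0 d h).
Proof.
move=> wd /forallP np hh; have wh := half_wf hh; left; exists ord0.
rewrite partner_stack0; have := wf_raw wd wh (inr ord0).
case: (raw_string d h (inr ord0)) => -[z|b] w [_ /=]; last by exists b.
have /forallP npz := np z; rewrite /raw_string; case E: (partner d (inl z)) => [z'|j] //.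
by have := npz j; rewrite E eqxx.
Qed.

Section Topo.
Context (d t : ddiag n n) (wd : wf_strings d) (rd : reducedd d) (Et : topo d = Some t).

Lemma topoE : exists i1 i2 j1 j2, [/\ i1 != i2, j1 != j2, partner d (inl i1) = inl i2,
  partner d (inr j1) = inr j2 &
  t = [ffun x =>
        if x == inl i1 then (inr j1, [bseq bL])
        else if x == inr j1 then (inl i1, [bseq bL])
        else if x == inl i2 then (inr j2, [bseq bR])
        else if x == inr j2 then (inl i2, [bseq bR])
        else d x]] /\ no_propagating d.
Proof.
move: Et; rewrite /topo; case np: (no_propagating d) => //=.
rewrite /top_LR_arc /bottom_LR_arc; case: pickP => // -[i1 i2] /= /and3P[i12 /eqP E1 _].
case: pickP => // -[j1 j2] /= /and3P[j12 /eqP E2 _] [<-].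
exists i1, i2, j1, j2; split=> //; split=> //.
  by apply: contraTneq i12 => ->; rewrite ltnn.
by apply: contraTneq j12 => ->; rewrite ltnn.
Qed.

(** The new diagram has exactly two propagating lines, one carrying $L$ and the other $R$. A line of
    the stack passes through one of them and is therefore decorated, whereas every label has a line
    that must stay undecorated: $(1,-1,-1)$ would be the exception. *)
Lemma topo_facts : [/\ wf_strings t, reducedd t, topo t = None &
  forall h : ddiag n m.+1, is_half eps1 eps2 h -> dead (stack0 t h)].
Proof.
have [i1 [i2 [j1 [j2 [[i12 j12 E1 E2 tE] np]]]]] := topoE.
have [hf hK hr] := wf_stringsP _ wd.
have E1' : partner d (inl i2) = inl i1 by rewrite -E1 hK.
have E2' : partner d (inr j2) = inr j1 by rewrite -E2 hK.
have t1 : t (inl i1) = (inr j1, [bseq bL]) by rewrite tE ffunE eqxx.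
have t2 : t (inr j1) = (inl i1, [bseq bL]) by rewrite tE ffunE eqxx.
have t3 : t (inl i2) = (inr j2, [bseq bR]).
  by rewrite tE ffunE (inj_eq (@inl_inj _ _)) eq_sym (negbTE i12) /= eqxx.
have t4 : t (inr j2) = (inl i2, [bseq bR]).
  by rewrite tE ffunE /= (inj_eq (@inr_inj _ _)) [_ == j1]eq_sym (negbTE j12) eqxx.
have t5 x : x != inl i1 -> x != inr j1 -> x != inl i2 -> x != inr j2 -> t x = d x.
  by move=> /negbTE h1 /negbTE h2 /negbTE h3 /negbTE h4; rewrite tE ffunE h1 h2 h3 h4.
have tind (Q : node n n -> node n n * word -> Prop) : Q (inl i1) (inr j1, [bseq bL]) ->
   Q (inr j1) (inl i1, [bseq bL]) -> Q (inl i2) (inr j2, [bseq bR]) ->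
   Q (inr j2) (inl i2, [bseq bR]) ->
   (forall x, x != inl i1 -> x != inr j1 -> x != inl i2 -> x != inr j2 -> Q x (d x)) ->
   forall x, Q x (t x).
  move=> q1 q2 q3 q4 q5 x.
  have [->|h1] := eqVneq x (inl i1); first by rewrite t1.
  have [->|h2] := eqVneq x (inr j1); first by rewrite t2.
  have [->|h3] := eqVneq x (inl i2); first by rewrite t3.
  have [->|h4] := eqVneq x (inr j2); first by rewrite t4.
  by rewrite t5 //; apply: q5.
have wt : wf_strings t.
  pose Q x (yw : node n n * word) := [/\ yw.1 != x, (t yw.1).1 = x
     & (t yw.1).2 = rev yw.2 :> seq blob].
  suff key : forall x, Q x (t x) by apply/wf_stringsP; split=> x; have [] := key x.
  apply: tind; rewrite /Q /= ?t1 ?t2 ?t3 ?t4 //.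
  move=> x h1 h2 h3 h4; rewrite t5; first by split; [exact: hf|exact: hK|exact: hr].
  - by rewrite -E1' (inj_eq (inv_inj hK)).
  - by rewrite -E2' (inj_eq (inv_inj hK)).
  - by rewrite -E1 (inj_eq (inv_inj hK)).
  by rewrite -E2 (inj_eq (inv_inj hK)).
split=> //.
- by move=> x; rewrite /deco; apply: (tind (fun _ yw => reducedw yw.2)) => // y _ _ _ _; apply: rd.
- rewrite /topo (_ : no_propagating t = false) //; apply/negP => /forallP/(_ i1)/forallP/(_ j1).
  by rewrite /partner t1 eqxx.
move=> h hh; have wh := half_wf hh.
pose D := stack0 t h; have wD : wf_strings D by apply: wf_stack0.
have [hfD hKD hrD] := wf_stringsP _ wD.
have prop z b : partner D (inr b) = inl z -> (z = i1 \/ z = i2) /\ deco D (inr b) <> [::] :> seq blob.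
  move=> E; have E' : partner D (inl z) = inr b by rewrite -E hKD.
  have Ed : deco D (inr b) = rev (deco D (inl z)) :> seq blob by rewrite -E' hrD.
  rewrite {}Ed partner_stack0 in E' *; rewrite deco_stack0.
  move: E'; rewrite /raw_string; case Ez: (partner t (inl z)) => [z'|j] //= _.
  have zz : z = i1 \/ z = i2.
    have [->|h1] := eqVneq z i1; first by left.
    have [->|h3] := eqVneq z i2; first by right.
    move: Ez; rewrite /partner t5 // => Ez.
    by have := forallP (forallP np z) j; rewrite /partner Ez eqxx.
  split=> //; case: walk => y w /= /(congr1 rev); rewrite revK /= => /red_nil.
  by case: zz => ->; rewrite /deco ?t1 ?t3.
case: (pselect (exists b, exists b', partner D (inr b) = inr b')) => [hb|nb]; first by left.
have bot b : exists z, partner D (inr b) = inl z.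
  by case E: (partner D (inr b)) => [z|b']; [exists z|case: nb; exists b, b'].
right; case: (pselect (exists b, line_word b = [::])) => [[b Eb]|nl].
  exists b; split=> //; have [z Ez] := bot b.
  by have [] := prop _ _ Ez.
have m0 : m <> 0 by move=> m0; apply: nl; exists ord0; apply: line_word0.
have lw (b : 'I_m.+1) : (b = 0 :> nat /\ eps1 = -1)%R \/ (b = m :> nat /\ eps2 = -1)%R.
  by case: (line_wordP b) => // E; case: nl; exists b.
have m1 : m = 1.
  have [//|m2] := eqVneq m 1; have hm : 1 < m.+1 by rewrite ltnS lt0n; apply/eqP.
  by have [[]|[E _]] := lw (Ordinal hm); rewrite // -E eqxx in m2.
exfalso; apply: (label_m1 m1).
  by have := lw ord0 => /=; rewrite m1; case=> -[].
by have := lw ord_max => /=; rewrite m1; case=> -[].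
Qed.

End Topo.

(** The invariant of products of generators bracketed to the right. The condition on [topo] makes
    the identity act as a left unit on [d]. *)
Definition good (d : ddiag n n) := [/\ wf_strings d, reducedd d, topo d = None & tame d].

Lemma good_id : 0 < n -> good (id_diag n).
Proof.
move=> hn; split; [exact: wf_id|exact: reducedd_id| |exact: tame_id].
rewrite /topo (_ : no_propagating _ = false) //; apply/negP => /forallP/(_ (Ordinal hn))/forallP/(_ (Ordinal hn)).
by rewrite /partner ffunE eqxx.
Qed.

Lemma stack0_e (hn : 0 < n) i l (d : ddiag n l) : i <= n -> wf_strings d -> reducedd d ->
  stack0 (e_diag n i) d = topop hn i d.
Proof. by move=> hi wd rd; rewrite (e_diagE hn hi) stack0_topop ?stack0_id //; apply: wf_id. Qed.

Lemma good_stack i (d : ddiag n n) : 0 < n -> i <= n -> good d -> good (stack (e_diag n i) d).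
Proof.
move=> hn hi [wd rd _ td]; rewrite /stack (stack0_e hn hi wd rd).
have ws := wf_topop hn hi wd; have rs := reducedd_topop hn hi wd rd.
case E: (topo _) => [t|] /=.
  by have [h1 h2 h3 h4] := topo_facts ws rs E; split=> // h hh; left; apply: h4.
by split=> //; apply: tame_topop.
Qed.

End Half.

Local Open Scope ring_scope.

(** * Compatibility of the action with products *)

Section Action.
Context {k : fieldType} (P : blob_params k) {n m : nat} {eps1 eps2 : int}.
Hypotheses (hn : (0 < n)%N) (hlab : is_label n m eps1 eps2).
Notation hdiag := (hdiag n m eps1 eps2).
Notation cellmod := (cellmod k n m eps1 eps2).
Notation is_half := (is_half eps1 eps2).
Notation dead := (dead eps1 eps2).
Notation good := (@good n m eps1 eps2).
Notation actb := (act_basis P (n := n) (m := m) (eps1 := eps1) (eps2 := eps2)).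
Implicit Types (v : cellmod) (a : sblob k n).

Lemma act_is_linear a : linear (act P a : cellmod -> cellmod).
Proof.
move=> c u v; rewrite /act scaler_sumr -big_split; apply: eq_bigr => d _ /=.
rewrite scaler_sumr -big_split; apply: eq_bigr => h _ /=.
by rewrite !ffunE scalerA -scalerDl; congr (_ *: _); rewrite /GRing.scale /=; ring.
Qed.

HB.instance Definition _ a := GRing.isLinear.Build k cellmod cellmod _ (act P a) (act_is_linear a).

Lemma actZD c a b v : act P (c *: a + b) v = c *: act P a v + act P b v.
Proof.
rewrite /act scaler_sumr -big_split; apply: eq_bigr => d _ /=.
rewrite scaler_sumr -big_split; apply: eq_bigr => h _ /=.
by rewrite !ffunE scalerA -scalerDl; congr (_ *: _); rewrite /GRing.scale /=; ring.
Qed.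

Lemma act0 v : act P (0 : sblob k n) v = 0.
Proof. by rewrite /act big1 // => d _; rewrite big1 // => h _; rewrite ffunE mul0r scale0r. Qed.

Lemma actD a b v : act P (a + b) v = act P a v + act P b v.
Proof. by rewrite -[in LHS](scale1r a) actZD scale1r. Qed.

Lemma actZ c a v : act P (c *: a) v = c *: act P a v.
Proof. by rewrite -[in LHS](addr0 (c *: a)) actZD act0 addr0. Qed.

Lemma act_sum I (r : seq I) (F : I -> sblob k n) v :
  act P (\sum_(i <- r) F i) v = \sum_(i <- r) act P (F i) v.
Proof. by elim: r => [|i r IH]; rewrite ?big_nil ?act0 // !big_cons actD IH. Qed.

Lemma cellE v : v = \sum_h v h *: cbasis (k := k) h.
Proof.
apply/ffunP => h; rewrite sum_ffunE (bigD1 h) //= !ffunE eqxx [X in _ + X]big1 ?addr0 => [|h' hh'].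
  by rewrite /GRing.scale /= mulr1.
by rewrite !ffunE eq_sym (negbTE hh') scaler0.
Qed.

Lemma act_bbasis d v : act P (bbasis d) v = \sum_h v h *: actb (val d) h.
Proof.
rewrite /act (bigD1 d) //= [X in _ + X]big1 ?addr0 => [|d' dd']; last first.
  by rewrite big1 // => h _; rewrite ffunE (negbTE dd') mul0r scale0r.
by apply: eq_bigr => h _; rewrite ffunE eqxx mul1r.
Qed.

Lemma act_bbasis_cbasis d h : act P (bbasis d) (cbasis h) = actb (val d) h.
Proof.
rewrite act_bbasis (bigD1 h) //= ffunE eqxx scale1r big1 ?addr0 // => h' hh'.
by rewrite ffunE (negbTE hh') scale0r.
Qed.

Lemma actb_dead (d : ddiag n n) (h : hdiag) : dead (stack0 d (val h)) -> actb d h = 0.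
Proof.
by move=> hd; rewrite /act_basis; case: insubP => // h' hh' _; case: (half_not_dead hh' hd).
Qed.

Lemma actb_half (d : ddiag n n) (h h' : hdiag) : stack0 d (val h) = val h' ->
  actb d h = stack0_coef P d (val h) *: cbasis h'.
Proof. by move=> E; rewrite /act_basis E valK. Qed.

Lemma topcf_id (i : nat) : topcf P hn i (id_diag n) = 1.
Proof.
have id1 y : deco (id_diag n) y = [bseq] :> word by rewrite /deco ffunE; case: y.
rewrite /topcf !id1; case: eqP => // _; case: eqP => // _.
by rewrite /cup_coef !id1 /partner ffunE.
Qed.

Lemma stack0_coef_e l i (d : ddiag n l) : (i <= n)%N -> wf_strings d -> reducedd d ->
  (forall j j', i != 0%N -> i != n -> partner d (inl j) = inl j' -> mono (deco d (inl j))) ->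
  stack0_coef P (e_diag n i) d = topcf P hn i d.
Proof.
move=> hi wd rd hm; rewrite (e_diagE hn hi).
have := stack0_coef_topop hn hi wf_id wd P reducedd_id.
rewrite topcf_id mul1r stack0_id // stack0_coef_id // mul1r; apply.
by move=> j j' i0 ine E; rewrite raw_id //=; apply: hm E.
Qed.

Lemma half_mono (d : ddiag n m.+1) i j : is_half d -> partner d (inl i) = inl j -> mono (deco d (inl i)).
Proof. by move=> hd E; apply: (mono_arc (w := fun x => deco d x) hd (half_colored hd) E). Qed.

Lemma actb_e i (h : hdiag) : (i <= n)%N ->
  actb (e_diag n i) h = (if insub (topop hn i (val h)) is Some h'
     then topcf P hn i (val h) *: cbasis h' else 0).
Proof.
move=> hi; have hh := valP h; rewrite /act_basis (stack0_e hn hi (half_wf hh) (half_reduced hh)).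
rewrite stack0_coef_e //; [exact: half_wf hh|exact: half_reduced hh|].
by move=> j j' _ _; apply: half_mono.
Qed.

(** If [d] stacked on [h] is dead, it stays so under $e_i$. Otherwise the words on its arcs, before
    straightening, have blobs of one kind, and the scalars agree by [stack0_coef_topop]. When the
    topological relation applies to $e_id$, both sides vanish. *)
Lemma actb_e_stack (i : 'I_n.+1) (d : bdiag n) h : good (val d) ->
  act P (be i) (actb (val d) h) =
  stack_coef P (e_diag n i) (val d) *: actb (stack (e_diag n i) (val d)) h.
Proof.
case=> wd rd _ td; have hi : (i <= n)%N by rewrite -ltnS.
have hh := valP h; have wh := half_wf hh; have rh := half_reduced hh.
set D := stack0 (val d) (val h).
have ws := wf_topop hn hi wd; have rs := reducedd_topop hn hi wd rd.
have sE : stack0 (topop hn i (val d)) (val h) = topop hn i D by rewrite stack0_topop.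
rewrite /stack_coef /stack (stack0_e hn hi wd rd).
have deadcase : dead (topop hn i D) ->
   actb (odflt (topop hn i (val d)) (topo (topop hn i (val d)))) h = 0.
  move=> hd; apply: actb_dead; case E: (topo _) => [t|] /=; last by rewrite sE.
  by have [_ _ _ tt] := topo_facts hlab ws rs E; apply: tt.
case: (td _ hh) => [hd|[hD cD]].
  rewrite actb_dead // linear0 deadcase ?scaler0 //.
  by apply: dead_topop => //; apply: wf_stack0.
rewrite (@actb_half _ h (Sub D hD)) // linearZ /= act_bbasis_cbasis actb_e //=.
case: insubP => [h2 half2 E2|nh]; last first.
  case: (half_topop hlab hn hi hD) => [hd|hd]; first by rewrite deadcase ?scaler0 // scaler0.
  by rewrite hd in nh.
have -> : topo (topop hn i (val d)) = None.
  case E: (topo _) => [t|] //.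
  have [i1 [i2 [j1 [j2 [_ np]]]]] := topoE E.
  by have := no_propagating_dead ws np hh; rewrite sE => /(half_not_dead half2).
rewrite /= (@actb_half _ h h2) ?sE // mulr1 !scalerA; congr (_ *: _).
have mn j j' : partner D (inl j) = inl j' -> mono (raw_string (val d) (val h) (inl j)).2.
  by move=> E; apply: (mono_arc hD cD E).
rewrite stack0_coef_e //.
  rewrite -(stack0_coef_topop hn hi wd wh P rd) // => j j' _ _; exact: mn.
move=> j j' _ _ E; have := mn j j'; rewrite partner_stack0 /raw_string E /=; exact.
Qed.

(* Combinations of good diagrams, on which left multiplication by the e_i is
   compatible with the action. *)
Definition tamea (a : sblob k n) := forall d, a d != 0 -> good (val d).

Lemma bmul_be (i : 'I_n.+1) a : bmul P (be i) a =
  \sum_d (a d * stack_coef P (e_diag n i) (val d)) *: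
     bbasis (bstack (exist _ (e_diag n i) (obtained_eP i)) d).
Proof.
rewrite /bmul (bigD1 (exist _ (e_diag n i) (obtained_eP i))) //= [X in _ + X]big1 ?addr0.
  by apply: eq_bigr => d _; rewrite ffunE eqxx mul1r.
by move=> d hd; rewrite big1 // => d' _; rewrite ffunE (negbTE hd) !mul0r scale0r.
Qed.

Lemma act_be_mul i a v : tamea a -> act P (bmul P (be i) a) v = act P (be i) (act P a v).
Proof.
move=> ta; rewrite bmul_be act_sum [act P a v]/act linear_sum; apply: eq_bigr => d _ /=.
have [a0|an] := eqVneq (a d) 0.
  rewrite a0 mul0r scale0r act0 linear_sum big1 // => h _.
  by rewrite mul0r scale0r linear0.
rewrite actZ act_bbasis scaler_sumr linear_sum; apply: eq_bigr => h _ /=.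
rewrite [RHS]linearZ /=; have /= -> := actb_e_stack i h (ta d an).
by rewrite !scalerA; congr (_ *: _); ring.
Qed.

End Action.

(** * Relations between surgeries *)

Section SurgAlgebra.
Context {n l : nat}.
Implicit Types (d : ddiag n l) (p r z : node n l).

Lemma surg_unique d d1 p p' : wf_strings d -> p != p' ->
  d1 p = (p', [bseq]) -> d1 p' = (p, [bseq]) ->
  (partner d p != p' -> d1 (partner d p) =
    (partner d p', red_word (deco d (partner d p) ++ deco d p'))) ->
  (partner d p != p' -> d1 (partner d p') =
    (partner d p, red_word (deco d (partner d p') ++ deco d p))) ->
  (forall x, x != p -> x != p' -> partner d x != p -> partner d x != p' -> d1 x = d x) ->
  surg p p' d = d1.
Proof.
move=> wd pp' h1 h2 h3 h4 h5; apply/ffunP.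
apply: (surg_ind wd pp' (Q := fun x yw => yw = d1 x)) => //.
- by move=> h; rewrite h3.
- by move=> h; rewrite h4.
by move=> x g1 g2 g3 g4; rewrite h5.
Qed.

Lemma surgC d p p' : wf_strings d -> p != p' -> surg p p' d = surg p' p d.
Proof.
move=> wd pp'; have [hf hK hr] := wf_stringsP _ wd.
have p'p : p' != p by rewrite eq_sym.
have H : partner d p != p' -> partner d p' != p.
  by apply: contraNneq => <-; rewrite hK.
apply: surg_unique => //.
- by rewrite surg_p'.
- by rewrite surg_p.
- by move/H => h; rewrite surg_join'.
- by move/H => h; rewrite surg_join.
by move=> x h1 h2 h3 h4; rewrite surg_same.
Qed.

Lemma surg_id d p p' : wf_strings d -> p != p' -> d p = (p', [bseq]) -> surg p p' d = d.
Proof.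
move=> wd pp' E; have [hf hK hr] := wf_stringsP _ wd.
have Ep : partner d p = p' by rewrite /partner E.
have E' : d p' = (p, [bseq]).
  rewrite [d p']surjective_pairing; congr (_, _); first by rewrite -[LHS]/(partner d p') -Ep hK.
  by apply: word_eq; rewrite -[LHS]/(deco d p' : seq blob) -Ep hr /deco E.
by apply: surg_unique; rewrite ?Ep ?eqxx.
Qed.

(* Moving an undecorated cup {a, b} to {b, c}, and back. *)
Section Zigzag.
Context (d : ddiag n l) (wd : wf_strings d) (rd : reducedd d) (a b c : node n l).
Hypotheses (da : d a = (b, [bseq])) (ca : c != a) (cb : c != b).
Let hf := let: And3 h _ _ := wf_stringsP _ wd in h.
Let hK := let: And3 _ h _ := wf_stringsP _ wd in h.
Let hr := let: And3 _ _ h := wf_stringsP _ wd in h.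
Let pa : partner d a = b. Proof. by rewrite /partner da. Qed.
Let pb : partner d b = a. Proof. by rewrite -pa hK. Qed.
Let ab : a != b. Proof. by rewrite -pa eq_sym hf. Qed.
Let bc : b != c. Proof. by rewrite eq_sym. Qed.
Let wa : deco d a = [bseq]. Proof. by rewrite /deco da. Qed.
Let wb : deco d b = [bseq]. Proof. by apply: word_eq; rewrite -pa hr wa. Qed.

Lemma zigzag_b : surg b c d b = (c, [bseq]). Proof. by rewrite surg_p. Qed.
Lemma zigzag_c : surg b c d c = (b, [bseq]). Proof. by rewrite surg_p'. Qed.
Lemma zigzag_a : surg b c d a = d c.
Proof.
have := @surg_join n l d wd b c; rewrite pb wa => -> //; last by rewrite eq_sym.
rewrite [d c]surjective_pairing; congr (_, _); apply: word_eq; exact: red_id (rd c).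
Qed.
Lemma zigzag_C : surg b c d (partner d c) = (a, deco d (partner d c)).
Proof.
have := @surg_join' n l d wd b c bc; rewrite pb wb => -> //; last by rewrite eq_sym.
by congr (_, _); apply: word_eq; rewrite cats0; apply: red_id (rd _).
Qed.
Lemma zigzag_same x : x != a -> x != b -> x != c -> partner d x != c -> surg b c d x = d x.
Proof.
move=> xa xb xc xC; rewrite surg_same //.
by rewrite -(inj_eq (inv_inj hK)) hK pb.
Qed.

Lemma zigzagK : surg a b (surg b c d) = d.
Proof.
have Ca : partner d c != a by rewrite -pb (inj_eq (inv_inj hK)).
have Cb : partner d c != b by rewrite -pa (inj_eq (inv_inj hK)).
have w2 : wf_strings (surg b c d) by apply: wf_surg.
have E1 : partner (surg b c d) a = partner d c by rewrite /partner zigzag_a.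
have E2 : partner (surg b c d) b = c by rewrite /partner zigzag_b.
apply: surg_unique => //; rewrite ?E1 ?E2.
- by rewrite [d b]surjective_pairing -/(partner d b) -/(deco d b) pb wb.
- move=> _; rewrite [d _]surjective_pairing -/(partner d _) hK; congr (_, _).
  rewrite /deco zigzag_C zigzag_b cats0; apply: word_eq; apply/esym; exact: red_id (rd _).
- move=> _; rewrite [d c]surjective_pairing; congr (_, _).
  rewrite /deco zigzag_a zigzag_c; apply: word_eq; apply/esym; exact: red_id (rd _).
move=> x xa xb h1 h2.
have xc : x != c by apply: contraNneq h2 => ->; rewrite /partner zigzag_c.
have [E|xC] := eqVneq x (partner d c).
  by move: h1; rewrite E /partner zigzag_C eqxx.
by rewrite zigzag_same // -(inj_eq (inv_inj hK)) hK.
Qed.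
End Zigzag.

Lemma surg_comm d p p' r r' : wf_strings d -> p != p' -> r != r' ->
  partner d p != p' -> partner d r != r' ->
  (forall x, x \in [:: p; p'; partner d p; partner d p'] ->
     x \notin [:: r; r'; partner d r; partner d r']) ->
  surg p p' (surg r r' d) = surg r r' (surg p p' d).
Proof.
move=> wd pp' rr' hp hr0 dis; have [hf hK hr] := wf_stringsP _ wd.
have wr : wf_strings (surg r r' d) by apply: wf_surg.
have wp : wf_strings (surg p p' d) by apply: wf_surg.
have S x : x \in [:: p; p'; partner d p; partner d p'] ->
   [/\ x != r, x != r', partner d x != r & partner d x != r'].
  move/dis; rewrite !inE !negb_or => /and4P[h1 h2 h3 h4]; split=> //.
    by rewrite -(inj_eq (inv_inj hK)) hK.
  by rewrite -(inj_eq (inv_inj hK)) hK.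
have Sd x : x \in [:: p; p'; partner d p; partner d p'] -> surg r r' d x = d x.
  by move/S=> [h1 h2 h3 h4]; rewrite surg_same.
have m1 : p \in [:: p; p'; partner d p; partner d p'] by rewrite !inE eqxx.
have m2 : p' \in [:: p; p'; partner d p; partner d p'] by rewrite !inE eqxx !orbT.
have m3 : partner d p \in [:: p; p'; partner d p; partner d p'] by rewrite !inE eqxx !orbT.
have m4 : partner d p' \in [:: p; p'; partner d p; partner d p'] by rewrite !inE eqxx !orbT.
have P1 : partner (surg r r' d) p = partner d p by rewrite /partner Sd.
have P2 : partner (surg r r' d) p' = partner d p' by rewrite /partner Sd.
have D x : x \in [:: p; p'; partner d p; partner d p'] -> deco (surg r r' d) x = deco d x.
  by move=> hx; rewrite /deco Sd.
(* the values of surg p p' d at its four nodes are not touched by r, r' *)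
have V x yw : x \in [:: p; p'; partner d p; partner d p'] ->
    yw.1 \in [:: p; p'; partner d p; partner d p'] -> surg p p' d x = yw ->
    surg r r' (surg p p' d) x = yw.
  move=> hx hy E; have [h1 h2 _ _] := S x hx; have [h3 h4 _ _] := S _ hy.
  by rewrite surg_same // /partner E.
apply: surg_unique; rewrite ?P1 ?P2 ?D //.
- by apply: V => //; rewrite surg_p.
- by apply: V => //; rewrite surg_p'.
- by move=> _; apply: V => //; rewrite surg_join.
- by move=> _; apply: V => //; rewrite surg_join'.
move=> x x1 x2 x3 x4.
have Tr y : y \in [:: r; r'; partner d r; partner d r'] -> surg p p' d y = d y.
  move=> hy; have ny z : z \in [:: p; p'; partner d p; partner d p'] -> y != z.
    by move=> /dis; apply: contraNneq => <-.
  rewrite surg_same ?ny //; first by rewrite -(inj_eq (inv_inj hK)) hK ny.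
  by rewrite -(inj_eq (inv_inj hK)) hK ny.
have k1 : r \in [:: r; r'; partner d r; partner d r'] by rewrite !inE eqxx.
have k2 : r' \in [:: r; r'; partner d r; partner d r'] by rewrite !inE eqxx !orbT.
have k3 : partner d r \in [:: r; r'; partner d r; partner d r'] by rewrite !inE eqxx !orbT.
have k4 : partner d r' \in [:: r; r'; partner d r; partner d r'] by rewrite !inE eqxx !orbT.
have Pr : partner (surg p p' d) r = partner d r by rewrite /partner Tr.
have Pr' : partner (surg p p' d) r' = partner d r' by rewrite /partner Tr.
have Dr y : y \in [:: r; r'; partner d r; partner d r'] -> deco (surg p p' d) y = deco d y.
  by move=> hy; rewrite /deco Tr.
have [E|e1] := eqVneq x r; first by rewrite E !surg_p.
have [E|e2] := eqVneq x r'; first by rewrite E !surg_p'.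
have [E|e3] := eqVneq x (partner d r).
  rewrite E (surg_join wd) // -Pr (surg_join wp) ?Pr // Pr' !Dr //.
have [E|e4] := eqVneq x (partner d r').
  rewrite E (surg_join' wd) // -Pr' (surg_join' wp) ?Pr // Pr' !Dr //.
have f3 : partner d x != r by rewrite -(inj_eq (inv_inj hK)) hK.
have f4 : partner d x != r' by rewrite -(inj_eq (inv_inj hK)) hK.
rewrite (surg_same (d := d)) // in x3 x4 *; rewrite /partner surg_same // -/(partner d x) in x3 x4.
have E : surg p p' d x = d x by rewrite surg_same.
by rewrite surg_same // /partner E.
Qed.

End SurgAlgebra.

Lemma red_dup a u : reducedw u -> red_word (a :: red_word (a :: u)) = red_word (a :: u).
Proof. by move=> hu; apply: word_eq; case: a; elim/reducedwP: u / hu. Qed.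

Lemma red_rdup a u : reducedw u -> red_word (rcons (red_word (rcons u a)) a) = red_word (rcons u a).
Proof. by move=> hu; apply: word_eq; case: a; elim/reducedwP: u / hu. Qed.

Lemma cons_coef_dup (k : fieldType) (P : blob_params k) a u : reducedw u ->
  cons_coef P a (red_word (a :: u)) = delta_of P a.
Proof. by move=> hu; case: a; elim/reducedwP: u / hu. Qed.

Section DecAlgebra.
Context {n l : nat}.
Implicit Types (d : ddiag n l) (p r z : node n l).

Lemma dec_unique d d1 z a : wf_strings d ->
  d1 z = (partner d z, red_word (a :: deco d z)) ->
  d1 (partner d z) = (z, red_word (rcons (deco d (partner d z)) a)) ->
  (forall x, x != z -> partner d x != z -> d1 x = d x) ->
  dec z a d = d1.
Proof.
move=> wd h1 h2 h3; apply/ffunP; apply: (dec_ind wd (Q := fun x yw => yw = d1 x)) => //.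
by move=> x g1 g2; rewrite h3.
Qed.

Lemma dec_dup d z a : wf_strings d -> reducedd d -> dec z a (dec z a d) = dec z a d.
Proof.
move=> wd rd; have wd1 := wf_dec wd z a; apply: dec_unique; rewrite ?partner_dec //.
- have -> : deco (dec z a d) z = red_word (a :: deco d z) by rewrite /deco dec_z.
  by rewrite red_dup ?dec_z //; apply: rd.
have -> : deco (dec z a d) (partner d z) = red_word (rcons (deco d (partner d z)) a).
  by rewrite /deco dec_z'.
by rewrite red_rdup ?dec_z' //; apply: rd.
Qed.

Lemma dec_comm d z a y b : wf_strings d -> 
  z != y -> z != partner d y -> dec z a (dec y b d) = dec y b (dec z a d).
Proof.
move=> wd zy zY; have [hf hK hr] := wf_stringsP _ wd.
have wy := wf_dec wd y b; have wz := wf_dec wd z a.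
have Yz : partner d y != z by rewrite eq_sym.
have Zy : partner d z != y by rewrite -(inj_eq (inv_inj hK)) hK.
have ZY : partner d z != partner d y by rewrite (inj_eq (inv_inj hK)).
have e1 : dec y b d z = d z by rewrite dec_same.
have e2 : dec y b d (partner d z) = d (partner d z) by rewrite dec_same // hK.
have e3 : dec z a d y = d y by rewrite dec_same // eq_sym.
have e4 : dec z a d (partner d y) = d (partner d y) by rewrite dec_same // hK eq_sym.
apply: dec_unique; rewrite ?partner_dec // /deco ?e1 ?e2.
- by rewrite dec_same // ?partner_dec // dec_z.
- by rewrite dec_same // ?partner_dec // ?hK // dec_z'.
move=> x xz xZ; have [->|xy] := eqVneq x y; first by rewrite !dec_z // /deco e3 partner_dec.
have [E|xY] := eqVneq (partner d x) y.
  rewrite -(hK x) E; have := dec_z' wz y b; rewrite partner_dec // => ->.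
  by rewrite dec_z' // /deco e4.
rewrite partner_dec // in xZ.
have -> : dec y b d x = d x by rewrite dec_same.
by rewrite dec_same ?partner_dec // dec_same.
Qed.

Lemma dec_surg_comm d z a r r' : wf_strings d -> r != r' -> partner d r != r' ->
  (forall x, x \in [:: z; partner d z] -> x \notin [:: r; r'; partner d r; partner d r']) ->
  dec z a (surg r r' d) = surg r r' (dec z a d).
Proof.
move=> wd rr' hr0 dis; have [hf hK hr] := wf_stringsP _ wd.
have wr : wf_strings (surg r r' d) by apply: wf_surg.
have wz := wf_dec wd z a.
have /dis : z \in [:: z; partner d z] by rewrite !inE eqxx.
rewrite !inE !negb_or => /and4P[z1 z2 z3 z4].
have /dis : partner d z \in [:: z; partner d z] by rewrite !inE eqxx orbT.
rewrite !inE !negb_or => /and4P[z5 z6 z7 z8].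
have e1 : surg r r' d z = d z by rewrite surg_same.
have e2 : surg r r' d (partner d z) = d (partner d z) by rewrite surg_same // hK.
have p1 : partner (surg r r' d) z = partner d z by rewrite /partner e1.
apply: dec_unique => //; rewrite ?p1 /deco ?e1 ?e2.
- by rewrite surg_same // ?partner_dec // dec_z.
- by rewrite surg_same // ?partner_dec // ?hK // dec_z'.
move=> x xz xZ.
have f1 y : y \in [:: r; r'; partner d r; partner d r'] -> dec z a d y = d y.
  move=> hy; rewrite dec_same //; first by move: hy; rewrite !inE => /or4P[] /eqP->; rewrite eq_sym.
  rewrite -(inj_eq (inv_inj hK)) hK.
  by move: hy; rewrite !inE => /or4P[] /eqP->; rewrite eq_sym.
have k1 : r \in [:: r; r'; partner d r; partner d r'] by rewrite !inE eqxx.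
have k2 : r' \in [:: r; r'; partner d r; partner d r'] by rewrite !inE eqxx !orbT.
have k3 : partner d r \in [:: r; r'; partner d r; partner d r'] by rewrite !inE eqxx !orbT.
have k4 : partner d r' \in [:: r; r'; partner d r; partner d r'] by rewrite !inE eqxx !orbT.
have Pr y : partner (dec z a d) y = partner d y by rewrite partner_dec.
have [E|e1'] := eqVneq x r; first by rewrite E !surg_p.
have [E|e2'] := eqVneq x r'; first by rewrite E !surg_p'.
have [E|e3] := eqVneq x (partner d r).
  rewrite E (surg_join wd) // -(Pr r) (surg_join wz) ?Pr // /deco !f1 //.
have [E|e4] := eqVneq x (partner d r').
  rewrite E (surg_join' wd) // -(Pr r') (surg_join' wz) ?Pr // /deco !f1 //.
have f3 : partner d x != r by rewrite -(inj_eq (inv_inj hK)) hK.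
have f4 : partner d x != r' by rewrite -(inj_eq (inv_inj hK)) hK.
rewrite !surg_same ?Pr // dec_same //.
by move: xZ; rewrite /partner surg_same.
Qed.

Lemma surg_dec_cup d p p' a : wf_strings d -> p != p' -> d p = (p', [bseq]) ->
  surg p p' (dec p a d) = d.
Proof.
move=> wd pp' E; have [hf hK hr] := wf_stringsP _ wd.
have Pp : partner d p = p' by rewrite /partner E.
apply: surg_unique; rewrite ?partner_dec ?Pp ?eqxx //; first exact: wf_dec.
  rewrite [d p']surjective_pairing; congr (_, _); first by rewrite -[LHS]/(partner d p') -Pp hK.
  by apply: word_eq; rewrite -[LHS]/(deco d p' : seq blob) -Pp hr /deco E.
by move=> x h1 h2; rewrite partner_dec // => h3 h4; rewrite dec_same.
Qed.

End DecAlgebra.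

Section Commutation.
Context {n : nat} (hn : (0 < n)%N).

(** Commutation is checked on the identity diagram, where the strings at distant nodes are disjoint,
    so that [surg_comm] and its variants apply. On the module it follows by compatibility with
    products, in [op_comm]; this avoids discussing how the strings of a half-diagram meet. *)
Lemma topop_comm i j : (i.+1 < j)%N -> (j <= n)%N ->
  topop hn i (topop hn j (id_diag n)) = topop hn j (topop hn i (id_diag n)).
Proof.
move=> ij jn.
have id1 u : partner (id_diag n) (inl u) = inr u by rewrite /partner ffunE.
have wi := @wf_id n.
have ordne u v : (u < n)%N -> (v < n)%N -> u <> v -> ord_of hn u != ord_of hn v.
  by move=> hu hv; apply: contra_not_neq => /(congr1 val) /=; rewrite !val_ord_of.
have ine (u v : 'I_n) : u != v -> (inl u : node n n) != inl v by apply: contraNneq => -[->].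
have ine' (u v : 'I_n) : u != v -> (inr u : node n n) != inr v by apply: contraNneq => -[->].
rewrite /topop; have -> : (j == 0%N) = false by lia.
case: (eqVneq i 0%N) => [i0|i0]; case: (eqVneq j n) => [jE|jE].
- by apply: dec_comm; rewrite ?id1 // ine // ordne; lia.
- apply: dec_surg_comm; rewrite ?id1 //; first by rewrite ine // ordne; lia.
  move=> x; rewrite !inE => /orP[] /eqP->; rewrite !negb_or /= ?(inj_eq (@inl_inj _ _)) ?(inj_eq (@inr_inj _ _));
  by rewrite !ordne //; lia.
- have -> : (i == n) = false by lia.
  apply/esym; apply: dec_surg_comm; rewrite ?id1 //; first by rewrite ine // ordne; lia.
  move=> x; rewrite !inE => /orP[] /eqP->; rewrite !negb_or /= ?(inj_eq (@inl_inj _ _)) ?(inj_eq (@inr_inj _ _));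
  by rewrite !ordne //; lia.
have -> : (i == n) = false by lia.
apply: surg_comm; rewrite ?id1 //; try by rewrite ine // ordne; lia.
move=> x; rewrite !inE => /or4P[] /eqP->; rewrite !negb_or /= ?(inj_eq (@inl_inj _ _)) ?(inj_eq (@inr_inj _ _));
  by rewrite !ordne //; lia.
Qed.

End Commutation.

(** * The generators on the cell module *)

Section Relations.
Context {k : fieldType} (P : blob_params k) {n m : nat} {eps1 eps2 : int}.
Hypotheses (hn : (0 < n)%N) (hlab : is_label n m eps1 eps2).
Notation hdiag := (hdiag n m eps1 eps2).
Notation cellmod := (cellmod k n m eps1 eps2).
Notation is_half := (is_half eps1 eps2).
Notation dead := (dead eps1 eps2).
Notation vb := (cbasis (k := k) (n := n) (m := m) (eps1 := eps1) (eps2 := eps2)).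
Implicit Types (v : cellmod) (h : hdiag).

Definition op (i : nat) : cellmod -> cellmod := act P (be (inord i : 'I_n.+1)).

HB.instance Definition _ i := GRing.Linear.on (op i).

Lemma op_basis i h : (i <= n)%N -> op i (vb h) =
  if insub (topop hn i (val h)) is Some h' then topcf P hn i (val h) *: (vb h') else 0.
Proof. by move=> hi; rewrite /op act_bbasis_cbasis /= inordK // actb_e. Qed.

Lemma op_half i h h' : (i <= n)%N -> topop hn i (val h) = val h' ->
  op i (vb h) = topcf P hn i (val h) *: (vb h').
Proof. by move=> hi E; rewrite op_basis // E valK. Qed.

Lemma op_case i h : (i <= n)%N -> op i (vb h) = 0 \/
  exists2 h', val h' = topop hn i (val h) & op i (vb h) = topcf P hn i (val h) *: (vb h').
Proof.
move=> hi; rewrite op_basis //; case: insubP => [h' _ E|_]; last by left.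
by right; exists h'.
Qed.

Lemma cell_ext (f g : {linear cellmod -> cellmod}) : (forall h, f (vb h) = g (vb h)) ->
  forall v, f v = g v.
Proof.
move=> E v; rewrite (cellE v) !linear_sum; apply: eq_bigr => h _; by rewrite !linearZ E.
Qed.

Definition cup_at i l (d : ddiag n l) := d (inl (ord_of hn i.-1)) = (inl (ord_of hn i), [bseq]).

Let ordne (u w : nat) : (u < n)%N -> (w < n)%N -> u <> w -> ord_of hn u != ord_of hn w.
Proof. by move=> hu hw; apply: contra_not_neq => /(congr1 val) /=; rewrite !val_ord_of. Qed.

Let inlne l (u w : 'I_n) : u != w -> (inl u : node n l) != inl w.
Proof. by apply: contraNneq => -[->]. Qed.

Lemma topopE i l (d : ddiag n l) : (0 < i < n)%N ->
  topop hn i d = surg (inl (ord_of hn i.-1)) (inl (ord_of hn i)) d.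
Proof. by move=> /andP[i0 ine]; rewrite /topop; case: eqP => [|_]; [lia|case: eqP => [|_//]; lia]. Qed.

Lemma topcfE i l (d : ddiag n l) : (0 < i < n)%N ->
  topcf P hn i d = cup_coef (ord_of hn i.-1) (ord_of hn i) P d.
Proof. by move=> /andP[i0 ine]; rewrite /topcf; case: eqP => [|_]; [lia|case: eqP => [|_//]; lia]. Qed.

Lemma cup_at_topop i l (d : ddiag n l) : (0 < i < n)%N -> cup_at i (topop hn i d).
Proof. by move=> hi; rewrite /cup_at topopE // surg_p. Qed.

Lemma cup_at' i l (d : ddiag n l) : wf_strings d -> (0 < i < n)%N -> cup_at i d ->
  d (inl (ord_of hn i)) = (inl (ord_of hn i.-1), [bseq]).
Proof.
move=> /wf_stringsP[_ hK hr] hi E; have Ep : partner d (inl (ord_of hn i.-1)) = inl (ord_of hn i) by rewrite /partner E.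
rewrite [LHS]surjective_pairing -/(partner d _) -/(deco d _) -Ep hK; congr (_, _).
by apply: word_eq; rewrite hr /deco E.
Qed.

Lemma cup_coefC l (d : ddiag n l) a b : wf_strings d -> cup_coef a b P d = cup_coef b a P d.
Proof.
move=> /wf_stringsP[hf hK hr]; rewrite /cup_coef.
have [E|ne] := eqVneq (partner d (inl a)) (inl b).
  by rewrite -E hK eqxx /loopw hr !count_rev.
rewrite ifN; last by apply: contraNneq ne => E; rewrite -E hK.
by rewrite -coef_rev rev_cat -!hr hK.
Qed.

(** Moving an undecorated cup keeps every line together with its word; at most the upper end of a
    line changes, to the freed node [a]. *)
Lemma surg_not_dead h a b c : val h (inl a) = (inl b, [bseq]) -> c != a -> c != b ->
  ~ dead (surg (inl b) (inl c) (val h)).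
Proof.
move=> ha ca cb; have hh := valP h; have wd := half_wf hh; have rd := half_reduced hh.
have [hf hK hr] := wf_stringsP _ wd.
have ca' : inl c != inl a :> node n m.+1 by apply: inlne.
have cb' : inl c != inl b :> node n m.+1 by apply: inlne.
have V x : (exists i, surg (inl b) (inl c) (val h) (inr x) = (inl i, deco (val h) (inr x))).
  have [E|ne] := eqVneq (inr x) (partner (val h) (inl c)).
    by exists a; rewrite E (zigzag_C wd rd ha).
  have [i Ei] := half_bottom hh x; exists i; rewrite (zigzag_same wd ha) //.
    by rewrite [LHS]surjective_pairing -/(partner _ _) Ei.
  by rewrite -(inj_eq (inv_inj hK)) hK.
move=> [[x [y]]|[x [E1]]].
  by rewrite /partner; have [i ->] := V x.
by rewrite /deco; have [i -> /=] := V x; rewrite (half_line hh) E1.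
Qed.

(** Used twice: for $e_ie_je_i=e_i$, since $e_ih$ has an undecorated cup at $i$, and for the
    reversible moves of cups in the generation argument. No scalar appears, because the words are
    reduced and that of the cup is empty. *)
Lemma zigzag i j h : (0 < i < n)%N -> (0 < j < n)%N -> (j == i.+1) || (i == j.+1) ->
  cup_at i (val h) -> exists h2, [/\ val h2 = topop hn j (val h), op j (vb h) = (vb h2) & op i (vb h2) = (vb h)].
Proof.
move=> hi hj ij E; have hh := valP h; have wd := half_wf hh; have rd := half_reduced hh.
have [hf hK hr] := wf_stringsP _ wd.
have E' := cup_at' wd hi E; rewrite /cup_at in E.
have [hi' hj'] : (i <= n)%N /\ (j <= n)%N by lia.
(* a - b is the cup and c the third node *)
have [a [b [c [ha [Ej Ei] [Cj Ci] [ca cb]]]]] : exists a b c, [/\ val h (inl a) = (inl b, [bseq]),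
    topop hn j (val h) = surg (inl b) (inl c) (val h) /\
    (forall d : ddiag n m.+1, wf_strings d -> topop hn i d = surg (inl a) (inl b) d),
    topcf P hn j (val h) = cup_coef b c P (val h) /\
    (forall d : ddiag n m.+1, wf_strings d -> topcf P hn i d = cup_coef a b P d) & c != a /\ c != b].
  case/orP: ij => /eqP Eij.
    exists (ord_of hn i.-1), (ord_of hn i), (ord_of hn j); split=> //.
    - by split=> [|d _]; rewrite topopE // Eij.
    - by split=> [|d _]; rewrite topcfE // Eij.
    by split; apply: ordne; lia.
  exists (ord_of hn i), (ord_of hn i.-1), (ord_of hn j.-1); split=> //.
  - split=> [|d wd']; rewrite topopE // surgC //.
    + by rewrite Eij.
    + by apply: inlne; apply: ordne; lia.
    + by apply: inlne; apply: ordne; lia.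
  - split=> [|d wd']; rewrite topcfE // cup_coefC //.
    by rewrite Eij.
  by split; apply: ordne; lia.
have ca' : inl c != inl a :> node n m.+1 by apply: inlne.
have cb' : inl c != inl b :> node n m.+1 by apply: inlne.
have nd := surg_not_dead ha ca cb.
case: (half_topop hlab hn hj' hh) => [|hd2]; first by rewrite Ej.
have pa : partner (val h) (inl a) = inl b by rewrite /partner ha.
have pb : partner (val h) (inl b) = inl a by rewrite -pa hK.
have wb : deco (val h) (inl b) = [::] :> seq blob by rewrite -pa hr /deco ha.
have wa : deco (val h) (inl a) = [::] :> seq blob by rewrite /deco ha.
have wbc : inl b != inl c :> node n m.+1 by rewrite eq_sym.
have wab : inl a != inl b :> node n m.+1 by rewrite -pa eq_sym hf.
have w2 : wf_strings (surg (inl b) (inl c) (val h)) by apply: wf_surg.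
exists (Sub _ hd2); split=> //.
  rewrite (@op_half j h (Sub _ hd2)) // Cj /cup_coef pb ifN; last by rewrite eq_sym.
  by rewrite wa red_coef_id ?scale1r //; apply: rd.
rewrite (@op_half i (Sub _ hd2) h) //; last by rewrite /= Ej Ei // (zigzagK wd rd ha).
rewrite /= Ej Ci // /cup_coef.
have Ea : partner (surg (inl b) (inl c) (val h)) (inl a) = partner (val h) (inl c).
  by rewrite /partner (zigzag_a wd rd ha).
rewrite Ea ifN; last by rewrite -pa (inj_eq (inv_inj hK)).
rewrite [deco _ (partner _ _)](_ : _ = deco (val h) (partner (val h) (inl c))); last first.
  by rewrite /deco (zigzag_C wd rd ha).
rewrite [deco _ (inl b)](_ : _ = [bseq]); last by rewrite /deco zigzag_b.
by rewrite cats0 red_coef_id ?scale1r //; apply: rd.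
Qed.

Lemma cup_at_op i h : (0 < i < n)%N -> cup_at i (val h) -> op i (vb h) = delta P *: (vb h).
Proof.
move=> hi E; have hh := valP h; have wd := half_wf hh.
have ne : inl (ord_of hn i.-1) != inl (ord_of hn i) :> node n m.+1 by apply: inlne; apply: ordne; lia.
rewrite (@op_half i h h); [|lia|by rewrite topopE // surg_id].
by rewrite topcfE // /cup_coef /partner E eqxx /loopw /deco E /loop_coef /= !expr0 !mul1r.
Qed.

Lemma op_sq i v : (0 < i < n)%N -> op i (op i v) = delta P *: op i v.
Proof.
move=> hi; move: v; apply: (cell_ext (f := op i \o op i) (g := delta P \*: op i)) => h /=.
have hin : (i <= n)%N by lia.
have [->|[h' E ->]] := op_case h hin.
  by rewrite linear0 scaler0.
rewrite linearZ /= cup_at_op //; last by rewrite E; apply: cup_at_topop.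
by rewrite !scalerA mulrC.
Qed.

Lemma op_tl i j v : (0 < i < n)%N -> (0 < j < n)%N -> (j == i.+1) || (i == j.+1) ->
  op i (op j (op i v)) = op i v.
Proof.
move=> hi hj ij; move: v; apply: (cell_ext (f := op i \o (op j \o op i)) (g := op i)) => h /=.
have hin : (i <= n)%N by lia.
have [->|[h' E ->]] := op_case h hin.
  by rewrite !linear0.
have [|h2 [_ E1 E2]] := zigzag (h := h') hi hj ij; first by rewrite E; apply: cup_at_topop.
by rewrite !linearZ /= E1 E2.
Qed.

Lemma e_diag_far u (w : 'I_n) : w <> u.-1 :> nat -> w <> u :> nat ->
  e_diag n u (inl w) = (inr w, [bseq]) /\ e_diag n u (inr w) = (inl w, [bseq]).
Proof.
move=> /eqP h1 /eqP h2; rewrite /e_diag; case: eqP => u0.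
  by rewrite u0 in h2; rewrite !ffunE (negbTE h2).
case: eqP => un; first by rewrite un in h1; rewrite !ffunE (negbTE h1).
have sw : swap_node u w = w by rewrite /swap_node (negbTE h1) (negbTE h2).
by rewrite !ffunE sw eqxx.
Qed.

Lemma topcf_far u w : (u <= n)%N -> (w <= n)%N -> (u.+1 < w)%N || (w.+1 < u)%N ->
  topcf P hn u (e_diag n w) = 1.
Proof.
move=> hu hw far.
have dn (x : 'I_n) : x = u :> nat \/ x = u.-1 :> nat ->
    deco (e_diag n w) (inl x) = [bseq] :> word /\ deco (e_diag n w) (inr x) = [bseq] :> word
    /\ partner (e_diag n w) (inl x) = inr x.
  move=> hx; have [] := @e_diag_far w x; [by lia|by lia|].
  by rewrite /deco /partner => -> ->.
rewrite /topcf; case: eqP => u0.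
  by have [|-> _] := dn (ord_of hn 0); rewrite ?val_ord_of ?u0 //; left.
case: eqP => un.
  by have [|-> _] := dn (ord_of hn n.-1); rewrite ?val_ord_of ?un //; [right|lia].
have [|e1 [e2 e3]] := dn (ord_of hn u.-1); first by rewrite val_ord_of; [right|lia].
have [|e4 _] := dn (ord_of hn u); first by rewrite val_ord_of; [left|lia].
by rewrite /cup_coef e3 /= e2 e4.
Qed.

Lemma op_comm i j v : (i.+1 < j)%N -> (j <= n)%N -> op i (op j v) = op j (op i v).
Proof.
move=> ij jn; have hi : (i <= n)%N by lia.
(* A generator has at most one blob on each string, which excludes the topological relation and
   words with two kinds of blobs. *)
have small u x : (u <= n)%N -> (size (deco (e_diag n u) x) <= 1)%N.
  move=> hu; rewrite /deco /e_diag; case: eqP => _; first by rewrite ffunE; case: x => y /=; case: ifP.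
  case: eqP => _; first by rewrite ffunE; case: x => y /=; case: ifP.
  by rewrite ffunE; case: x.
have wid := @wf_id n; have rid := @reducedd_id n.
have ge u : (u <= n)%N -> good eps1 eps2 (e_diag n u) (m := m).
  move=> hu; have := good_stack hlab hn hu (good_id eps1 eps2 hn (m := m)).
  rewrite /stack (stack0_e hn hu wid rid) -e_diagE //.
  rewrite (_ : topo _ = None) //; rewrite /topo; case: ifP => // _.
  rewrite /top_LR_arc; case: pickP => // -[x y] /and3P[_ _ /perm_size] /= E.
  by have := small u (inl x) hu; rewrite E.
have te u : (u <= n)%N -> @tamea k n m eps1 eps2 (be (inord u : 'I_n.+1)).
  move=> hu d; rewrite ffunE; have [-> _ /=|nd] := eqVneq d _; last by rewrite eqxx.
  by rewrite inordK //; apply: ge.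
rewrite /op -!(act_be_mul P hn hlab); [|exact: te|exact: te].
suff -> : bmul P (be (inord i : 'I_n.+1)) (be (inord j)) = bmul P (be (inord j)) (be (inord i)) by [].
have bb u w : (u <= n)%N -> (w <= n)%N -> bmul P (be (inord u : 'I_n.+1)) (be (inord w)) =
    stack_coef P (e_diag n (inord u : 'I_n.+1)) (e_diag n (inord w : 'I_n.+1)) *:
    bbasis (bstack (exist _ (e_diag n (inord u : 'I_n.+1)) (obtained_eP (inord u)))
                   (exist _ (e_diag n (inord w : 'I_n.+1)) (obtained_eP (inord w)))).
  move=> hu hw; rewrite bmul_be (bigD1 (exist _ (e_diag n (inord w : 'I_n.+1)) (obtained_eP (inord w)) : bdiag n)) //= ffunE eqxx mul1r.
  by rewrite big1 ?addr0 // => d hd; rewrite ffunE (negbTE hd) mul0r scale0r.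
rewrite (bb i j hi jn) (bb j i jn hi).
have [gi1 gi2 _ _] := ge i hi; have [gj1 gj2 _ _] := ge j jn.
have sE : stack0 (e_diag n i) (e_diag n j) = stack0 (e_diag n j) (e_diag n i).
  rewrite (stack0_e hn hi gj1 gj2) (stack0_e hn jn gi1 gi2) (e_diagE hn hi) (e_diagE hn jn).
  exact: topop_comm.
have cE : stack_coef P (e_diag n i) (e_diag n j) = stack_coef P (e_diag n j) (e_diag n i).
  have cc u w : (u <= n)%N -> (w <= n)%N -> (u.+1 < w)%N || (w.+1 < u)%N ->
      wf_strings (e_diag n w) -> reducedd (e_diag n w) -> stack0_coef P (e_diag n u) (e_diag n w) = 1.
    move=> hu hw far w1 w2; rewrite (stack0_coef_e P hn) ?topcf_far // => x y _ _ _.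
    by have := small w (inl x) hw; case: (deco _ _ : seq blob) => [|[] [|]].
  by rewrite /stack_coef sE !cc //; apply/orP; auto.
have -> : stack_coef P (e_diag n (inord i : 'I_n.+1)) (e_diag n (inord j : 'I_n.+1)) =
    stack_coef P (e_diag n (inord j : 'I_n.+1)) (e_diag n (inord i : 'I_n.+1)) by rewrite !inordK.
congr (_ *: bbasis _); apply: val_inj; rewrite /= !inordK //.
by rewrite /stack sE.
Qed.

Lemma half_arc_dec h z x a : partner (val h) (inl z) = inl x ->
  ~ dead (dec (inl z) a (val h)).
Proof.
move=> E; have hh := valP h; have wd := half_wf hh; have [hf hK hr] := wf_stringsP _ wd.
have V y : dec (inl z) a (val h) (inr y) = val h (inr y).
  by apply: dec_same => //; apply/eqP => /(canRL hK); rewrite E.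
move=> hd; apply: (half_not_dead hh).
case: hd => [[y [y']]|[y [E1]]].
  by rewrite /partner V => E'; left; exists y, y'.
by rewrite /deco V => E'; right; exists y.
Qed.

Lemma topop0 l (d : ddiag n l) : topop hn 0 d = dec (inl (ord_of hn 0)) bL d.
Proof. by []. Qed.

Lemma topopn l (d : ddiag n l) : topop hn n d = dec (inl (ord_of hn n.-1)) bR d.
Proof. by rewrite /topop; case: eqP => [|_]; [lia|rewrite eqxx]. Qed.

Lemma topcf0 l (d : ddiag n l) : topcf P hn 0 d = cons_coef P bL (deco d (inl (ord_of hn 0))).
Proof. by []. Qed.

Lemma topcfn l (d : ddiag n l) : topcf P hn n d = cons_coef P bR (deco d (inl (ord_of hn n.-1))).
Proof. by rewrite /topcf; case: eqP => [|_]; [lia|rewrite eqxx]. Qed.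

Lemma deco_dec_z l (d : ddiag n l) z a : wf_strings d ->
  deco (dec z a d) z = red_word (a :: deco d z).
Proof. by move=> wd; rewrite /deco dec_z. Qed.

Lemma op_0 v : op 0 (op 0 v) = deltaL P *: op 0 v.
Proof.
move: v; apply: (cell_ext (f := op 0 \o op 0) (g := deltaL P \*: op 0)) => h /=.
have hh := valP h; have wd := half_wf hh; have rd := half_reduced hh.
have [->|[h' E ->]] := op_case h (leq0n n); first by rewrite linear0 scaler0.
have T : topop hn 0 (val h') = val h' by rewrite E !topop0 dec_dup.
rewrite linearZ /= (op_half (leq0n n) T) (topcf0 (val h')) E topop0 deco_dec_z //.
by rewrite cons_coef_dup ?scalerA 1?mulrC //; apply: rd.
Qed.

Lemma op_n v : op n (op n v) = deltaR P *: op n v.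
Proof.
move: v; apply: (cell_ext (f := op n \o op n) (g := deltaR P \*: op n)) => h /=.
have hh := valP h; have wd := half_wf hh; have rd := half_reduced hh.
have [->|[h' E ->]] := op_case h (leqnn n); first by rewrite linear0 scaler0.
have T : topop hn n (val h') = val h' by rewrite E !topopn dec_dup.
rewrite linearZ /= (op_half (leqnn n) T) (topcfn (val h')) E topopn deco_dec_z //.
by rewrite cons_coef_dup ?scalerA 1?mulrC //; apply: rd.
Qed.

Lemma op_dec i z x a h : (i <= n)%N -> topop hn i (val h) = dec (inl z) a (val h) ->
  topcf P hn i (val h) = cons_coef P a (deco (val h) (inl z)) ->
  val h (inl z) = (inl x, [bseq]) ->
  exists h2, val h2 = dec (inl z) a (val h) /\ op i (vb h) = vb h2.
Proof.
move=> hi Et Ec E; have hh := valP h.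
have nd : ~ dead (dec (inl z) a (val h)) by apply: (@half_arc_dec _ _ x); rewrite /partner E.
case: (half_topop hlab hn hi hh) => [|h2]; first by rewrite Et.
rewrite Et in h2; exists (Sub _ h2); split=> //.
by rewrite (@op_half i h (Sub _ h2)) // Ec /deco E scale1r.
Qed.

(** The first $e_1$ creates an undecorated cup at the first two nodes, $e_0$ puts an $L$ on it, and
    the second $e_1$ closes a loop carrying this $L$. *)
Lemma op_101 v : (1 < n)%N -> op 1 (op 0 (op 1 v)) = kappaL P *: op 1 v.
Proof.
move=> n1; have h1 : (0 < 1 < n)%N by [].
move: v; apply: (cell_ext (f := op 1 \o (op 0 \o op 1)) (g := kappaL P \*: op 1)) => h /=.
have [->|[h' E ->]] := op_case h hn; first by rewrite !linear0 ?scaler0.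
have hh := valP h'; have wd := half_wf hh.
have := cup_at_topop (val h) h1; rewrite -E => C.
have [h2 [E2 Eo]] := op_dec (leq0n n) (topop0 _) (topcf0 _) C.
have ne : inl (ord_of hn 0) != inl (ord_of hn 1) :> node n m.+1 by apply: inlne; apply: ordne; lia.
rewrite !linearZ /= Eo (@op_half 1 h2 h') //; last first.
  by rewrite topopE // E2 surg_dec_cup.
rewrite !scalerA; congr (_ *: _); congr (_ * _).
rewrite topcfE // /cup_coef E2 partner_dec // /partner C eqxx /loopw /deco dec_z //= /deco C.
by rewrite /loop_coef /= !expr0 !mul1r.
Qed.

Lemma op_n1n v : (1 < n)%N -> op n.-1 (op n (op n.-1 v)) = kappaR P *: op n.-1 v.
Proof.
move=> n1; have h1 : (0 < n.-1 < n)%N by lia.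
have hn1 : (n.-1 <= n)%N by lia.
move: v; apply: (cell_ext (f := op n.-1 \o (op n \o op n.-1)) (g := kappaR P \*: op n.-1)) => h /=.
have [->|[h' E ->]] := op_case h hn1; first by rewrite !linear0 ?scaler0.
have hh := valP h'; have wd := half_wf hh.
have := cup_at_topop (val h) h1; rewrite -E => C.
have C' := cup_at' wd h1 C.
have [h2 [E2 Eo]] := op_dec (leqnn n) (topopn _) (topcfn _) C'.
have ne : inl (ord_of hn n.-1.-1) != inl (ord_of hn n.-1) :> node n m.+1 by apply: inlne; apply: ordne; lia.
rewrite !linearZ /= Eo (@op_half n.-1 h2 h') //; last first.
  rewrite topopE // E2 surgC // ?wf_dec // surg_dec_cup //.
  by rewrite eq_sym.
rewrite !scalerA; congr (_ *: _); congr (_ * _).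
rewrite topcfE // cup_coefC ?E2 ?wf_dec // /cup_coef partner_dec // /partner C' eqxx /loopw /deco dec_z //= /deco C'.
by rewrite /loop_coef /= !expr0 !mul1r.
Qed.

End Relations.

(** * Words in the generators as operators *)

Section Geval.
Context {k : fieldType} (q Q1 Q2 kLR : k) {n m : nat} {eps1 eps2 : int}.
Hypotheses (hn : (0 < n)%N) (hlab : is_label n m eps1 eps2).
Notation P := (qparams q Q1 Q2 kLR).
Notation cellmod := (cellmod k n m eps1 eps2).
Notation tame := (@tamea k n m eps1 eps2).
Implicit Types (v : cellmod) (a b : sblob k n).

Lemma bmulDl c a b x : bmul P (c *: a + b) x = c *: bmul P a x + bmul P b x.
Proof.
rewrite /bmul scaler_sumr -big_split; apply: eq_bigr => d _ /=.
rewrite scaler_sumr -big_split; apply: eq_bigr => d' _ /=.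
by rewrite !ffunE scalerA -scalerDl; congr (_ *: _); rewrite /GRing.scale /=; ring.
Qed.

(** [stack] also applies the topological relation, so this relies on [topo] being [None] on the
    diagrams of [a]. *)
Lemma bmul_bone a : tame a -> bmul P (bone : sblob k n) a = a.
Proof.
move=> ta; rewrite /bmul (bigD1 (exist _ (id_diag n) (obtained_idP n) : bdiag n)) //=.
rewrite [X in _ + X]big1 ?addr0 => [|d hd]; last first.
  by rewrite big1 // => d' _; rewrite ffunE (negbTE hd) !mul0r scale0r.
have E d : ((bone : sblob k n) (exist _ (id_diag n) (obtained_idP n)) * a d *
     stack_coef P (id_diag n) (val d)) *:
     bbasis (bstack (exist _ (id_diag n) (obtained_idP n)) d) = a d *: bbasis d.
  rewrite ffunE eqxx mul1r; have [->|an] := eqVneq (a d) 0; first by rewrite mul0r !scale0r.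
  have [wd rd td _] := ta d an.
  rewrite /stack_coef stack0_coef_id // stack0_id // td !mulr1; congr (_ *: bbasis _).
  by apply: val_inj; rewrite /= /stack stack0_id // td.
rewrite (eq_bigr _ (fun d _ => E d)); apply/ffunP => d.
rewrite sum_ffunE (bigD1 d) //= !ffunE eqxx [X in _ + X]big1 ?addr0 => [|d' hd'].
  by rewrite /GRing.scale /= mulr1.
by rewrite !ffunE eq_sym (negbTE hd') scaler0.
Qed.

Lemma tamea_lin c a b : tame a -> tame b -> tame (c *: a + b).
Proof.
move=> ta tb d; rewrite !ffunE => h; have [a0|/ta//] := eqVneq (a d) 0.
by apply: tb; move: h; rewrite a0 scaler0 add0r.
Qed.

Lemma tamea_be i a : tame a -> tame (bmul P (be i) a).
Proof.
move=> ta d; rewrite bmul_be sum_ffunE => h.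
case: (pselect (exists2 d', a d' != 0 & d = bstack (exist _ (e_diag n i) (obtained_eP i)) d')).
  by move=> [d' /ta gd' ->] /=; apply: good_stack => //; rewrite -ltnS.
move=> no; case/eqP: h; apply: big1 => d' _; rewrite !ffunE.
have [->|an] := eqVneq (a d') 0; first by rewrite mul0r scale0r.
case: eqP => [E|_]; last by rewrite scaler0.
by case: no; exists d'.
Qed.

Lemma tamea_bone : tame bone.
Proof.
move=> d; rewrite ffunE; have [-> _ /=|nd] := eqVneq d _; last by rewrite eqxx.
exact: good_id.
Qed.

Lemma act_bone v : act P (bone : sblob k n) v = v.
Proof.
rewrite act_bbasis [RHS]cellE; apply: eq_bigr => h _; congr (_ *: _).
have hh := valP h; rewrite (@actb_half _ _ _ _ _ _ (id_diag n) h h).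
  by rewrite stack0_coef_id ?scale1r //; [exact: half_wf hh|exact: half_reduced hh].
by rewrite stack0_id //; [exact: half_wf hh|exact: half_reduced hh].
Qed.

Lemma gE (i : 'I_n.+1) s : exists c c', g q Q1 Q2 i s = c *: be i + c' *: bone :> sblob k n.
Proof.
rewrite /g; case: eqP => _.
  by exists (- (q ^ s * Q1 ^ s - q ^ (- s) * Q1 ^ (- s))), (Q1 ^ s); rewrite scaleNr addrC.
case: eqP => _.
  by exists (- (q ^ s * Q2 ^ s - q ^ (- s) * Q2 ^ (- s))), (Q2 ^ s); rewrite scaleNr addrC.
by exists 1, (- q ^ (- s)); rewrite scale1r scaleNr.
Qed.

Lemma bmul_g i s a : tame a -> tame (bmul P (g q Q1 Q2 i s) a) /\
  forall v, act P (bmul P (g q Q1 Q2 i s) a) v = act P (g q Q1 Q2 i s) (act P a v).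
Proof.
move=> ta; have [c [c' ->]] := gE i s.
have E : bmul P (c *: be i + c' *: bone) a = c *: bmul P (be i) a + c' *: a.
  rewrite bmulDl; congr (_ + _).
  have := bmulDl c' bone 0 a; rewrite addr0 => ->.
  rewrite (_ : bmul P 0 a = 0) ?addr0 ?bmul_bone //.
  by rewrite /bmul big1 // => d _; rewrite big1 // => d' _; rewrite ffunE !mul0r scale0r.
split; rewrite E.
  by apply: tamea_lin; [apply: tamea_be|rewrite -[_ *: _]addr0; apply: tamea_lin => // d; rewrite ffunE eqxx].
by move=> v; rewrite !actD !actZ (act_be_mul P hn hlab) // act_bone.
Qed.

Definition gop (i : nat) (s : int) : cellmod -> cellmod := act P (g q Q1 Q2 (inord i : 'I_n.+1) s).

Lemma gopE i s v : (i <= n)%N -> gop i s v =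
  if i == 0%N then Q1 ^ s *: v - (q ^ s * Q1 ^ s - q ^ (- s) * Q1 ^ (- s)) *: op P i v
  else if i == n then Q2 ^ s *: v - (q ^ s * Q2 ^ s - q ^ (- s) * Q2 ^ (- s)) *: op P i v
  else op P i v - q ^ (- s) *: v.
Proof.
move=> hi.
rewrite /gop /g inordK //; case: ifP => _.
  by rewrite -scaleNr actD !actZ act_bone scaleNr.
case: ifP => _; first by rewrite -scaleNr actD !actZ act_bone scaleNr.
by rewrite -scaleNr actD !actZ act_bone scaleNr.
Qed.

(** The right bracketing matters: each step multiplies on the left, by one generator, an element
    that is already a combination of good diagrams. *)
Lemma act_geval (w : gword) v :
  act P (geval q Q1 Q2 kLR n w) v = foldr (fun x u => gop x.1 x.2 u) v w.
Proof.
suff [] : tame (geval q Q1 Q2 kLR n w) /\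
   act P (geval q Q1 Q2 kLR n w) v = foldr (fun x u => gop x.1 x.2 u) v w by [].
elim: w => [|[i s] w [tw IH]] /=; first by split; [exact: tamea_bone|exact: act_bone].
have [t1 E] := bmul_g (inord i) s tw; split=> //.
by rewrite E IH.
Qed.

End Geval.

(* Linear identities between vectors are proved by reflection: both sides are
   reified over a list of atoms, and the coefficients are compared one by one. *)
Section Lterm.
Context {k : nzRingType} {V : lmodType k}.

Inductive lterm := LAtom of nat | LZero | LAdd of lterm & lterm | LOpp of lterm | LScale of k & lterm.

Fixpoint leval (e : seq V) (t : lterm) : V :=
  match t with
  | LAtom i => e`_i
  | LZero => 0
  | LAdd a b => leval e a + leval e b
  | LOpp a => - leval e a
  | LScale c a => c *: leval e a
  end.

Fixpoint lcoef (i : nat) (t : lterm) : k :=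
  match t with
  | LAtom j => if Nat.eqb i j then 1 else 0
  | LZero => 0
  | LAdd a b => lcoef i a + lcoef i b
  | LOpp a => - lcoef i a
  | LScale c a => c * lcoef i a
  end.

Fixpoint latoms (N : nat) (t : lterm) : bool :=
  match t with
  | LAtom j => (j < N)%N
  | LZero => true
  | LAdd a b => latoms N a && latoms N b
  | LOpp a | LScale _ a => latoms N a
  end.

Fixpoint leqs (N : nat) (t t' : lterm) : Prop :=
  if N is N'.+1 then lcoef N' t = lcoef N' t' /\ leqs N' t t' else True.

Lemma levalE e t : latoms (size e) t -> leval e t = \sum_(i < size e) lcoef i t *: e`_i.
Proof.
elim: t => [j|_|a IHa b IHb /andP[ha hb]|a IH ha|c a IH ha] /=.
- move=> hj; rewrite (bigD1 (Ordinal hj)) //= PeanoNat.Nat.eqb_refl scale1r big1 ?addr0 // => i ne.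
  case E: (Nat.eqb i j); last by rewrite scale0r.
  by case/eqP: ne; apply: val_inj; apply/PeanoNat.Nat.eqb_eq.
- by rewrite big1 // => i _; rewrite scale0r.
- by rewrite IHa // IHb // -big_split; apply: eq_bigr => i _; rewrite scalerDl.
- by rewrite IH // -sumrN; apply: eq_bigr => i _; rewrite scaleNr.
- by rewrite IH // scaler_sumr; apply: eq_bigr => i _; rewrite scalerA.
Qed.

Lemma leval_eq e t t' : latoms (size e) t -> latoms (size e) t' ->
  leqs (size e) t t' -> leval e t = leval e t'.
Proof.
move=> h h' E; rewrite !levalE //; apply: eq_bigr => i _; congr (_ *: _).
elim: (size e) (i : nat) (ltn_ord i) E => [|N IH] j //=; rewrite ltnS leq_eqVlt.
by case/predU1P=> [-> []|hj []] // _; apply: IH.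
Qed.
End Lterm.

Ltac lindex a e := lazymatch e with
  | ?b :: ?e' => match constr:(Set) with
    | _ => let _ := match constr:(Set) with _ => unify a b end in constr:(0%N)
    | _ => let j := lindex a e' in constr:(j.+1)
    end
  end.
Ltac lcollect e t := lazymatch t with
  | GRing.add ?a ?b => let e := lcollect e a in lcollect e b
  | GRing.opp ?a => lcollect e a
  | GRing.scale _ ?a => lcollect e a
  | GRing.zero => e
  | _ => match constr:(Set) with
    | _ => let _ := lindex t e in e
    | _ => constr:(t :: e)
    end
  end.
Ltac lreify k e t := lazymatch t with
  | GRing.add ?a ?b => let a := lreify k e a in let b := lreify k e b in constr:(@LAdd k a b)
  | GRing.opp ?a => let a := lreify k e a in constr:(@LOpp k a)
  | GRing.scale ?c ?a => let a := lreify k e a in constr:(@LScale k c a)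
  | GRing.zero => constr:(@LZero k)
  | _ => let j := lindex t e in constr:(@LAtom k j)
  end.
(* Plain rewriting with linearZ would not terminate, as scaling is itself linear. *)
Ltac lexp := rewrite /=; repeat match goal with
  | |- context [GRing.Linear.sort ?f (GRing.add ?a ?b)] => rewrite (linearD f a b)
  | |- context [GRing.Linear.sort ?f (GRing.opp ?a)] => rewrite (linearN f a)
  | |- context [GRing.Linear.sort ?f (GRing.scale ?c ?a)] => rewrite (linearZ_LR f c a)
  | |- context [GRing.Linear.sort ?f GRing.zero] => rewrite (linear0 f)
  end; rewrite /=.
Ltac lmod_with k := lexp;
  lazymatch goal with |- @eq ?V ?a ?b =>
    let e := lcollect (@nil V) a in let e := lcollect e b in
    let a := lreify k e a in let b := lreify k e b in
    apply: (@leval_eq k _ e a b isT isT);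
    cbv beta iota delta [leqs lcoef Nat.eqb size]; repeat (split; first try by ring)
  end.

(** * Centrality *)

Section Commute.
Context {V : Type}.
Definition com (f h : V -> V) := forall v, f (h v) = h (f v).

Lemma com_sym f h : com f h -> com h f. Proof. by move=> c v; rewrite c. Qed.
Lemma com_comp f h h' : com f h -> com f h' -> com f (fun v => h (h' v)).
Proof. by move=> c c' v; rewrite c c'. Qed.
Lemma com_inv f h hi : cancel h hi -> cancel hi h -> com f h -> com f hi.
Proof. by move=> K Ki c v; rewrite -[LHS]K -c Ki. Qed.
End Commute.

Section Hecke.
Context {k : fieldType} {V : lmodType k} (n : nat) (q t u : k) (g gi : nat -> {linear V -> V}).
Hypothesis gK : forall i, (i <= n)%N -> cancel (g i) (gi i).
Hypothesis giK : forall i, (i <= n)%N -> cancel (gi i) (g i).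
Hypothesis skein : forall i v, (0 < i < n)%N -> g i v = gi i v + (q - q^-1) *: v.
Hypothesis g0E : forall v, gi 0%N v = t *: v - g 0%N v.
Hypothesis gnE : forall v, gi n v = u *: v - g n v.
Hypothesis g_comm : forall i j, (i.+1 < j <= n)%N -> com (g i) (g j).
Hypothesis braid : forall i v, (0 < i)%N -> (i.+1 < n)%N ->
  g i (g i.+1 (g i v)) = g i.+1 (g i (g i.+1 v)).
Hypothesis braid0 : forall v, g 0%N (g 1%N (g 0%N (g 1%N v))) = g 1%N (g 0%N (g 1%N (g 0%N v))).
Hypothesis braidn : forall v, g n (g n.-1 (g n (g n.-1 v))) = g n.-1 (g n (g n.-1 (g n v))).

Lemma gi_comm_l i j : (i.+1 < j <= n)%N -> com (gi i) (g j).
Proof.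
move=> h; apply: com_sym; apply: (com_inv (gK _) (giK _)); [lia|lia|].
by apply: com_sym; apply: g_comm.
Qed.

Lemma gi_comm_r i j : (i.+1 < j <= n)%N -> com (g i) (gi j).
Proof. by move=> h; apply: (com_inv (gK _) (giK _)); [lia|lia|apply: g_comm]. Qed.

Fixpoint Xd (d : nat) : {linear V -> V} :=
  if d is d'.+1 then (gi (n - d) \o (Xd d' \o g (n - d)))%FUN else g n.
Fixpoint Xid (d : nat) : {linear V -> V} :=
  if d is d'.+1 then (gi (n - d) \o (Xid d' \o g (n - d)))%FUN else gi n.

(* g_j^-1 ... g_(n-1)^-1 g_n g_(n-1) ... g_j *)
Definition hX j := Xd (n - j).
Definition hXi j := Xid (n - j).

Lemma XE j v : (j < n)%N -> hX j v = gi j (hX j.+1 (g j v)).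
Proof.
move=> h; rewrite /hX (_ : (n - j)%N = (n - j.+1).+1) /=; last by lia.
by rewrite (_ : (n - (n - j.+1).+1)%N = j) //; lia.
Qed.
Lemma XiE j v : (j < n)%N -> hXi j v = gi j (hXi j.+1 (g j v)).
Proof.
move=> h; rewrite /hXi (_ : (n - j)%N = (n - j.+1).+1) /=; last by lia.
by rewrite (_ : (n - (n - j.+1).+1)%N = j) //; lia.
Qed.
Lemma Xn : hX n = g n. Proof. by rewrite /hX subnn. Qed.
Lemma Xin : hXi n = gi n. Proof. by rewrite /hXi subnn. Qed.

Lemma down_ind (A : nat -> Prop) : A n -> (forall j, (j < n)%N -> A j.+1 -> A j) ->
  forall j, (j <= n)%N -> A j.
Proof.
move=> An h j jn; rewrite -(subKn jn); elim: (n - j)%N (leq_subr j n) => [|d IH] hd; first by rewrite subn0.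
by apply: h; [lia|rewrite (_ : (n - d.+1).+1 = n - d)%N; [apply: IH; lia|lia]].
Qed.

Lemma XK j : (j <= n)%N -> cancel (hX j) (hXi j) /\ cancel (hXi j) (hX j).
Proof.
move: j; apply: down_ind; first by rewrite Xn Xin; split; [apply: gK|apply: giK].
move=> j jn [h1 h2]; have jn' : (j <= n)%N by lia.
by split=> v; rewrite XE // XiE // giK // ?h1 ?h2 gK.
Qed.

(** Conjugation preserves the quadratic relation of $g_n$. *)
Lemma XXi j v : (j <= n)%N -> hXi j v = u *: v - hX j v.
Proof.
move=> jn; move: j jn v; apply: down_ind; first by move=> v; rewrite Xin Xn gnE.
move=> j jn IH v; rewrite XE // XiE // IH linearB linearZ /= gK //; lia.
Qed.

Lemma X_comm_lo i j : (i.+1 < j <= n)%N -> com (hX j) (g i).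
Proof.
case/andP=> ij jn; move: j jn ij; apply: down_ind.
  by move=> h; apply: com_sym; rewrite Xn; apply: g_comm; rewrite h leqnn.
move=> j jn IH h v; have hj : (i.+1 < j <= n)%N by lia.
by rewrite !(@XE j) // -(g_comm hj) IH 1?ltnW // -gi_comm_r.
Qed.

(** Unfolding [hX] reduces this to $i=j+1$. There the braid relation replaces $g_{j+1}$ by $g_j$,
    which passes through $X_{j+2}$ and is turned back into $g_{j+1}$ on the other side. *)
Lemma X_comm_hi i j : (0 < j < i)%N -> (i < n)%N -> com (hX j) (g i).
Proof.
move=> /andP[j0 ji] hi; have jn : (j <= n)%N by lia.
move: j jn j0 ji; apply: down_ind; first by lia.
move=> j jn IH j0 ji v; have [ij|ij] := ltnP j.+1 i.
  rewrite !(@XE j) // (@g_comm j i); last by lia.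
  by rewrite IH // gi_comm_l //; lia.
have Ei : i = j.+1 by lia.
rewrite Ei in hi *; rewrite !(@XE j) // !(@XE j.+1) // -braid //.
rewrite X_comm_lo; last by lia.
have [jn' jn''] : (j <= n)%N /\ (j.+1 <= n)%N by lia.
suff H w : gi j (gi j.+1 (g j w)) = g j.+1 (gi j (gi j.+1 w)) by rewrite H.
apply: (can_inj (gK jn')); apply: (can_inj (gK jn'')).
by rewrite giK // giK // -braid // giK // giK.
Qed.

(** The four-term relation of $g_{n-1}$ and $g_n$, with $X_{j+1}$ in the role of $g_n$. Conjugation
    by $g_jg_{j+1}$ takes the pair $X_{j+1},g_j$ to $X_{j+2},g_{j+1}$, which gives the inductive
    step. *)
Lemma X_braid j v : (0 < j < n)%N ->
  hX j.+1 (g j (hX j.+1 (g j v))) = g j (hX j.+1 (g j (hX j.+1 v))).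
Proof.
case/andP=> j0 jn; have jn' := ltnW jn; move: j jn' j0 jn v.
apply: down_ind => [|j jn IH j0 _ v]; first by lia.
have [E|j1] := eqVneq j.+1 n; first by rewrite E Xn -[j]/(j.+1.-1) E braidn.
have hj1 : (j.+1 < n)%N by lia.
have {}IH := IH isT hj1; rewrite !(@XE j.+1) //.
have [h0 h1 h2] : [/\ (j <= n)%N, (j.+1 <= n)%N & (j.+2 <= n)%N] by split; lia.
(* with a = g_j, h = g_(j+1): h a h^-1 = a^-1 h a *)
have conj w : g j.+1 (g j (gi j.+1 w)) = gi j (g j.+1 (g j w)).
  by rewrite -[in RHS](giK h1 w) -braid // gK.
have Xc w : hX j.+2 (g j w) = g j (hX j.+2 w) by rewrite X_comm_lo // ltnSn.
have Xci w : hX j.+2 (gi j w) = gi j (hX j.+2 w).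
  by rewrite -[LHS](gK h0) -Xc giK.
have e w : gi j.+1 (gi j (g j.+1 w)) = g j (gi j.+1 (gi j w)).
  apply: (can_inj (gK h1)); rewrite giK // conj; apply: (can_inj (gK h0)).
  by rewrite !giK.
by rewrite !conj !Xci -!Xc braid // IH e.
Qed.

Fixpoint hJ (i : nat) : {linear V -> V} :=
  if i is i'.+1 then (g i \o (hJ i' \o g i))%FUN else (hX 1 \o g 0)%FUN.
Fixpoint hJi (i : nat) : {linear V -> V} :=
  if i is i'.+1 then (gi i \o (hJi i' \o gi i))%FUN else (gi 0 \o hXi 1)%FUN.

Lemma JK i : (i < n)%N -> cancel (hJ i) (hJi i) /\ cancel (hJi i) (hJ i).
Proof.
elim: i => [|i IH] hi.
  by have [|h1 h2] := @XK 1; [lia|]; split=> v /=; [rewrite h1 gK|rewrite giK // h2].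
have [|h1 h2] := IH; first by lia.
have hi' : (i.+1 <= n)%N by lia.
by split=> v /=; [rewrite gK // h1 gK|rewrite giK // h2 giK].
Qed.

Lemma com_Ji f i : (i < n)%N -> com f (hJ i) -> com f (hJi i).
Proof. by move=> hi; have [h1 h2] := JK hi; apply: com_inv. Qed.

Lemma J_comm_lo i j : (i < j < n)%N -> (i.+1 < j)%N -> com (g j) (hJ i).
Proof.
elim: i => [|i IH] /andP[_ jn] ij.
  apply: com_comp; first by apply: com_sym; apply: X_comm_hi; lia.
  by apply: com_sym; apply: g_comm; lia.
apply: com_comp; first by apply: com_sym; apply: g_comm; lia.
apply: com_comp; first by apply: IH; lia.
by apply: com_sym; apply: g_comm; lia.
Qed.

Lemma J_comm_hi i j : (0 < j < i)%N -> (i < n)%N -> com (g j) (hJ i).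
Proof.
elim: i => [|i IH] /andP[j0 ij] hi; first by lia.
have [ji|ji] := ltnP j i.
  apply: com_comp; first by apply: g_comm; lia.
  by apply: com_comp; [apply: IH; lia|apply: g_comm; lia].
have E : j = i by lia.
case: i E IH ij hi ji => [|i] E IH ij hi ji v; first by lia.
have h0 : (0 < i.+1)%N by [].
have c : com (g i.+2) (hJ i) by apply: J_comm_lo; lia.
by rewrite E /= braid // c -braid.
Qed.

(** With $J=J_{i-1}$, $J_i=gJg$ and $g^2=1+cg$ for $c=q-q^{-1}$, both sides are $gJ+Jg+c\,gJg$. *)
Lemma g_comm_sumJ i v : (0 < i < n)%N ->
  g i (hJ i.-1 v + hJ i v) = hJ i.-1 (g i v) + hJ i (g i v).
Proof.
case: i => // i /andP[_ hi] /=.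
have sq w : g i.+1 (g i.+1 w) = w + (q - q^-1) *: g i.+1 w.
  by rewrite {1}skein ?hi // gK // ltnW.
rewrite linearD /= sq [in RHS]sq !linearD !linearZ /=.
by rewrite addrCA.
Qed.

(** The same computation with $g^{-2}=1-cg^{-1}$ gives commutation with $g^{-1}$, hence with $g$. *)
Lemma g_comm_sumJi i v : (0 < i < n)%N ->
  g i (hJi i.-1 v + hJi i v) = hJi i.-1 (g i v) + hJi i (g i v).
Proof.
case: i => // i /andP[_ hi]; move: v.
have sk w : gi i.+1 w = g i.+1 w - (q - q^-1) *: w by rewrite skein ?hi // addrK.
have sq w : gi i.+1 (gi i.+1 w) = w - (q - q^-1) *: gi i.+1 w.
  by rewrite {1}sk giK // ltnW.
have c : com (gi i.+1) (fun v => hJi i v + hJi i.+1 v).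
  by move=> v /=; rewrite linearD /= sq [in RHS]sq !linearB !linearZ /= addrCA.
apply: com_sym; apply: (com_inv (giK (ltnW hi)) (gK (ltnW hi))).
exact: com_sym c.
Qed.

Definition hZ v := \sum_(i < n) (hJ i v + hJi i v).

Lemma com_Z f : (forall v w, f (v + w) = f v + f w) -> (forall i, (i < n)%N -> com f (hJ i)) -> com f hZ.
Proof.
move=> fD fJ v; rewrite /hZ.
have f0 : f 0 = 0 by apply: (addrI (f 0)); rewrite -fD !addr0.
rewrite (big_morph f fD f0); apply: eq_bigr => i _.
by rewrite fD fJ ?(com_Ji _ (fJ i _)).
Qed.

Lemma g_comm_Z i : (0 < i < n)%N -> com (g i) hZ.
Proof.
move=> hi v; have h1 : (i < n)%N by lia.
have h2 : (i.-1 < n)%N by lia.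
have split w : hZ w = (hJ i.-1 w + hJ i w) + (hJi i.-1 w + hJi i w) +
    \sum_(j < n | (j != i :> nat) && (j != i.-1 :> nat)) (hJ j w + hJi j w).
  rewrite /hZ (bigD1 (Ordinal h1)) //= (bigD1 (Ordinal h2)) /=; last first.
    by apply/eqP => -[]; lia.
  rewrite addrA; congr (_ + _); rewrite addrACA [hJ i w + _]addrC [hJi i w + _]addrC.
  by [].
rewrite !split linearD; congr (_ + _).
  by rewrite linearD /= g_comm_sumJ // g_comm_sumJi.
rewrite linear_sum; apply: eq_bigr => j /andP[j1 j2] /=.
have c : com (g i) (hJ j).
  have [ji|ij] : (j.+1 < i)%N \/ (i < j)%N by lia.
    by apply: J_comm_lo; have := ltn_ord j; lia.
  by apply: J_comm_hi; have := ltn_ord j; lia.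
by rewrite linearD /= c (com_Ji (ltn_ord j) c).
Qed.

Hypotheses (n2 : (1 < n)%N).

(** $J_1=X_2g_1g_0g_1$ commutes with $g_0$ by the four-term relation, and then so do the later
    $J_j$. For $J_0=X_1g_0$ the inverse has to be added: $J_0+J_0^{-1}=X_1g_0+(t-g_0)(u-X_1)$
    commutes with $g_0$ because $g_0^2=tg_0-1$. *)
Lemma g0_comm_Z : com (g 0) hZ.
Proof.
move=> v; have n0 : (0 < n)%N by lia.
have c1 : com (g 0) (hJ 1).
  move=> w /=; have [h1 h2] : (1 <= n)%N /\ (2 <= n)%N by lia.
  rewrite !(@XE 1) // !giK //.
  rewrite -X_comm_lo ?n2 //.
  by rewrite braid0.
have cJ j : (0 < j < n)%N -> com (g 0) (hJ j).
  elim: j => [|j IH] // /andP[_ hj]; case: j IH hj => [//|j] IH hj.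
  apply: com_comp; first by apply: g_comm; lia.
  by apply: com_comp; [apply: IH; lia|apply: g_comm; lia].
have split w : hZ w = (hJ 0 w + hJi 0 w) + \sum_(j < n | (j != 0%N :> nat)) (hJ j w + hJi j w).
  by rewrite /hZ (bigD1 (Ordinal n0)).
rewrite !split linearD; congr (_ + _); last first.
  rewrite linear_sum; apply: eq_bigr => j j0 /=.
  have c : com (g 0) (hJ j) by apply: cJ; have := ltn_ord j; lia.
  by rewrite linearD /= c (com_Ji (ltn_ord j) c).
have sq w : g 0 (g 0 w) = t *: g 0 w - w.
  by rewrite -[hX in _ - hX](gK (leq0n n)) g0E opprB addrCA subrr addr0.
rewrite /= !XXi; [|lia|lia].
by rewrite !g0E; lexp; rewrite !sq; lmod_with k.
Qed.

Lemma J0_comm_J1 : com (hJ 0) (hJ 1).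
Proof.
move=> v /=; have [h1 h2] : (1 <= n)%N /\ (2 <= n)%N by lia.
have Xc w : g 0 (hX 2 w) = hX 2 (g 0 w) by rewrite X_comm_lo // n2.
rewrite !(@XE 1) // !giK // !Xc braid0.
by rewrite X_braid ?n2 // gK.
Qed.

Lemma J0_comm_Z : com (hJ 0) hZ.
Proof.
apply: com_Z => [v w|]; first by rewrite linearD.
elim=> [|[|i] IH] hi; [by move=> v|exact: J0_comm_J1|].
have c : com (hJ 0) (g i.+2) by apply: com_sym; apply: J_comm_lo; lia.
have c' : com (hJ 0) (hJ i.+1) by apply: IH; lia.
by apply: (com_comp c); apply: (com_comp c').
Qed.

(** $g_n$ is reached along $X_1=J_0g_0^{-1}$, $X_{j+1}=g_jX_jg_j^{-1}$, $X_n=g_n$, all of which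
    commute with [hZ]. *)
Lemma gn_comm_Z : com (g n) hZ.
Proof.
suff h j : (0 < j <= n)%N -> com (hX j) hZ by rewrite -Xn; apply: h; lia.
case: j => // j; elim: j => [|j IH] hj.
  have c : com hZ (fun v => hJ 0 (gi 0 v)).
    apply: com_comp; first exact: com_sym J0_comm_Z.
    by apply: (com_inv (gK (leq0n n)) (giK (leq0n n))); exact: com_sym g0_comm_Z.
  by move=> v; have := c v; rewrite /= !giK.
have hj1 : (j.+1 <= n)%N by lia.
have c : com hZ (g j.+1) by apply/com_sym/g_comm_Z; lia.
have c' : com hZ (fun v => g j.+1 (hX j.+1 (gi j.+1 v))).
  apply: com_comp => //; apply: com_comp; first by apply/com_sym/IH; lia.
  exact: (com_inv (gK hj1) (giK hj1)).
by move=> v; have := c' v; rewrite !(@XE j.+1) ?giK //; lia.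
Qed.
End Hecke.

(** * Evaluation *)

Section Blob.
Context {k : fieldType} {V : lmodType k} (n : nat) (q Q1 Q2 : k) (e : nat -> {linear V -> V}).
Hypotheses (n0 : (0 < n)%N) (q0 : q != 0) (Q10 : Q1 != 0) (Q20 : Q2 != 0).
Hypothesis esq : forall i v, (0 < i < n)%N -> e i (e i v) = (q + q^-1) *: e i v.
Hypothesis etl : forall i j v, (0 < i < n)%N -> (0 < j < n)%N -> (j == i.+1) || (i == j.+1) ->
  e i (e j (e i v)) = e i v.
Hypothesis ecomm : forall i j v, (i.+1 < j <= n)%N -> e i (e j v) = e j (e i v).
Hypothesis e0sq : forall v, e 0%N (e 0%N v) = (Q1 - Q1^-1) *: e 0%N v.
Hypothesis ensq : forall v, e n (e n v) = (Q2 - Q2^-1) *: e n v.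
Hypothesis e101 : forall v, (1 < n)%N -> e 1%N (e 0%N (e 1%N v)) = (q * Q1 - q^-1 * Q1^-1) *: e 1%N v.
Hypothesis en1n : forall v, (1 < n)%N -> e n.-1 (e n (e n.-1 v)) = (q * Q2 - q^-1 * Q2^-1) *: e n.-1 v.

Definition hlin (c d : k) i : {linear V -> V} := (c \*: (idfun : {linear V -> V}) \+ d \*: e i).
(** [e 0] and [e n] stand for the blob generators multiplied by $qQ_i-q^{-1}Q_i^{-1}$ with $i=1,2$,
    so that $g_0$ and $g_n$ take the form $Q_i-e$ and no quantum number has to be inverted. *)
Definition hg i := if i == 0%N then hlin Q1 (-1) i else if i == n then hlin Q2 (-1) i else hlin (- q^-1) 1 i.
Definition hgi i := if i == 0%N then hlin Q1^-1 1 i else if i == n then hlin Q2^-1 1 i else hlin (- q) 1 i.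

Lemma hg0 v : hg 0 v = Q1 *: v - e 0%N v. Proof. by rewrite /= ?scaleN1r ?scale1r. Qed.
Lemma hgi0 v : hgi 0 v = Q1^-1 *: v + e 0%N v. Proof. by rewrite /= ?scaleN1r ?scale1r. Qed.
Lemma hgn v : hg n v = Q2 *: v - e n v.
Proof. by rewrite /hg; case: eqP => [|_]; [lia|rewrite eqxx /= ?scaleN1r ?scale1r]. Qed.
Lemma hgin v : hgi n v = Q2^-1 *: v + e n v.
Proof. by rewrite /hgi; case: eqP => [|_]; [lia|rewrite eqxx /= ?scaleN1r ?scale1r]. Qed.
Lemma hgE i v : (0 < i < n)%N -> hg i v = e i v - q^-1 *: v.
Proof. by rewrite /hg; case: eqP => [|_]; [lia|case: eqP => [|_]; [lia|rewrite /= scaleNr scale1r addrC]]. Qed.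
Lemma hgiE i v : (0 < i < n)%N -> hgi i v = e i v - q *: v.
Proof. by rewrite /hgi; case: eqP => [|_]; [lia|case: eqP => [|_]; [lia|rewrite /= scaleNr scale1r addrC]]. Qed.

Ltac lm := lmod_with k => //; try by field; rewrite ?q0 ?Q10 ?Q20.

Lemma hgK i : (i <= n)%N -> cancel (hg i) (hgi i).
Proof.
move=> hi v; have [->|i0] := eqVneq i 0%N.
  by rewrite hg0 hgi0; lexp; rewrite e0sq; lm.
have [->|ine] := eqVneq i n.
  by rewrite hgn hgin; lexp; rewrite ensq; lm.
by rewrite hgE ?hgiE; try lia; lexp; rewrite esq; try lia; lm.
Qed.

Lemma hgiK i : (i <= n)%N -> cancel (hgi i) (hg i).
Proof.
move=> hi v; have [->|i0] := eqVneq i 0%N.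
  by rewrite hg0 hgi0; lexp; rewrite e0sq; lm.
have [->|ine] := eqVneq i n.
  by rewrite hgn hgin; lexp; rewrite ensq; lm.
by rewrite hgE ?hgiE; try lia; lexp; rewrite esq; try lia; lm.
Qed.

Lemma hg_skein i v : (0 < i < n)%N -> hg i v = hgi i v + (q - q^-1) *: v.
Proof. by move=> hi; rewrite hgE ?hgiE //; lm. Qed.

Lemma hg_inv0 v : hgi 0 v = (Q1 + Q1^-1) *: v - hg 0 v.
Proof. by rewrite hg0 hgi0; lm. Qed.

Lemma hg_invn v : hgi n v = (Q2 + Q2^-1) *: v - hg n v.
Proof. by rewrite hgn hgin; lm. Qed.

Lemma hg_lin i : exists c d, forall v, hg i v = c *: v + d *: e i v.
Proof. by rewrite /hg; do 2?case: eqP => _; eexists; eexists. Qed.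

Lemma hg_comm i j : (i.+1 < j <= n)%N -> com (hg i) (hg j).
Proof.
move=> h v; have [c [d E]] := hg_lin i; have [c' [d' E']] := hg_lin j.
by rewrite !(E, E'); lexp; rewrite ecomm //; lm.
Qed.

Lemma hg_braid i v : (0 < i)%N -> (i.+1 < n)%N ->
  hg i (hg i.+1 (hg i v)) = hg i.+1 (hg i (hg i.+1 v)).
Proof.
move=> i0 hi; have [h1 h2] : (0 < i < n)%N /\ (0 < i.+1 < n)%N by lia.
rewrite !(hgE _ h1, hgE _ h2); lexp.
by rewrite !(esq _ h1, esq _ h2) !(etl _ h1 h2, etl _ h2 h1) ?eqxx ?orbT //; lm.
Qed.

Lemma hg_braid0 (n2 : (1 < n)%N) v : hg 0 (hg 1 (hg 0 (hg 1 v))) = hg 1 (hg 0 (hg 1 (hg 0 v))).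
Proof.
have h1 : (0 < 1 < n)%N by lia.
rewrite !(hg0, hgE _ h1); lexp.
have e101' v' := e101 v' n2.
by rewrite !(e101', e0sq, esq _ h1); lexp; rewrite ?(e101', e0sq, esq _ h1); lm.
Qed.

Lemma hg_braidn (n2 : (1 < n)%N) v : hg n (hg n.-1 (hg n (hg n.-1 v))) = hg n.-1 (hg n (hg n.-1 (hg n v))).
Proof.
have h1 : (0 < n.-1 < n)%N by lia.
rewrite !(hgn, hgE _ h1); lexp.
have en1n' v' := en1n v' n2.
by rewrite !(en1n', ensq, esq _ h1); lexp; rewrite ?(en1n', ensq, esq _ h1); lm.
Qed.

Notation X := (hX n hg hgi).
Notation Xi := (hXi n hg hgi).
Notation J := (hJ n hg hgi).
Notation Ji := (hJi n hg hgi).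
Notation Z := (hZ n hg hgi).

Lemma Z_lin c v w : Z (c *: v + w) = c *: Z v + Z w.
Proof.
rewrite /hZ scaler_sumr -big_split; apply: eq_bigr => i _ /=.
by rewrite !linearP scalerDr addrACA.
Qed.

Lemma hg_comm_Z i : (1 < n)%N -> (i <= n)%N -> com (hg i) Z.
Proof.
move=> n2 hi; have [->|i0] := eqVneq i 0%N.
  exact: (g0_comm_Z hgK hgiK hg_inv0 hg_invn hg_comm (hg_braid0 n2) n2).
have [->|ine] := eqVneq i n.
  exact: (gn_comm_Z hgK hgiK hg_skein hg_inv0 hg_invn hg_comm hg_braid (hg_braid0 n2) (hg_braidn n2) n2).
by apply: (g_comm_Z hgK hgiK hg_skein hg_comm hg_braid); lia.
Qed.

Lemma e_hg i : (i <= n)%N -> exists c d, forall v, e i v = c *: v + d *: hg i v.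
Proof.
move=> hi; have [->|i0] := eqVneq i 0%N.
  by exists Q1, (-1) => v; rewrite hg0; lm.
have [->|ine] := eqVneq i n; first by exists Q2, (-1) => v; rewrite hgn; lm.
by exists q^-1, 1 => v; rewrite hgE; [lm|lia].
Qed.

Lemma e_comm_Z i v : (1 < n)%N -> (i <= n)%N -> Z (e i v) = e i (Z v).
Proof.
move=> n2 hi; have [c [d E]] := e_hg hi; rewrite !E Z_lin (hg_comm_Z n2 hi).
congr (_ + _); have := Z_lin d (hg i v) 0; rewrite addr0 => ->.
by rewrite {2}/hZ big1 ?addr0 // => j _; rewrite !linear0 addr0.
Qed.

Lemma com_e_hg (f : {linear V -> V}) i : (i <= n)%N -> com f (hg i) -> com f (e i).
Proof. by move=> hi c v; have [a [b E]] := e_hg hi; rewrite !E; lexp; rewrite c. Qed.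

Lemma X_comm_e i j : (i.+1 < j <= n)%N -> com (X j) (e i).
Proof.
by move=> h; apply: com_e_hg; [lia|apply: (X_comm_lo hgK hgiK hg_comm)].
Qed.

(** Pulling a strand across a cup: the two crossings disappear and the shifted cup remains, up to
    $-q^{\pm1}$. *)
Lemma gge j v : (0 < j)%N -> (j.+1 < n)%N ->
  [/\ hg j (hg j.+1 (e j v)) = - q^-1 *: e j.+1 (e j v),
      hgi j (hgi j.+1 (e j v)) = - q *: e j.+1 (e j v),
      hg j.+1 (hg j (e j.+1 v)) = - q^-1 *: e j (e j.+1 v) &
      hgi j.+1 (hgi j (e j.+1 v)) = - q *: e j (e j.+1 v)].
Proof.
move=> j0 jn; have [h1 h2] : (0 < j < n)%N /\ (0 < j.+1 < n)%N by lia.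
by split; rewrite ?(hgE _ h1, hgE _ h2, hgiE _ h1, hgiE _ h2); lexp;
  rewrite !(esq _ h1, esq _ h2) !(etl _ h1 h2, etl _ h2 h1) ?eqxx ?orbT //; lm.
Qed.

Lemma egg j v : (0 < j)%N -> (j.+1 < n)%N ->
  e j.+1 (hgi j (hgi j.+1 v)) = - q *: e j.+1 (e j v) /\
  e j (hg j.+1 (hg j v)) = - q^-1 *: e j (e j.+1 v).
Proof.
move=> j0 jn; have [h1 h2] : (0 < j < n)%N /\ (0 < j.+1 < n)%N by lia.
by split; rewrite ?(hgE _ h1, hgE _ h2, hgiE _ h1, hgiE _ h2); lexp;
  rewrite !(esq _ h1, esq _ h2) !(etl _ h1 h2, etl _ h2 h1) ?eqxx ?orbT //; lm.
Qed.

Lemma XE2 j v : (0 < j)%N -> (j.+1 < n)%N ->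
  X j v = hgi j (hgi j.+1 (X j.+2 (hg j.+1 (hg j v)))).
Proof. by move=> j0 jn; rewrite (XE hg hgi (j := j)) 1?(XE hg hgi (j := j.+1)) //; lia. Qed.

(** The strand of $X_j$ is pulled through the cup at $j+1$, which leaves $X_{j+2}$; the factors $-q$
    and $-q^{-1}$ of the two pairs of crossings cancel. *)
Lemma Xe j v : (0 < j)%N -> (j.+1 < n)%N ->
  X j (e j.+1 v) = e j.+1 (e j (X j.+2 (e j.+1 v))).
Proof.
move=> j0 jn; have h : (j.+1 < j.+2 <= n)%N by lia.
rewrite XE2 //; have [_ _ -> _] := gge v j0 jn; lexp; rewrite (X_comm_e h).
have [_ -> _ _] := gge (X j.+2 (e j.+1 v)) j0 jn; lm.
Qed.

Lemma eX j v : (0 < j)%N -> (j.+1 < n)%N ->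
  e j.+1 (X j v) = e j.+1 (X j.+2 (e j (e j.+1 v))).
Proof.
move=> j0 jn; have h : (j.+1 < j.+2 <= n)%N by lia.
rewrite XE2 //; have [-> _] := egg (X j.+2 (hg j.+1 (hg j v))) j0 jn; lexp.
rewrite -(X_comm_e h); have [_ ->] := egg v j0 jn; lm.
Qed.

Lemma eeX j v : (0 < j)%N -> (j.+1 < n)%N -> e j (e j.+1 (X j v)) = X j.+2 (e j (e j.+1 v)).
Proof.
move=> j0 jn; have h : (j.+1 < j.+2 <= n)%N by lia.
by rewrite eX // (X_comm_e h) etl ?eqxx -?(X_comm_e h) //; lia.
Qed.

Lemma eXe2 j v : (0 < j)%N -> (j.+1 < n)%N -> e j.+1 (X j (e j v)) = e j.+1 (X j.+2 (e j v)).
Proof. by move=> j0 jn; rewrite eX // etl ?eqxx //; lia. Qed.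

(** For $j=n-1$ the two terms of $g_n=Q_2-e_n$ give $(q+q^{-1})Q_2-(qQ_2-q^{-1}Q_2^{-1})$. The
    induction carries this value down unchanged. *)
Lemma eXe j v : (0 < j < n)%N -> e j (X j.+1 (e j v)) = (q^-1 * (Q2 + Q2^-1)) *: e j v.
Proof.
case/andP=> j0 jn; have jn' := ltnW jn; move: j jn' j0 jn v.
apply: down_ind => [|j jn IH j0 _ v]; first by lia.
have h1 : (0 < j < n)%N by lia.
have [E|j1] := eqVneq j.+1 n.
  have E' : j = n.-1 by lia.
  rewrite E Xn hgn; lexp; rewrite (esq _ h1) E' en1n; [lm|lia].
have h2 : (0 < j.+1 < n)%N by lia.
have h : (j.+1 < j.+2 <= n)%N by lia.
have [h2' hn2] : (j.+1 < n)%N /\ (j.+2 <= n)%N by lia.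
rewrite XE // hgE // hgiE //; lexp; rewrite (IH isT h2').
rewrite -!(X_comm_e h); lexp; rewrite !(etl _ h1 h2) ?eqxx ?orbT // !esq //; lexp.
by rewrite !(X_comm_e h) !(etl _ h1 h2) ?eqxx //; lm.
Qed.

(** [f] acts at the first node; [G f j] transports it to node $2j+1$, counted from 1, of a diagram
    beginning with [j] undecorated cups: $e_{2j},\dots,e_2$ move these cups one step to the right,
    and $e_1,\dots,e_{2j-1}$ move them back. *)
Fixpoint G (f : {linear V -> V}) (j : nat) : {linear V -> V} :=
  if j is j'.+1 then (e j'.*2.+1 \o (G f j' \o e j'.*2.+2))%FUN else f.

Lemma G_com (f : {linear V -> V}) (c : V -> V) j : com c f ->
  (forall i, (0 < i <= j.*2)%N -> com c (e i)) -> com c (G f j).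
Proof.
move=> cf; elim: j => [|j IH] ce //=.
apply: com_comp; first by apply: ce; lia.
apply: com_comp; last by apply: ce; lia.
by apply: IH => i hi; apply: ce; lia.
Qed.

Lemma e_comm i j : (i.+1 < j <= n)%N -> com (e j) (e i).
Proof. by move=> h v; rewrite (ecomm _ h). Qed.

Lemma G_com_e (f : {linear V -> V}) j i : com (e i) f -> (j.*2.+1 < i <= n)%N -> com (e i) (G f j).
Proof. by move=> cf h; apply: (G_com cf) => l hl; apply: e_comm; lia. Qed.

Section Eval.
Context (h0 : V) (r m : nat) (x0 y2 : k) (z : nat -> V).
Hypotheses (nE : n = (r.*2 + m).+1) (x00 : x0 != 0) (y20 : y2 != 0).
Hypotheses (tE : Q1 + Q1^-1 = x0 + x0^-1) (uE : Q2 + Q2^-1 = y2 + y2^-1).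
Hypothesis h0_cup : forall j, (j < r)%N -> h0 = e j.*2.+1 (z j).
Hypothesis h0_line : forall i, (r.*2 < i < n)%N -> e i h0 = 0.
Hypothesis h0_n : hg n h0 = y2 *: h0.

(** [even_e r 1] is $e_2e_4\cdots e_{2r}h_0$: the cups have moved one step to the right and the
    first line has come to the first node, where $g_0$ has the eigenvalue [x0]. *)
Fixpoint even_e (d : nat) (j : nat) : V := if d is d'.+1 then e j.*2 (even_e d' j.+1) else h0.
Hypothesis h0_0 : hg 0 (even_e r 1) = x0 *: even_e r 1.

Lemma cup_sq j : (j < r)%N -> e j.*2.+1 h0 = (q + q^-1) *: h0.
Proof. by move=> hj; rewrite {1}(h0_cup hj) esq -?h0_cup //; lia. Qed.

Lemma cup_tl j : (j < r)%N -> e j.*2.+1 (e j.*2.+2 h0) = h0.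
Proof. by move=> hj; rewrite {1}(h0_cup hj) etl -?h0_cup ?eqxx //; lia. Qed.

(* w_j = e_(2j+2) ... e_(2r) h0 *)
Let w j := even_e (r - j) j.+1.

Lemma wE j : (j < r)%N -> w j = e j.*2.+2 (w j.+1).
Proof. by move=> hj; rewrite /w (_ : r - j = (r - j.+1).+1)%N //; lia. Qed.

Lemma w_tl i j : (j < i <= r)%N -> e j.*2.+1 (e j.*2.+2 (w i)) = w i.
Proof.
rewrite /w; have [d] := ubnP (r - i); elim: d i => // d IH i hd /andP[ji ir].
have [->|ne] := eqVneq i r; first by rewrite subnn cup_tl //; lia.
rewrite -/(w i) wE; last by lia.
rewrite (@ecomm j.*2.+2); last by lia.
rewrite (@ecomm j.*2.+1); last by lia.
by rewrite IH //; lia.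
Qed.

Lemma G_w j : (j <= r)%N -> G (hg 0) j (w j) = x0 *: w j.
Proof.
elim: j => [|j IH] hj; first by rewrite /w subn0.
by rewrite /= -wE // IH 1?ltnW // linearZ /= wE // w_tl // ltnSn.
Qed.

Notation Gk := (G (hg 0)).
Notation Gi := (G (hgi 0)).

Lemma G_id j : (j <= r)%N -> G idfun j h0 = h0.
Proof.
elim: j => [//|j IH] hj /=.
have c : com (e j.*2.+2) (G idfun j) by apply: G_com_e => //; lia.
by rewrite -c IH 1?ltnW // cup_tl.
Qed.

(** [G] is linear in [f], and $g_0^{-1}=Q_1+Q_1^{-1}-g_0$. *)
Lemma Gi_h0 j : (j <= r)%N -> Gi j h0 = (Q1 + Q1^-1) *: h0 - Gk j h0.
Proof.
move=> hj; rewrite -{2}(G_id hj).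
elim: j {hj} h0 => [|j IH] v /=; first exact: hg_inv0.
by rewrite IH; lexp.
Qed.

Lemma com_e_hg0 i : (1 < i <= n)%N -> com (e i) (hg 0).
Proof. by move=> hi; apply/com_sym/com_e_hg; [lia|apply: hg_comm]. Qed.

Lemma com_e_Gk j i : (j.*2.+1 < i <= n)%N -> com (e i) (Gk j).
Proof. by move=> hi; apply: G_com_e => //; apply: com_e_hg0; lia. Qed.

(** The counterpart of [eXe] at the left wall: the value comes from $e_1g_0e_1$ and is carried from
    cup to cup. *)
Lemma eG j : (j < r)%N -> e j.*2.+1 (Gk j h0) = (q^-1 * (Q1 + Q1^-1)) *: h0.
Proof.
elim: j => [|j IH] hj.
  rewrite -[Gk 0]/(hg 0) (h0_cup hj) hg0; lexp; rewrite e101 1?esq; try lia.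
  by lm.
have hj' : (j < r)%N by lia.
have h : (j.*2.+2 < j.+1.*2.+1 <= n)%N by lia.
rewrite /= -ecomm; last by lia.
rewrite com_e_Gk; last by lia.
rewrite {1}(h0_cup hj) -[j.+1.*2.+1]/j.*2.+3 etl ?eqxx ?orbT //; try lia.
by rewrite -[j.*2.+3]/j.+1.*2.+1 -h0_cup // IH.
Qed.

(** The mixed term of $J_{2j}+J_{2j+1}$, in which both walls act on the same cup. Its value also
    involves the propagating lines, through [x0] and [y2]. *)
Definition Y j := e j.*2.+1 (X j.*2.+2 (Gk j h0)).

Lemma com_X_Gk j i : (j.*2.+1 < i <= n)%N -> com (X i) (Gk j).
Proof.
move=> hi; apply: G_com => [|l hl]; last by apply: X_comm_e; lia.
by apply: (X_comm_lo hgK hgiK hg_comm); lia.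
Qed.

(** Writing $h_0=e_{2j+3}e_{2j+2}h_0$ allows $X_{2j+2}$ to be pulled through the next cup; the
    generators left over rebuild [Gk] at [j.+1]. *)
Lemma Y_step j : (j.+1 < r)%N -> Y j = Y j.+1.
Proof.
move=> hj; have hj' : (j < r)%N by lia.
have cup1 : e j.+1.*2.+1 (e j.*2.+2 h0) = h0.
  by rewrite {1}(h0_cup hj) etl -?h0_cup ?eqxx ?orbT //; lia.
rewrite /Y -{1}cup1 -com_e_Gk; last by lia.
rewrite -com_e_Gk; last by lia.
rewrite -[j.+1.*2.+1]/j.*2.+3 Xe; [|lia|lia].
rewrite com_e_Gk; last by lia.
rewrite (com_e_Gk (i := j.*2.+3)); last by lia.
rewrite -[j.*2.+3]/j.+1.*2.+1 cup1 -[j.+1.*2.+2]/j.*2.+4 /=.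
rewrite ecomm; last by lia.
rewrite -(@X_comm_e j.*2.+2 j.*2.+4); last by lia.
rewrite -(@X_comm_e j.*2.+1 j.*2.+4); last by lia.
by rewrite com_e_Gk //; lia.
Qed.

Lemma hg_line i : (r.*2 < i < n)%N -> hg i h0 = - q^-1 *: h0.
Proof. by move=> hi; rewrite hgE ?h0_line ?sub0r ?scaleNr //; lia. Qed.

Lemma hgi_line i : (r.*2 < i < n)%N -> hgi i h0 = - q *: h0.
Proof. by move=> hi; rewrite hgiE ?h0_line ?sub0r ?scaleNr //; lia. Qed.

Lemma X_h0 j : (r.*2 < j)%N -> (j <= n)%N -> X j h0 = y2 *: h0.
Proof.
move=> rj jn; move: j jn rj; apply: down_ind; first by rewrite Xn.
move=> j jn IH rj; have hj : (r.*2 < j < n)%N by lia.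
rewrite XE // hg_line //; lexp; rewrite IH 1?ltnW //; lexp; rewrite hgi_line //; lm.
Qed.

(** The first line is next to the last cup. After expanding $X_{2r}=g_{2r}^{-1}X_{2r+1}g_{2r}$,
    every term is known: [Gk] gives [x0] once $e_{2r}$ has brought the line into place, $X_{2r+1}$
    gives [y2] on the lines, and the rest is [eG] and [eXe]. *)
Lemma Y_last : (0 < r)%N -> Y r.-1 = (q^-1 * (Q1 + Q1^-1) * (Q2 + Q2^-1) - q * x0 * y2 - (q * x0 * y2)^-1) *: h0.
Proof.
move=> r0; have [s Es] : exists s, r = s.+1 by exists r.-1; lia.
have hs : (s < r)%N by lia.
have Gs : e s.*2.+2 (Gk s h0) = x0 *: e s.*2.+2 h0.
  rewrite com_e_Gk; last by lia.
  have := G_w (ltnW hs); rewrite wE // (_ : w s.+1 = h0) //.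
  by rewrite /w Es subnn.
rewrite Es /= /Y XE; last by lia.
have hg2 : (0 < s.*2.+2 < n)%N by lia.
have c v : e s.*2.+1 (X s.*2.+3 v) = X s.*2.+3 (e s.*2.+1 v) by rewrite (@X_comm_e s.*2.+1) //; lia.
rewrite hgE // hgiE // Gs; lexp; rewrite com_X_Gk ?X_h0; [|lia|lia|lia].
lexp; rewrite Gs eXe // c cup_tl // X_h0; [|lia|lia].
rewrite eG //; lexp; rewrite cup_tl // tE uE; lmod_with k => //.
by field; rewrite q0 x00 y20.
Qed.

Lemma Y_E j : (j < r)%N -> Y j = (q^-1 * (Q1 + Q1^-1) * (Q2 + Q2^-1) - q * x0 * y2 - (q * x0 * y2)^-1) *: h0.
Proof.
move=> hj; have [d] := ubnP (r - j); elim: d j hj => // d IH j hj hd.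
have [E|ne] := eqVneq j.+1 r; first by rewrite -Y_last -?E.
by rewrite Y_step ?IH //; lia.
Qed.

Definition yh := q * x0 * y2 + (q * x0 * y2)^-1.

Lemma com_J_e i j : (i.+1 < j < n)%N -> com (J i) (e j).
Proof.
move=> h; apply: com_e_hg; first by lia.
by apply/com_sym/(J_comm_lo hgK hgiK hg_comm hg_braid); lia.
Qed.

Lemma com_Ji_e i j : (i.+1 < j < n)%N -> com (Ji i) (e j).
Proof.
by move=> h; apply/com_sym/(com_Ji hgK hgiK); [lia|apply/com_sym/com_J_e].
Qed.

(** Passing a cup costs two factors $-q^{-1}$, one for each pair of crossings, and shifts both [X]
    and [Gk] by two nodes. *)
Lemma J_even j : (j <= r)%N -> J j.*2 h0 = q^-1 ^+ j.*2 *: X j.*2.+1 (Gk j h0).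
Proof.
elim: j => [_|j IH hj]; first by rewrite expr0 scale1r.
have [j0 hn] : (0 < j.*2.+1)%N /\ (j.*2.+2 < n)%N by lia.
rewrite doubleS /= {1}(h0_cup hj); have [-> _ _ _] := gge (z j) j0 hn; lexp.
rewrite -h0_cup // com_J_e; last by lia.
have [_ _ -> _] := gge (J j.*2 h0) j0 hn; rewrite IH 1?ltnW //; lexp.
rewrite eeX // com_e_Gk; last by lia.
by rewrite !exprS; lm.
Qed.

Lemma Xi_u j v : (j <= n)%N -> Xi j v = (Q2 + Q2^-1) *: v - X j v.
Proof. exact: XXi hgK hg_invn _ _. Qed.

Lemma eXi j v : (0 < j)%N -> (j.+1 < n)%N -> e j.+1 (Xi j (e j v)) = e j.+1 (Xi j.+2 (e j v)).
Proof. by move=> j0 jn; rewrite !Xi_u; [|lia|lia]; lexp; rewrite eXe2. Qed.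

Lemma com_e_Gi j i : (j.*2.+1 < i <= n)%N -> com (e i) (Gi j).
Proof.
move=> hi; apply: G_com_e => //; apply: (com_inv (hgK _) (hgiK _)) => //.
by apply: com_e_hg0; lia.
Qed.

Lemma com_X_Gi j i : (j.*2.+1 < i <= n)%N -> com (X i) (Gi j).
Proof.
move=> hi; apply: G_com => [|l hl]; last by apply: X_comm_e; lia.
apply: (com_inv (hgK _) (hgiK _)) => //.
by apply: (X_comm_lo hgK hgiK hg_comm); lia.
Qed.

Lemma Ji_even j : (j <= r)%N -> Ji j.*2 h0 = q ^+ j.*2 *: Gi j (Xi j.*2.+1 h0).
Proof.
elim: j => [_|j IH hj]; first by rewrite expr0 scale1r.
have [j0 hn] : (0 < j.*2.+1)%N /\ (j.*2.+2 < n)%N by lia.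
rewrite doubleS /= {1}(h0_cup hj); have [_ -> _ _] := gge (z j) j0 hn; lexp.
rewrite -h0_cup // com_Ji_e; last by lia.
have [_ _ _ ->] := gge (Ji j.*2 h0) j0 hn; rewrite IH 1?ltnW //; lexp.
rewrite com_e_Gi; last by lia.
rewrite {1}(h0_cup hj) eXi // -h0_cup //.
by rewrite !exprS; lm.
Qed.

Lemma eXh0 j : (j < r)%N -> e j.*2.+1 (X j.*2.+2 h0) = (q^-1 * (Q2 + Q2^-1)) *: h0.
Proof. by move=> hj; rewrite {1}(h0_cup hj) eXe -?h0_cup //; lia. Qed.

(** Since $g_{2j+1}h_0=qh_0$, the sum is $q\,e_{2j+1}J_{2j}h_0$. Expanding $X_{2j+1}$ in it leaves
    the mixed term [Y j] and a product of the values in [eXe] and [eG], which cancels the first term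
    in [Y_E]. *)
Lemma pair_J j : (j < r)%N ->
  J j.*2 h0 + J j.*2.+1 h0 = (q^-1 ^+ j.*2.+1 * yh) *: h0.
Proof.
move=> hj; have h1 : (0 < j.*2.+1 < n)%N by lia.
have jn : (j.*2.+1 < n)%N by lia.
have q2 : hg j.*2.+1 h0 = q *: h0 by rewrite hgE // cup_sq //; lm.
rewrite /= q2; lexp; rewrite hgE // J_even 1?ltnW //; lexp.
rewrite XE // !hgE // hgiE //; lexp; rewrite esq // eG //; lexp.
rewrite eXh0 // -/(Y j) Y_E //; lexp; rewrite cup_sq // /yh !exprS.
lm; field; by rewrite q0 Q10 Q20 x00 y20.
Qed.

Lemma pair_Ji j : (j < r)%N ->
  Ji j.*2 h0 + Ji j.*2.+1 h0 = (q ^+ j.*2.+1 * yh) *: h0.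
Proof.
move=> hj; have h1 : (0 < j.*2.+1 < n)%N by lia.
have jn : (j.*2.+1 < n)%N by lia.
have q2 : hg j.*2.+1 h0 = q *: h0 by rewrite hgE // cup_sq //; lm.
have q3 : hgi j.*2.+1 h0 = q^-1 *: h0 by rewrite hgiE // cup_sq //; lm.
have Xi1 : Xi j.*2.+1 h0 = q *: (e j.*2.+1 (Xi j.*2.+2 h0) - q *: Xi j.*2.+2 h0).
  by rewrite XiE // q2; lexp; rewrite hgiE.
have eXi0 : e j.*2.+1 (Xi j.*2.+2 h0) = (q * (Q2 + Q2^-1)) *: h0.
  by rewrite Xi_u //; lexp; rewrite eXh0 // cup_sq //; lm.
rewrite /= q3; lexp; rewrite hgiE // Ji_even 1?ltnW //; lexp.
rewrite Xi1 eXi0; lexp; rewrite !Xi_u //; lexp.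
rewrite -com_X_Gi ?Gi_h0; [|lia..]; lexp.
rewrite cup_sq // eG // eXh0 // -/(Y j) Y_E // /yh !exprS.
lm; field; by rewrite q0 Q10 Q20 x00 y20.
Qed.

Lemma J_line a : (r.*2 + a < n)%N ->
  J (r.*2 + a) h0 = (q^-1 ^+ (r.*2 + a.*2) * x0 * y2) *: h0.
Proof.
elim: a => [|a IH] ha.
  rewrite !addn0 J_even //; have := G_w (leqnn r); rewrite /w subnn /= => ->.
  by rewrite linearZ /= X_h0 //; [lm|lia].
have hl : (r.*2 < (r.*2 + a).+1 < n)%N by lia.
rewrite addnS /= hg_line //; lexp; rewrite IH; last by lia.
by lexp; rewrite hg_line // !addnS !exprS; lm.
Qed.

Lemma Ji_line a : (r.*2 + a < n)%N ->
  Ji (r.*2 + a) h0 = (q ^+ (r.*2 + a.*2) * x0^-1 * y2^-1) *: h0.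
Proof.
move=> ha; have [K _] := JK hgK hgiK ha.
have := K h0; rewrite J_line //; lexp => E.
rewrite -{2}E; lmod_with k => //; rewrite exprVn; field; by rewrite x00 y20 expf_neq0.
Qed.

Lemma Z_h0 : q ^+ 2 != 1 -> Z h0 =
  ((q ^+ n - q^-1 ^+ n) / (q - q^-1) * (q^-1 ^+ m * x0 * y2 + q ^+ m * x0^-1 * y2^-1)) *: h0.
Proof.
move=> q21; have qq : q * q - 1 != 0 by rewrite subr_eq0 -expr2.
have A0 i : q ^+ i != 0 by rewrite expf_neq0.
have P1 j : (j <= r)%N -> \sum_(0 <= i < j.*2) (J i h0 + Ji i h0) =
    ((q ^+ j.*2 - q^-1 ^+ j.*2) / (q - q^-1) * yh) *: h0.
  elim: j => [_|j IH hj]; first by rewrite big_geq // subrr !mul0r scale0r.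
  rewrite doubleS !big_nat_recr // IH 1?ltnW //.
  rewrite -[LHS]/(_ + (J j.*2 h0 + Ji j.*2 h0) + (J j.*2.+1 h0 + Ji j.*2.+1 h0)).
  rewrite -addrA addrACA pair_J // pair_Ji //.
  rewrite !exprS !exprVn; move: (A0 j.*2); move: (q ^+ j.*2) => A hA; lmod_with k => //.
  by field; rewrite q0 hA qq.
(* The factors $q$ and $q^{-1}$ come from the denominators $1-q^{-2}=q^{-1}(q-q^{-1})$ and
   $q^2-1=q(q-q^{-1})$ of the geometric sums over the lines. *)
have P2 a : (r.*2 + a <= n)%N -> \sum_(0 <= i < r.*2 + a) (J i h0 + Ji i h0) =
    ((q ^+ r.*2 - q^-1 ^+ r.*2) / (q - q^-1) * yh +
     (q * q^-1 ^+ r.*2 * (1 - q^-1 ^+ a.*2) * (x0 * y2) + q^-1 * q ^+ r.*2 * (q ^+ a.*2 - 1) / (x0 * y2)) / (q - q^-1)) *: h0.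
  elim: a => [_|a IH ha]; first by rewrite addn0 P1 //; lmod_with k => //; field; rewrite q0 x00 y20 qq A0.
  rewrite addnS big_nat_recr // IH 1?J_line 1?Ji_line //; try lia.
  rewrite doubleS !exprD !exprS !exprVn; move: (A0 r.*2) (A0 a.*2).
  move: (q ^+ r.*2) (q ^+ a.*2) => A B hA hB; lmod_with k => //.
  by field; rewrite q0 hA hB x00 y20 qq.
have := P2 m.+1; rewrite addnS -nE /hZ big_mkord => -> //; congr (_ *: _).
rewrite /yh nE doubleS !exprS !exprD -[m.*2]addnn !exprD !exprVn; move: (A0 r.*2) (A0 m).
move: (q ^+ r.*2) (q ^+ m) => A B hA hB.
by field; rewrite q0 hA hB x00 y20 qq.
Qed.
End Eval.
End Blob.

(** * Generation *)

Section Cyclic.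
Context {k : fieldType} (P : blob_params k) {n m : nat} {eps1 eps2 : int}.
Hypotheses (hn : (0 < n)%N) (hlab : is_label n m eps1 eps2).
Notation hdiag := (hdiag n m eps1 eps2).
Notation vb := (cbasis (k := k) (n := n) (m := m) (eps1 := eps1) (eps2 := eps2)).
Notation op := (@op k P n m eps1 eps2).
Implicit Types (h : hdiag).

Definition nd (i : nat) : node n m.+1 := inl (ord_of hn i).

Lemma nd_inj i j : (i < n)%N -> (j < n)%N -> nd i = nd j -> i = j.
Proof. by move=> hi hj [] /(congr1 val) /=; rewrite !val_ord_of. Qed.

Lemma nd_eq i j : (i < n)%N -> (j < n)%N -> (nd i == nd j) = (i == j).
Proof. by move=> hi hj; apply/eqP/eqP => [/nd_inj|->//]; apply. Qed.

Lemma inl_nd (i : 'I_n) : inl i = nd i.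
Proof. by rewrite /nd ord_of_val. Qed.

Lemma node_case (x : node n m.+1) : (exists2 i, (i < n)%N & x = nd i) \/ exists b, x = inr b.
Proof.
case: x => [i|b]; [left|right; by exists b].
by exists (i : nat); [apply: ltn_ord|rewrite inl_nd].
Qed.

Lemma pos_nd i : (i < n)%N -> boundary_pos (nd i) = i.
Proof. by move=> hi; rewrite /= val_ord_of. Qed.

Lemma halfP h : [/\ forall x, partner (val h) x != x, involutive (partner (val h)) &
  forall x, deco (val h) (partner (val h) x) = rev (deco (val h) x) :> seq blob].
Proof. exact: wf_stringsP _ (half_wf (valP h)). Qed.

Definition sw (a c : nat) (x : node n m.+1) :=
  if x == nd a then nd c else if x == nd c then nd a else x.

Lemma swL a c : sw a c (nd a) = nd c. Proof. by rewrite /sw eqxx. Qed.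
Lemma swR a c : sw a c (nd c) = nd a.
Proof. by rewrite /sw eqxx; case: eqP => [->|]. Qed.
Lemma swD a c x : nd a != x -> nd c != x -> sw a c x = x.
Proof. by rewrite /sw ![_ == x]eq_sym => /negbTE-> /negbTE->. Qed.
Lemma swK a c : involutive (sw a c).
Proof.
move=> x; have [<-|xa] := eqVneq (nd a) x; first by rewrite swL swR.
have [<-|xc] := eqVneq (nd c) x; first by rewrite swR swL.
by rewrite !swD.
Qed.

(* Moving an undecorated cup by one step exchanges two nodes. *)
Lemma move_cup h a b c : (a < n)%N -> (c < n)%N ->
  (a.+1 == b) && (b.+1 == c) || (a == b.+1) && (b == c.+1) ->
  val h (nd a) = (nd b, [bseq]) ->
  exists h2, (forall x, val h2 x = (sw a c (partner (val h) (sw a c x)),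
     deco (val h) (sw a c x))) /\
  (exists i, (i <= n)%N /\ op i (vb h2) = vb h) /\ (c = b.+1 -> op c (vb h) = vb h2).
Proof.
move=> an cn abc E; have wd := half_wf (valP h); have rd := half_reduced (valP h).
have [hf hK hr] := halfP h.
have bn : (b < n)%N by lia.
have E' : val h (nd b) = (nd a, [bseq]).
  have Ep : partner (val h) (nd a) = nd b by rewrite /partner E.
  rewrite [LHS]surjective_pairing -/(partner _ _) -/(deco _ _) -Ep hK; congr (_, _).
  by apply: word_eq; rewrite hr /deco E.
have [ca cb ab] : [/\ nd c != nd a, nd c != nd b & nd a != nd b] by split; rewrite nd_eq //; lia.
have spec : forall x, surg (nd b) (nd c) (val h) x =
   (sw a c (partner (val h) (sw a c x)), deco (val h) (sw a c x)).
  have pa : partner (val h) (nd a) = nd b by rewrite /partner E.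
  have pb : partner (val h) (nd b) = nd a by rewrite /partner E'.
  move=> x; have [->|xa] := eqVneq x (nd a).
    rewrite (zigzag_a wd rd E ca) swL swD; first by rewrite -surjective_pairing.
      by apply/eqP => /esym/(canRL hK); rewrite pa => /eqP; rewrite (negbTE cb).
    by rewrite eq_sym hf.
  have [->|xb] := eqVneq x (nd b).
    rewrite (swD ab cb) pb swL surg_p; first by rewrite /deco E'.
  have [->|xc] := eqVneq x (nd c).
    by rewrite swR pa (swD ab cb) surg_p' 1?eq_sym // /deco E.
  rewrite (swD (x := x)) 1?eq_sym //.
  have [->|xC] := eqVneq x (partner (val h) (nd c)).
    by rewrite (zigzag_C wd rd E ca cb) hK swR.
  rewrite (zigzag_same wd E) //; last by rewrite -(inj_eq (inv_inj hK)) hK.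
  rewrite swD; first by rewrite -surjective_pairing.
    by rewrite eq_sym -(inj_eq (inv_inj hK)) hK pa.
  by rewrite eq_sym -(inj_eq (inv_inj hK)) hK.
case/orP: abc => /andP[/eqP Eb /eqP Ec].
  have [hb hc] : (0 < b < n)%N /\ (0 < c < n)%N by lia.
  have ij : (c == b.+1) || (b == c.+1) by lia.
  have C : cup_at hn b (val h) by move: E; rewrite /cup_at -Eb.
  have [h2 [E2 O' O]] := zigzag P hlab hb hc ij C.
  exists h2; split; last by split=> //; exists b; split=> //; lia.
  by move=> x; rewrite E2 (topopE hn hlab) -?spec -?Ec //; lia.
have [ha hb] : (0 < a < n)%N /\ (0 < b < n)%N by lia.
have ij : (b == a.+1) || (a == b.+1) by lia.
have C : cup_at hn a (val h) by move: E'; rewrite /cup_at Eb.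
have [h2 [E2 O' O]] := zigzag P hlab ha hb ij C.
exists h2; split; last by split=> [|cb']; [exists a; split=> //; lia|lia].
move=> x; rewrite -spec E2 (topopE hn hlab); last by lia.
move: cb; rewrite Ec => cb.
by rewrite -[LHS]/(surg (nd c) (nd c.+1) (val h) x) (surgC wd cb).
Qed.

(** The measure of the outer induction, each blob being counted at both ends of its string: moving
    cups preserves it, removing a blob lowers it. *)
Definition ndeco h := (\sum_x size (deco (val h) x))%N.

Lemma ndeco_sw h h2 a c : (forall x, val h2 x = (sw a c (partner (val h) (sw a c x)),
  deco (val h) (sw a c x))) -> ndeco h2 = ndeco h.
Proof.
move=> E; rewrite /ndeco [RHS](reindex_inj (inv_inj (swK a c))).
by apply: eq_bigr => x _; rewrite {1}/deco E.
Qed.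

Lemma arc_sym h a b : partner (val h) (nd a) = nd b -> partner (val h) (nd b) = nd a.
Proof. by have [_ hK _] := halfP h; move=> <-. Qed.

Lemma undecorate h a b c : (a < n)%N -> (b < n)%N -> partner (val h) (nd a) = nd b ->
  deco (val h) (nd a) = [:: c] :> seq blob ->
  exists h', [/\ (ndeco h' < ndeco h)%N, val h' (nd a) = (nd b, [bseq]),
     val h' (nd b) = (nd a, [bseq]) & forall z, z = nd a \/ z = nd b -> dec z c (val h') = val h].
Proof.
move=> an bn Ea Wa; have [hf hK hr] := halfP h; have Eb := arc_sym Ea.
have ab : nd a != nd b by rewrite -Ea eq_sym hf.
have Wb : deco (val h) (nd b) = [:: c] :> seq blob by rewrite -Ea hr Wa.
pose d' : ddiag n m.+1 := [ffun x => if (x == nd a) || (x == nd b) then (partner (val h) x, [bseq]) else val h x].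
have pd x : partner d' x = partner (val h) x by rewrite /partner ffunE; case: ifP.
have dd x : deco d' x = if (x == nd a) || (x == nd b) then [bseq] else deco (val h) x.
  by rewrite /deco ffunE; case: ifP.
have swp x : (partner (val h) x == nd a) || (partner (val h) x == nd b) = (x == nd a) || (x == nd b).
  by rewrite -{1}Eb -{2}Ea !(inj_eq (inv_inj hK)) orbC.
have hd' : is_half eps1 eps2 d'.
  have /and5P[w nb pl ar li] := valP h; apply/and5P; split.
  - apply/wf_stringsP; split=> [x|x|x]; rewrite ?pd ?hf // ?pd ?hK //.
    by rewrite !dd swp; case: ifP => // _; rewrite hr.
  - by apply/forallP => x; have /existsP[i Ei] := forallP nb x; apply/existsP; exists i; rewrite pd.
  - by apply/forallP => x; apply/forallP => y; have := forallP (forallP pl x) y; rewrite !pd.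
  - apply/forallP => i; apply/forallP => j; have := forallP (forallP ar i) j.
    have eL : exposed_left d' i j = exposed_left (val h) i j.
      by apply: eq_forallb => y; rewrite pd.
    have eR : exposed_right d' i j = exposed_right (val h) i j.
      by apply: eq_forallb => y; rewrite pd.
    rewrite pd eL eR dd; case: ifP => // _ _; rewrite eqxx ?implybT //.
  - by apply/forallP => x; have := forallP li x; rewrite dd.
exists (Sub _ hd'); split=> /=.
- rewrite /ndeco [X in (_ < X)%N](bigD1 (nd a)) //= [X in (X < _)%N](bigD1 (nd a)) //= dd eqxx Wa.
  rewrite /= ltnS.
  by apply: leq_sum => x _; rewrite dd; case: ifP.
- by rewrite [LHS]surjective_pairing -/(partner _ _) -/(deco _ _) pd dd eqxx Ea.
- by rewrite [LHS]surjective_pairing -/(partner _ _) -/(deco _ _) pd dd eqxx orbT Eb.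
move=> z hz; have wd' := half_wf hd'.
have zz : (z == nd a) || (z == nd b) by case: hz => ->; rewrite eqxx ?orbT.
apply/ffunP => x; rewrite ffunE pd !dd zz.
have Wz y : (y == nd a) || (y == nd b) -> deco (val h) y = [bseq c].
  by case/orP=> /eqP->; apply: word_eq; rewrite ?Wa ?Wb.
have [->|xz] := eqVneq x z.
  by rewrite [RHS]surjective_pairing -/(partner _ _) -/(deco _ _) Wz.
have [E|xz'] := eqVneq x (partner (val h) z).
  have hx : (x == nd a) || (x == nd b) by rewrite E swp.
  by rewrite hx [RHS]surjective_pairing -/(partner _ _) -/(deco _ _) Wz // E hK.
rewrite ffunE ifN //; case: hz xz xz' => ->; rewrite ?Ea ?Eb; by case: eqP => //; case: eqP.
Qed.

Lemma under_arc h a b i : (a < b)%N -> (b < n)%N -> partner (val h) (nd a) = nd b ->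
  (a < i < b)%N -> exists2 j, (a < j < b)%N & partner (val h) (nd i) = nd j.
Proof.
move=> ab bn E /andP[ai ib]; have [hf hK hr] := halfP h.
have /and5P[_ _ pl _ _] := valP h.
have [an i_n] : (a < n)%N /\ (i < n)%N by lia.
have N x y := forallP (forallP pl x) y.
have E' := arc_sym E.
have ia : nd i != nd a by rewrite nd_eq //; lia.
have ib' : nd i != nd b by rewrite nd_eq //; lia.
have := N (nd a) (nd i); rewrite E !pos_nd // ai ib /= -leqNgt.
case: (node_case (partner (val h) (nd i))) => [[j jn Ej]|[c Ej]]; rewrite Ej; last first.
  by rewrite /=; lia.
rewrite pos_nd // => jb; exists j => //.
have := N (nd j) (nd a); rewrite (arc_sym Ej) E !pos_nd // ib andbT ai andbT.
rewrite -leqNgt leq_eqVlt => /predU1P[Ea|aj].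
  by move: Ej; rewrite -Ea => /arc_sym; rewrite E => /nd_inj; lia.
rewrite aj /=; move: jb; rewrite leq_eqVlt => /predU1P[Eb|//].
by move: Ej; rewrite Eb => /arc_sym; rewrite E' => /nd_inj; lia.
Qed.

(** An innermost arc exists: either the arc at [lo] joins neighbours, or the nodes strictly under it
    are again matched among themselves. *)
Lemma small_arc h lo hi : (lo < hi <= n)%N ->
  (forall i, (lo <= i < hi)%N -> exists2 j, (lo <= j < hi)%N & partner (val h) (nd i) = nd j) ->
  exists p, [/\ (lo <= p)%N, (p.+1 < hi)%N & partner (val h) (nd p) = nd p.+1].
Proof.
have [hf hK hr] := halfP h.
have [N] := ubnP (hi - lo); elim: N lo hi => // N IH lo hi hN lh H.
have [|j hj E] := H lo; first by lia.
have jlo : j != lo by apply/eqP => jl; have := hf (nd lo); rewrite E jl eqxx.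
have [Ej|jne] := eqVneq j lo.+1; first by exists lo; rewrite -Ej; split=> //; lia.
have [|||p [h1 h2 h3]] := IH lo.+1 j; [lia|lia| |by exists p; split=> //; lia].
move=> i hi'; have [||||j' hj' E'] := @under_arc h lo j i; [lia|lia|done|lia|].
by exists j' => //; lia.
Qed.

Context (A : hdiag -> Prop).
Hypothesis A_op : forall h h' i, (i <= n)%N -> op i (vb h') = vb h -> A h' -> A h.

Definition arc h a b (w : word) := val h (nd a) = (nd b, w).

Lemma arc_partner h a b w : arc h a b w -> partner (val h) (nd a) = nd b.
Proof. by rewrite /partner => ->. Qed.

Lemma arc_deco h a b w : arc h a b w -> deco (val h) (nd a) = w.
Proof. by rewrite /deco => ->. Qed.

Lemma arc_words h a b : (a < b)%N -> (b < n)%N -> partner (val h) (nd a) = nd b ->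
  [\/ arc h a b [bseq], arc h a b [bseq bL] /\ outL (val h) (nd a) |
      arc h a b [bseq bR] /\ outR (val h) (nd a)].
Proof.
move=> ab bn E; have [i Ei] : exists i : 'I_n, i = a :> nat by exists (ord_of hn a); rewrite val_ord_of //; lia.
have [|W|[o W]|[o W]] := @half_arc _ _ _ _ (val h) (valP h) (ord_of hn a) (ord_of hn b) _ E.
- by rewrite !val_ord_of //; lia.
- by constructor 1; rewrite /arc [LHS]surjective_pairing -/(partner _ _) E; congr (_, _); apply: word_eq.
- by constructor 2; split=> //; rewrite /arc [LHS]surjective_pairing -/(partner _ _) E; congr (_, _); apply: word_eq.
by constructor 3; split=> //; rewrite /arc [LHS]surjective_pairing -/(partner _ _) E; congr (_, _); apply: word_eq.
Qed.

Lemma arc_flip h a b : arc h a b [bseq] -> arc h b a [bseq].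
Proof.
move=> E; have [_ _ hr] := halfP h; have Ep := arc_partner E.
rewrite /arc [LHS]surjective_pairing -/(partner _ _) -/(deco _ _) (arc_sym Ep); congr (_, _).
by apply: word_eq; rewrite -Ep hr (arc_deco E).
Qed.

Lemma arc_sw h h2 a c x y w : (forall z, val h2 z = (sw a c (partner (val h) (sw a c z)),
  deco (val h) (sw a c z))) -> arc h x y w -> val h2 (sw a c (nd x)) = (sw a c (nd y), w).
Proof. by move=> S E; rewrite S swK /partner /deco E. Qed.

Lemma sw_far a c x : (a < n)%N -> (c < n)%N -> (x < n)%N -> a <> x -> c <> x -> sw a c (nd x) = nd x.
Proof. by move=> an cn xn /eqP ax /eqP cx; rewrite swD // nd_eq. Qed.

Lemma left_of_L h a b i : (a < b)%N -> (b < n)%N -> partner (val h) (nd a) = nd b -> outL (val h) (nd a) ->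
  (i < a)%N -> exists2 j, (j < a)%N & partner (val h) (nd i) = nd j.
Proof.
move=> ab bn E o ia; have := o (nd i); rewrite E !nd_eq; [|lia..].
case: eqP => [|_ /(_ isT)]; first by lia.
case: eqP => [|_ /(_ isT)]; first by lia.
rewrite !pos_nd ?ia; [|lia|lia].
case: (node_case (partner (val h) (nd i))) => [[j jn ->]|[c ->]].
  by rewrite pos_nd // => /esym ja; exists j.
by rewrite /=; lia.
Qed.

Lemma right_of_R h p i : (p.+1 < n)%N -> partner (val h) (nd p) = nd p.+1 -> outR (val h) (nd p) ->
  (p.+1 < i < n)%N -> exists2 j, (p.+1 < j < n)%N & partner (val h) (nd i) = nd j.
Proof.
move=> pn E o /andP[pi i_n]; have := o (nd i); rewrite E !nd_eq; [|lia..].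
case: eqP => [|_ /(_ isT)]; first by lia.
case: eqP => [|_ /(_ isT)]; first by lia.
have rp j : (j < n)%N -> right_pos (nd j) = (m.+1 + j)%N by move=> jn; rewrite /= val_ord_of.
rewrite !rp; [|lia|lia].
case: (node_case (partner (val h) (nd i))) => [[j jn Ej]|[c ->]]; last by rewrite /=; lia.
rewrite Ej rp // => H; exists j => //.
have jp : j <> p by move=> jp; move: Ej; rewrite jp => /arc_sym; rewrite E => /nd_inj; lia.
have jp' : j <> p.+1 by move=> jp'; move: Ej; rewrite jp' => /arc_sym; rewrite (arc_sym E) => /nd_inj; lia.
by lia.
Qed.

Section Descent.
Context (N : nat) (IHN : forall h, (ndeco h < N)%N -> A h).

Lemma op0_arc h b : (0 < b < n)%N -> arc h 0 b [bseq bL] -> (ndeco h <= N)%N -> A h.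
Proof.
move=> hb E hN; have Ep := arc_partner E.
have [|||h' [lt E1 _ D]] := @undecorate h 0 b bL _ _ Ep; [lia|lia|by rewrite (arc_deco E)|].
have T : topop hn 0 (val h') = val h by rewrite topop0; apply: D; left.
apply: (@A_op h h' 0) => //; last by apply: IHN; lia.
by rewrite (op_half P (leq0n n) T) topcf0 /deco E1 scale1r.
Qed.

Lemma opn_arc h p : p.+2 = n -> arc h p p.+1 [bseq bR] -> (ndeco h <= N)%N -> A h.
Proof.
move=> hp E hN; have Ep := arc_partner E.
have [|||h' [lt _ E1 D]] := @undecorate h p p.+1 bR _ _ Ep; [lia|lia|by rewrite (arc_deco E)|].
have En : p.+1 = n.-1 by lia.
have T : topop hn n (val h') = val h by rewrite (topopn hn hlab) -/(nd n.-1) -En; apply: D; right.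
apply: (@A_op h h' n) => //; last by apply: IHN; lia.
by rewrite (op_half P (leqnn n) T) (topcfn P hn hlab) -/(nd n.-1) -En /deco E1 scale1r.
Qed.

(** An arc with an $L$ is exposed to the left, so the nodes before it are matched among themselves
    and contain an innermost arc. If this one is undecorated, it is moved to the right until it
    jumps over the end [a], which brings the $L$ two nodes closer to the wall. If it has an $L$, it
    replaces the given arc. It cannot have an $R$, as the lines stand on its right. At the first
    node, the blob comes from $e_0$. *)
Lemma left_phase a h b : (ndeco h <= N)%N -> (a < b)%N -> (b < n)%N -> arc h a b [bseq bL] -> A h.
Proof.
have [M] := ubnP a; elim: M a h b => // M IH a h b aM hN ab bn E.
have [a0|a0] := posnP a; first by rewrite a0 in E ab; apply: (@op0_arc h b) => //; rewrite ab.
have inner d p h' : (a - p <= d)%N -> (ndeco h' <= N)%N -> arc h' a b [bseq bL] ->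
    arc h' p p.+1 [bseq] -> (p.+1 < a)%N -> A h'.
  elim: d p h' => [|d IHd] p h' hd hN' E' C pa; first by lia.
  have [|||h2 [S [[i [i_n O]] _]]] := @move_cup h' p p.+1 p.+2 _ _ _ C; [lia|lia|by rewrite !eqxx|].
  apply: A_op i_n O _; have S' := ndeco_sw S.
  have [Ea|pa'] := eqVneq p.+2 a.
    apply: (IH p h2 b) => //; try lia.
    have := arc_sw S E'; rewrite -{1}Ea swR sw_far //; lia.
  apply: (IHd p.+1 h2) => //; try lia.
    by have := arc_sw S E'; rewrite !sw_far //; lia.
  by have := arc_sw S (arc_flip C); rewrite swL sw_far //; lia.
have Ep := arc_partner E.
have oL : outL (val h) (nd a).
  by case: (arc_words ab bn Ep) => [|[]|[]] //; rewrite /arc E => -[].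
have cl := left_of_L ab bn Ep oL.
have [||p [_ pa Cp]] := @small_arc h 0 a; [lia| |].
  by move=> i /cl[j ja Ej]; exists j.
case: (arc_words (ltnSn p) _ Cp) => [|C|[C _]|[C oR]]; first by lia.
- exact: (inner _ p h (leqnn _)).
- by apply: (IH p h p.+1) => //; lia.
have [x Ex] := half_bottom (valP h) ord0.
have Ex' : partner (val h) (nd x) = inr ord0.
  by have [_ hK _] := halfP h; rewrite -inl_nd -Ex hK.
have [xa|ax] := ltnP x a; first by have [j _] := cl x xa; rewrite Ex'.
have [||j _] := @right_of_R h p x _ Cp oR; [lia|by have := ltn_ord x; lia|by rewrite Ex'].
Qed.

Definition lead j h := (j.*2 <= n)%N /\ forall t, (t < j)%N -> arc h t.*2 t.*2.+1 [bseq].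

Lemma lead_in j h i : lead j h -> (i < j.*2)%N -> exists2 i', (i' < j.*2)%N & partner (val h) (nd i) = nd i'.
Proof.
move=> [hj L] hi; have tj : (i./2 < j)%N by lia.
have E := arc_partner (L _ tj); case io : (odd i).
  by exists i.-1; [lia|rewrite (_ : i = i./2.*2.+1) ?(arc_sym E) //=; lia].
by exists i.+1; [lia|rewrite (_ : i = i./2.*2) ?E //; lia].
Qed.

Lemma move_left j p h : (forall h', (ndeco h' <= N)%N -> lead j.+1 h' -> A h') ->
  lead j h -> (ndeco h <= N)%N -> (j.*2 <= p)%N -> (p.+1 < n)%N -> arc h p p.+1 [bseq] -> A h.
Proof.
move=> IH; elim: p h => [|p IHp] h [jn L] hN jp pn C.
  apply: IH => //; split; first by lia.
  by move=> t tj; rewrite (_ : t = 0%N) //; lia.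
have [E|ne] := eqVneq j.*2 p.+1.
  apply: IH => //; split; first by lia.
  by move=> t; rewrite ltnS leq_eqVlt => /predU1P[->|/L//]; rewrite E.
have [|||h2 [S [[i [i_n O]] _]]] := @move_cup h p.+2 p.+1 p _ _ _ (arc_flip C); [lia|lia|by rewrite !eqxx orbT|].
apply: A_op i_n O _; have S' := ndeco_sw S.
apply: IHp; rewrite ?S' //; try lia.
  split=> // t tj; have := arc_sw S (L t tj); rewrite !sw_far //; lia.
by have := arc_sw S (arc_flip C); rewrite swL sw_far //; lia.
Qed.

(** An $R$ on an arc joining neighbours means that the nodes to its right are matched among
    themselves, so there is a further innermost arc there, unless the arc is at the right end, where
    the blob comes from $e_n$. The search to the right thus terminates. *)
Lemma small_phase j p h : (forall h', (ndeco h' <= N)%N -> lead j.+1 h' -> A h') ->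
  lead j h -> (ndeco h <= N)%N -> (j.*2 <= p)%N -> (p.+1 < n)%N -> partner (val h) (nd p) = nd p.+1 -> A h.
Proof.
move=> IH L hN; have [M] := ubnP (n - p); elim: M p => // M IHM p hM jp pn E.
case: (arc_words (ltnSn p) pn E) => [C|[C _]|[C oR]].
- exact: (move_left IH L hN jp pn C).
- exact: (left_phase hN (ltnSn p) pn C).
have [Ep|np] := eqVneq p.+2 n; first exact: (opn_arc Ep C).
have [||p' [h1 h2 h3]] := @small_arc h p.+2 n; [lia| |].
  by move=> i hi; have [j' hj' Ej] := right_of_R pn E oR hi; exists j'.
by apply: (IHM p') => //; lia.
Qed.

Definition tail_lines j h := forall i, (j.*2 <= i < n)%N -> exists b, partner (val h) (nd i) = inr b.

Hypothesis A_base : forall j h, lead j h -> tail_lines j h -> A h.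

Lemma lead_phase j h : lead j h -> (ndeco h <= N)%N -> A h.
Proof.
have [M] := ubnP (n - j); elim: M j h => // M IH j h hM L hN; have [jn _] := L.
case: (pselect (tail_lines j h)) => [T|T]; first exact: A_base L T.
have [i [i' [ji ii' i'n E]]] : exists i i', [/\ (j.*2 <= i)%N, (i < i')%N, (i' < n)%N & partner (val h) (nd i) = nd i'].
  apply: contrapT => no; apply: T => i /andP[ji i_n].
  case: (node_case (partner (val h) (nd i))) => [[i' i'n E]|//]; case: no.
  have ji' : (j.*2 <= i')%N.
    rewrite leqNgt; apply/negP => /(lead_in L)[i2 h2]; rewrite (arc_sym E) => /nd_inj; lia.
  have [hf _ _] := halfP h.
  have ne : i <> i' by move=> ii; have := hf (nd i); rewrite E ii eqxx.
  have [lt|lt] : (i < i')%N \/ (i' < i)%N by lia.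
    by exists i, i'.
  by exists i', i; split=> //; rewrite (arc_sym E).
have [||p [h1 h2 h3]] := @small_arc h i i'.+1; [lia| |].
  move=> x hx; have [->|xi] := eqVneq x i; first by exists i' => //; lia.
  have [->|xi'] := eqVneq x i'; first by exists i; [lia|apply: arc_sym].
  have [|y hy Ey] := under_arc ii' i'n E (i := x); first by lia.
  by exists y => //; lia.
apply: (small_phase _ L hN _ _ h3); [|lia|lia].
by move=> h' hN' L'; have [jn' _] := L'; apply: (IH j.+1) => //; lia.
Qed.
End Descent.

Lemma generated h : (forall j h, lead j h -> tail_lines j h -> A h) -> A h.
Proof.
move=> base; have [N] := ubnP (ndeco h); elim: N h => // N IH h hN.
by apply: (lead_phase IH base (j := 0)).
Qed.
End Cyclic.

(** * Specialization to the cell module *)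

Section Final.
Context {k : fieldType} (q Q1 Q2 kLR : k) {n m : nat} {eps1 eps2 : int}.
Hypotheses (hn : (0 < n)%N) (q0 : q != 0) (q21 : q ^+ 2 != 1) (Q10 : Q1 != 0) (Q20 : Q2 != 0).
Hypotheses (hw1 : qnum q Q1 Q2 1 1 0 != 0) (hw2 : qnum q Q1 Q2 1 0 1 != 0).
Hypothesis hlab : is_label n m eps1 eps2.
Notation P := (qparams q Q1 Q2 kLR).
Notation cellmod := (cellmod k n m eps1 eps2).
Notation vb := (cbasis (k := k) (n := n) (m := m) (eps1 := eps1) (eps2 := eps2)).
Notation op := (@op k P n m eps1 eps2).
Implicit Types (v : cellmod).

Lemma qq0 : q - q^-1 != 0.
Proof.
apply: contraNneq q21 => /eqP; rewrite subr_eq0 => /eqP E.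
by rewrite expr2 {2}E divff.
Qed.

Definition kapL : k := q * Q1 - q^-1 * Q1^-1.
Definition kapR : k := q * Q2 - q^-1 * Q2^-1.

Lemma qnumE (a b1 b2 : int) : (q - q^-1) * qnum q Q1 Q2 a b1 b2 =
  q ^ a * Q1 ^ b1 * Q2 ^ b2 - q ^ (- a) * Q1 ^ (- b1) * Q2 ^ (- b2).
Proof. by rewrite /qnum mulrC divfK // qq0. Qed.

Lemma kapL_qnum : (q - q^-1) * qnum q Q1 Q2 1 1 0 = kapL.
Proof. by rewrite qnumE oppr0 !expr1z !exprN1 !expr0z !mulr1. Qed.

Lemma kapR_qnum : (q - q^-1) * qnum q Q1 Q2 1 0 1 = kapR.
Proof. by rewrite qnumE oppr0 !expr1z !exprN1 !expr0z !mulr1. Qed.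

Lemma kapL_delta : kapL * deltaL P = Q1 - Q1^-1.
Proof.
rewrite -kapL_qnum /= -mulrA [X in _ * X]mulrC divfK //.
by rewrite qnumE !oppr0 !expr1z !exprN1 !expr0z !mulr1 !mul1r.
Qed.

Lemma kapR_delta : kapR * deltaR P = Q2 - Q2^-1.
Proof.
rewrite -kapR_qnum /= -mulrA [X in _ * X]mulrC divfK //.
by rewrite qnumE !oppr0 !expr1z !exprN1 !expr0z !mulr1 !mul1r.
Qed.

Lemma delta_q : delta P = q + q^-1.
Proof.
apply: (mulfI qq0); rewrite qnumE !oppr0 !expr0z !mulr1 -invr_expz -exprnP.
by field; rewrite q0.
Qed.

Lemma opZ i c v : op i (c *: v) = c *: op i v.
Proof. exact: linearZ. Qed.

(** The rescaling that gives the blob relations of the evaluation part. It equals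
    $(q-q^{-1})[w_1+1]$ or $(q-q^{-1})[w_2+1]$ at the walls, hence is invertible, and generation by
    [op] is also generation by [ee]. *)
Definition kap i : k := if i == 0%N then kapL else if i == n then kapR else 1.
Definition ee i : {linear cellmod -> cellmod} := (kap i \*: op i).

Lemma ee_mid i v : (0 < i < n)%N -> ee i v = op i v.
Proof. by move=> hi /=; rewrite /kap !ifN ?scale1r //; lia. Qed.

Lemma ee0 v : ee 0 v = kapL *: op 0 v. Proof. by []. Qed.
Lemma een v : ee n v = kapR *: op n v.
Proof. by rewrite /= /kap eqxx ifN //; lia. Qed.

Lemma ee_sq i v : (0 < i < n)%N -> ee i (ee i v) = (q + q^-1) *: ee i v.
Proof. by move=> hi; rewrite !ee_mid // (op_sq P hn hlab) // delta_q. Qed.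

Lemma ee_tl i j v : (0 < i < n)%N -> (0 < j < n)%N -> (j == i.+1) || (i == j.+1) ->
  ee i (ee j (ee i v)) = ee i v.
Proof. by move=> hi hj ij; rewrite !ee_mid // (op_tl P hn hlab). Qed.

Lemma ee_comm i j v : (i.+1 < j <= n)%N -> ee i (ee j v) = ee j (ee i v).
Proof.
move=> /andP[ij jn]; rewrite /ee /= !opZ (op_comm P hn hlab) // !scalerA.
by rewrite mulrC.
Qed.

Lemma ee_0sq v : ee 0 (ee 0 v) = (Q1 - Q1^-1) *: ee 0 v.
Proof. by rewrite !ee0 opZ (op_0 P hn) -kapL_delta !scalerA mulrAC. Qed.

Lemma ee_nsq v : ee n (ee n v) = (Q2 - Q2^-1) *: ee n v.
Proof. by rewrite !een opZ (op_n P hn hlab) -kapR_delta !scalerA mulrAC. Qed.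

Lemma ee_101 v : (1 < n)%N -> ee 1 (ee 0 (ee 1 v)) = kapL *: ee 1 v.
Proof. by move=> n1; have h : (0 < 1 < n)%N by []; rewrite (ee_mid (ee 0 (ee 1 v)) h) ee0 opZ (ee_mid v h) (op_101 P hn hlab) // scale1r. Qed.

Lemma ee_n1n v : (1 < n)%N -> ee n.-1 (ee n (ee n.-1 v)) = kapR *: ee n.-1 v.
Proof.
move=> n1; have h : (0 < n.-1 < n)%N by lia.
by rewrite (ee_mid (ee n (ee n.-1 v)) h) een opZ (ee_mid v h) (op_n1n P hn hlab) // scale1r.
Qed.

Notation hg := (hg n q Q1 Q2 ee).
Notation hgi := (hgi n q Q1 Q2 ee).
Notation X := (hX n hg hgi).
Notation J := (hJ n hg hgi).
Notation Ji := (hJi n hg hgi).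

Lemma ee_gK i : (i <= n)%N -> cancel (hg i) (hgi i).
Proof. exact: (hgK hn q0 Q10 Q20 ee_sq ee_0sq ee_nsq). Qed.

Lemma ee_giK i : (i <= n)%N -> cancel (hgi i) (hg i).
Proof. exact: (hgiK hn q0 Q10 Q20 ee_sq ee_0sq ee_nsq). Qed.

Notation gop := (@gop k q Q1 Q2 kLR n m eps1 eps2).

Lemma gop1 i v : (i <= n)%N -> gop i 1 v = hg i v.
Proof.
move=> hi; rewrite gopE // !expr1z !exprN1.
have [->|i0] := eqVneq i 0%N; first by rewrite hg0.
have [->|ine] := eqVneq i n; first by rewrite hgn // een.
by rewrite hgE ?ee_mid //; lia.
Qed.

Lemma gopN1 i v : (i <= n)%N -> gop i (-1) v = hgi i v.
Proof.
move=> hi; rewrite gopE // !opprK !expr1z !exprN1.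
have [->|i0] := eqVneq i 0%N; first by rewrite hgi0 ee0 -scaleNr opprB.
have [->|ine] := eqVneq i n; first by rewrite hgin // een -scaleNr opprB.
by rewrite hgiE ?ee_mid //; lia.
Qed.

Definition wact (w : gword) v := foldr (fun x u => gop x.1 x.2 u) v w.

Definition okw (w : gword) := all (fun x : nat * int => (x.1 <= n)%N && (x.2 \in [:: 1; -1])) w.

Lemma wact_cat w1 w2 v : wact (w1 ++ w2) v = wact w1 (wact w2 v).
Proof. by rewrite /wact foldr_cat. Qed.

Lemma wact_inv w v : okw w -> wact (ginv w) (wact w v) = v.
Proof.
elim: w => [//|[i s] w IH] /= /andP[/andP[/= hi hs] hw].
rewrite /ginv rev_cons map_rcons -cats1 wact_cat -[map _ _]/(ginv w) /=.
move: hs; rewrite !inE => /orP[]/eqP->.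
  by rewrite gop1 // gopN1 // ee_gK // IH.
by rewrite opprK gopN1 // gop1 // ee_giK // IH.
Qed.

Lemma wact_X j v : (j <= n)%N ->
  wact ([seq (i, -1) | i <- iota j (n - j)] ++ (n, 1) :: [seq (i, 1) | i <- rev (iota j (n - j))]) v = X j v.
Proof.
move=> jn; move: j jn v; apply: down_ind => [v|j jn IH v].
  by rewrite subnn /= Xn gop1.
rewrite XE // (_ : n - j = (n - j.+1).+1)%N /=; last by lia.
rewrite gopN1 1?ltnW //; congr (hgi _ _).
rewrite rev_cons map_rcons -cats1 -cat_cons catA wact_cat IH.
by rewrite /= gop1 // ltnW.
Qed.

Lemma wact_J i v : (i < n)%N -> okw (Jword n i) /\ wact (Jword n i) v = J i v.
Proof.
elim: i v => [|i IH] v hi /=.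
  split.
    apply/allP => x; rewrite /J0word mem_cat in_cons mem_cat mem_seq1.
    case/or4P=> [/mapP[i]|/eqP->|/mapP[i]|/eqP->] /=; rewrite ?leqnn // ?mem_rev mem_iota => hi' ->;
      by rewrite /= !inE eqxx ?orbT andbT; lia.
  by rewrite /J0word -cat_cons catA wact_cat -[n.-1]subn1 wact_X //= gop1.
split; first by rewrite /okw all_rcons /= -/(okw _) (IH 0 _).1 ?inE ?eqxx //; lia.
by rewrite -cats1 wact_cat gop1 ?(IH _ _).2 /= ?gop1 //; lia.
Qed.

Lemma act_Z v : act P (Z q Q1 Q2 kLR n) v = hZ n hg hgi v.
Proof.
rewrite /Z act_sum /hZ; apply: eq_bigr => i _; rewrite /Defs.J /Defs.Jinv.
have hi := ltn_ord i.
have a1 w u : act P (geval q Q1 Q2 kLR n w) u = wact w u by exact: act_geval.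
rewrite actD !a1; congr (_ + _); first by case: (wact_J v hi).
(* The inverse word is not followed letter by letter: [v] is written as the image of [Ji i v] under
   the word of $J_i$, which [ginv] undoes. *)
have [_ K] := JK ee_gK ee_giK hi.
have [ok E] := wact_J (Ji i v) hi.
by rewrite -{1}[v]K -E wact_inv.
Qed.

Definition x0 := Q1 ^ eps1.
Definition y2 := Q2 ^ eps2.

Lemma eps_cases : (eps1 = 1 \/ eps1 = -1) /\ (eps2 = 1 \/ eps2 = -1).
Proof.
case/and5P: hlab => _ _ h1 h2 _; move: h1 h2; rewrite !inE.
by case/orP=> /eqP-> /orP[]/eqP->; split; auto.
Qed.


Lemma dec_id (d : ddiag n m.+1) z a : wf_strings d -> deco d z = [:: a] :> seq blob -> dec z a d = d.
Proof.
move=> wd W; have [hf hK hr] := wf_stringsP _ wd; apply/ffunP => x.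
apply: (dec_ind wd (z := z) (a := a) (Q := fun x y => y = d x)) => {x} [||//].
  rewrite [RHS]surjective_pairing -/(partner _ _) -/(deco _ _); congr (_, _).
  by apply: word_eq; rewrite W /= eqxx.
rewrite [RHS]surjective_pairing -/(partner _ _) -/(deco _ _) hK; congr (_, _).
by apply: word_eq; rewrite hr W /= eqxx.
Qed.

Lemma op_line (h : hdiag n m eps1 eps2) i z a b : (i <= n)%N ->
  topop hn i (val h) = dec z a (val h) -> topcf P hn i (val h) = cons_coef P a (deco (val h) z) ->
  partner (val h) z = inr b ->
  (line_word eps1 eps2 b = [::] -> op i (vb h) = 0) /\
  (line_word eps1 eps2 b = [:: a] -> op i (vb h) = delta_of P a *: vb h).
Proof.
move=> hi Et Ec E; have wd := half_wf (valP h); have [hf hK hr] := halfP h.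
have W := half_line (valP h) b.
split=> Wb.
  rewrite (op_basis P hn) //; case: insubP => [h' hh' _|//].
  case: (half_not_dead hh'); right; exists b; split=> //.
  by rewrite Et /deco -E dec_z' //= E -/(deco _ _) W Wb.
have Wz : deco (val h) z = [:: a] :> seq blob by rewrite -[z]hK E hr W Wb.
rewrite (op_half P hi (h' := h)); last by rewrite Et dec_id.
by rewrite Ec Wz /= eqxx.
Qed.

(** The origin of the eigenvalue $Q_1^{\epsilon_1}$: $e_0$ kills the line if $\epsilon_1=1$;
    otherwise it acts by $\delta_L$, and $Q_1-(Q_1-Q_1^{-1})=Q_1^{-1}$. *)
Lemma hg0_line (h : hdiag n m eps1 eps2) : partner (val h) (nd hn 0) = inr ord0 ->
  hg 0 (vb h) = x0 *: vb h.
Proof.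
move=> E; have [o1 o2] := op_line (leq0n n) (topop0 hn _) (topcf0 P hn _) E.
rewrite hg0 ee0; have [[e1|e1] _] := eps_cases.
  have -> : x0 = Q1 by rewrite /x0 e1 expr1z.
  rewrite o1 ?scaler0 ?subr0 // /line_word {1}e1 /=.
  by case: ifP => // /andP[/eqP m0]; have [_ ->] := label_m0 hlab (esym m0).
have -> : x0 = Q1^-1 by rewrite /x0 e1 exprN1.
have m0 : m <> 0%N by move=> /(label_m0 hlab)[]; rewrite e1.
rewrite o2; last by rewrite /line_word {1}e1 /=; case: eqP => // /esym.
by rewrite scalerA kapL_delta -scalerBl; congr (_ *: _); ring.
Qed.

Lemma hgn_line (h : hdiag n m eps1 eps2) : partner (val h) (nd hn n.-1) = inr ord_max ->
  hg n (vb h) = y2 *: vb h.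
Proof.
move=> E; have [o1 o2] := op_line (leqnn n) (topopn hn hlab _) (topcfn P hn hlab _) E.
rewrite hgn // een; have [_ [e1|e1]] := eps_cases.
  have -> : y2 = Q2 by rewrite /y2 e1 expr1z.
  rewrite o1 ?scaler0 ?subr0 // /line_word {1}e1 /= andbF cats0.
  by case: ifP => // /andP[/eqP m0]; have [-> _] := label_m0 hlab m0.
have -> : y2 = Q2^-1 by rewrite /y2 e1 exprN1.
have m0 : m <> 0%N by move=> /(label_m0 hlab)[_]; rewrite e1.
rewrite o2; last by rewrite /line_word {1}e1 /= eqxx; case: eqP.
by rewrite scalerA kapR_delta -scalerBl; congr (_ *: _); ring.
Qed.

Notation arc := (arc hn).
Notation lead := (lead hn).

Section Base.
Context (j : nat) (h : hdiag n m eps1 eps2).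
Hypotheses (L : lead j h) (T : tail_lines hn j h).

(** Two inequalities, from injections in both directions between the nodes after the cups and the
    lower ends of the lines. *)
Lemma base_count : n = (j.*2 + m).+1.
Proof.
have [hf hK hr] := halfP h; have [jn _] := L.
have K b : exists2 x, (j.*2 <= x < n)%N & partner (val h) (inr b) = nd hn x.
  have [x Ex] := half_bottom (valP h) b; exists (x : nat); last by rewrite Ex inl_nd.
  rewrite ltn_ord andbT leqNgt; apply/negP => /(lead_in hlab L)[i' _].
  by rewrite -inl_nd -Ex hK.
have [x0 hx0 _] := K ord0.
have hn' : (0 < n - j.*2)%N by lia.
pose f (i : 'I_(n - j.*2)) := if partner (val h) (nd hn (j.*2 + i)) is inr b then b else ord0.
pose f' (b : 'I_m.+1) := if partner (val h) (inr b) is inl x then ord_of hn' (x - j.*2) else ord_of hn' 0.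
have If : injective f.
  move=> i1 i2; rewrite /f; have l1 := ltn_ord i1; have l2 := ltn_ord i2.
  have [|b1 E1] := T (i := (j.*2 + i1)%N); first by lia.
  have [|b2 E2] := T (i := (j.*2 + i2)%N); first by lia.
  rewrite E1 E2 => Eb; rewrite -Eb -E1 in E2; apply: val_inj => /=.
  by have /nd_inj := inv_inj hK E2; lia.
have If' : injective f'.
  move=> b1 b2; rewrite /f'; have [x1 h1 E1] := K b1; have [x2 h2 E2] := K b2.
  have [[l1 l2] [l3 l4]] : ((x1 < n)%N /\ (x2 < n)%N) /\ (x1 - j.*2 < n - j.*2)%N /\ (x2 - j.*2 < n - j.*2)%N.
    by clear -h1 h2; lia.
  rewrite E1 E2 => /(congr1 val) /=.
  rewrite (val_ord_of hn l1) (val_ord_of hn l2) (val_ord_of hn' l3) (val_ord_of hn' l4) => Ex.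
  have {}Ex : x1 = x2 by clear -Ex h1 h2; lia.
  by rewrite -Ex -E1 in E2; have := inv_inj hK E2 => -[].
by have := leq_card f If; have := leq_card f' If'; rewrite !card_ord; lia.
Qed.

Lemma base_first : partner (val h) (nd hn j.*2) = inr ord0.
Proof.
have [hf hK hr] := halfP h; have nE := base_count.
have [|b Eb] := T (i := j.*2); first by lia.
have [x Ex] := half_bottom (valP h) ord0.
have Px : partner (val h) (inl x) = inr ord0 by rewrite -Ex hK.
have [b0|b0] := posnP b; first by rewrite Eb; congr inr; apply: val_inj.
have /and5P[_ _ pl _ _] := valP h.
have := forallP (forallP pl (nd hn j.*2)) (inl x); rewrite Eb Px /= val_ord_of; last by lia.
have lx := ltn_ord x; have lb := ltn_ord b.
have xj : (j.*2 <= x)%N.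
  by rewrite leqNgt; apply/negP => /(lead_in hlab L)[i' _]; rewrite -inl_nd -Ex hK.
have xj' : x <> j.*2 :> nat.
  move=> xj'; move: Eb; rewrite -xj' -inl_nd -Ex hK => -[] /(congr1 val) /= b00; lia.
by lia.
Qed.

Lemma base_last : partner (val h) (nd hn n.-1) = inr ord_max.
Proof.
have [hf hK hr] := halfP h; have nE := base_count.
have [|b Eb] := T (i := n.-1); first by lia.
have [x Ex] := half_bottom (valP h) ord_max.
have Px : partner (val h) (inl x) = inr ord_max by rewrite -Ex hK.
have [bm|bm] := eqVneq (b : nat) m; first by rewrite Eb; congr inr; apply: val_inj.
have /and5P[_ _ pl _ _] := valP h.
have := forallP (forallP pl (inl x)) (nd hn n.-1); rewrite Eb Px /= val_ord_of; last by lia.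
have lx := ltn_ord x; have lb := ltn_ord b.
have xj' : x <> n.-1 :> nat.
  move=> xj'; move: Eb; rewrite -xj' -inl_nd -Ex hK => -[] /(congr1 val) /= b00; lia.
by lia.
Qed.

Lemma base_cup t : (t < j)%N -> vb h = ee t.*2.+1 (ee t.*2.+2 (vb h)).
Proof.
move=> tj; have nE := base_count; have [_ C] := L.
have [h1' h2'] : (0 < t.*2.+1 < n)%N /\ (0 < t.*2.+2 < n)%N by lia.
have ij : (t.*2.+2 == t.*2.+2) || (t.*2.+1 == t.*2.+3) by rewrite eqxx.
have [h2 [_ O1 O2]] := zigzag P hlab h1' h2' ij (C t tj).
by rewrite !ee_mid ?O1 ?O2 //; lia.
Qed.

Lemma base_line i : (j.*2 < i < n)%N -> ee i (vb h) = 0.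
Proof.
move=> hi; have wd := half_wf (valP h); have [hf hK hr] := halfP h.
have [|b1 E1] := T (i := i.-1); first by lia.
have [|b2 E2] := T (i := i); first by lia.
rewrite /= (op_basis P hn); last by lia.
case: insubP => [h' hh' _|_]; last by rewrite scaler0.
case: (half_not_dead hh'); left; exists b1, b2.
rewrite (topopE hn hlab); last by lia.
have nj : partner (val h) (nd hn i.-1) != nd hn i by rewrite E1.
by rewrite -E1 {1}/partner (surg_join wd nj) /= E2.
Qed.

(** The cups are moved from the last one to the first. The position of the first line and the cups
    still in place are recorded because the next move needs both. *)
Lemma base_even d : (d <= j)%N -> exists H, [/\ even_e ee (vb h) d (j - d).+1 = vb H,
  partner (val H) (nd hn (j - d).*2) = inr ord0 & lead (j - d) H].
Proof.
have nE := base_count.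
elim: d => [_|d IH dj]; first by exists h; rewrite subn0; split=> //; apply: base_first.
have [H [E EH [_ LH]]] := IH (ltnW dj).
have Et : (j - d = (j - d.+1).+1)%N by lia.
move: (j - d.+1)%N Et (subSS d j) => t Et _; rewrite Et in E EH LH.
have tj : (t < j)%N by lia.
have [|||h2 [S [_ O]]] := @move_cup k P n m eps1 eps2 hn hlab H t.*2 t.*2.+1 t.*2.+2 _ _ _ (LH t (ltnSn t)); [lia|lia|by rewrite !eqxx|].
exists h2; split.
- by rewrite -[LHS]/(ee t.+1.*2 (even_e ee (vb h) d t.+2)) E ee_mid ?O //; lia.
- rewrite /partner S swL -[t.*2.+2]/t.+1.*2 EH /= swD //.
split; first by lia.
move=> u ut; have := arc_sw S (LH u (ltnW ut)).
by rewrite !(sw_far hn) //; clear -ut tj nE; lia.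
Qed.

Lemma base_Z : act P (Z q Q1 Q2 kLR n) (vb h) = alpha q Q1 Q2 n m eps1 eps2 *: vb h.
Proof.
rewrite act_Z.
have [H [E EH _]] := base_even (leqnn j); rewrite subnn in E EH.
have tE : Q1 + Q1^-1 = x0 + x0^-1.
  by rewrite /x0; have [[->|->] _] := eps_cases; rewrite ?expr1z // exprN1 invrK addrC.
have uE : Q2 + Q2^-1 = y2 + y2^-1.
  by rewrite /y2; have [_ [->|->]] := eps_cases; rewrite ?expr1z // exprN1 invrK addrC.
have x00 : x0 != 0 by rewrite expfz_neq0.
have y20 : y2 != 0 by rewrite expfz_neq0.
have h0_n := hgn_line base_last.
have h0_0 : hg 0 (even_e ee (vb h) j 1) = x0 *: even_e ee (vb h) j 1 by rewrite E hg0_line.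
rewrite (Z_h0 hn q0 Q10 Q20 ee_sq ee_tl ee_comm ee_0sq ee_nsq ee_101 ee_n1n base_count x00 y20 tE uE
  base_cup base_line h0_n h0_0 q21).
congr (_ *: _); rewrite /alpha /qnum !expr0z !mulr1 /x0 /y2.
by rewrite -!invr_expz -!exprnP !exprVn.
Qed.
End Base.

Lemma kap_neq0 i : kap i != 0.
Proof.
rewrite /kap; case: (i =P 0%N) => _; first by rewrite -kapL_qnum mulf_neq0 ?qq0.
by case: (i =P n) => _; [rewrite -kapR_qnum mulf_neq0 ?qq0|exact: oner_neq0].
Qed.

Lemma act_Z_vb (h : hdiag n m eps1 eps2) : act P (Z q Q1 Q2 kLR n) (vb h) = alpha q Q1 Q2 n m eps1 eps2 *: vb h.
Proof.
(* The centrality lemmas assume [1 < n]. With a single node there is no arc, so every half-diagram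
   is already a base case. *)
have [n1|n2] := leqP n 1.
  apply: (@base_Z 0); first by split.
  move=> i hi; case: (node_case hn (partner (val h) (nd hn i))) => [[j jn E]|//].
  have [hf _ _] := halfP h; have := hf (nd hn i); rewrite E.
  by rewrite (_ : j = i) ?eqxx //; lia.
pose A h := act P (Z q Q1 Q2 kLR n) (vb h) = alpha q Q1 Q2 n m eps1 eps2 *: vb h.
apply: (@generated k P n m eps1 eps2 hn hlab A _ h); last by move=> j h'; apply: base_Z.
move=> {}h h' i hi E; rewrite /A => Ah.
have c := e_comm_Z hn q0 Q10 Q20 ee_sq ee_tl ee_comm ee_0sq ee_nsq ee_101 ee_n1n (vb h') n2 hi.
have {}E : vb h = (kap i)^-1 *: ee i (vb h') by rewrite /= scalerA mulVf ?kap_neq0 // scale1r E.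
have lz c' w : act P (Z q Q1 Q2 kLR n) (c' *: w) = c' *: act P (Z q Q1 Q2 kLR n) w by exact: linearZ.
have ez c' w : ee i (c' *: w) = c' *: ee i w by exact: linearZ.
by rewrite E lz act_Z c -act_Z Ah ez !(scalerA _ _ (ee i _)) mulrC.
Qed.
End Final.

Theorem corollary6p9 (k : fieldType) (q Q1 Q2 kLR : k) (n m : nat) (eps1 eps2 : int)
    (hn : (1 <= n)%N) (hq : q != 0) (hq2 : q ^+ 2 != 1)
    (hQ1 : Q1 != 0) (hQ2 : Q2 != 0)
    (hw1 : qnum q Q1 Q2 1 1 0 != 0) (hw2 : qnum q Q1 Q2 1 0 1 != 0)
    (hlabel : is_label n m eps1 eps2) :
  (forall v : cellmod k n m eps1 eps2,
     act (qparams q Q1 Q2 kLR) (Z q Q1 Q2 kLR n) v = alpha q Q1 Q2 n m eps1 eps2 *: v) /\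
  (qnum q Q1 Q2 (- m%:Z) eps1 eps2 != 0 ->
     alpha q Q1 Q2 n m eps1 eps2 =
       qnum q Q1 Q2 n 0 0 * (qnum q Q1 Q2 (2 * - m%:Z) (2 * eps1) (2 * eps2)
                             / qnum q Q1 Q2 (- m%:Z) eps1 eps2)).
Proof.
split=> [v|h0].
  rewrite (cellE v) linear_sum scaler_sumr; apply: eq_bigr => h _.
  by rewrite linearZ /= (act_Z_vb kLR hn hq hq2 hQ1 hQ2 hw1 hw2 hlabel) !scalerA mulrC.
(* The identity is $[2x]=[x](q^x+q^{-x})$, a difference of two squares after multiplication by
   $q-q^{-1}$. *)
rewrite /alpha; congr (_ * _); apply: (canRL (mulfK h0)).
apply: (mulfI (qq0 hq hq2)).
have sq (x : k) (e : int) : x ^ (2 * e) = x ^ e * x ^ e by rewrite mulrC -exprz_exp.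
rewrite mulrCA !qnumE // -!mulrN !sq !opprK.
by ring.
Qed.
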